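(* For every prime $p>3$ and every integer $d\geq 2$, $e_{\mathrm{HK}}(S_{p,d})>e_{\mathrm{HK}}(R_{p,d})$.
   Context: For a Noetherian local ring $(R,\mathfrak{m})$ of prime characteristic $p$ and dimension $d$, let $\mathfrak{m}^{[p^e]}=(a^{p^e}:a\in\mathfrak{m})$, $\mathrm{HK}_e(R)=\operatorname{length}_R(R/\mathfrak{m}^{[p^e]})$, and $e_{\mathrm{HK}}(R)=\lim_{e\to\infty}\mathrm{HK}_e(R)/p^{ed}$ (the Hilbert–Kunz multiplicity; the limit exists). The $A_1$ singularity is $R_{p,d}=\mathbb{F}_p[[x_0,\dots,x_d]]/(Q_d)$, where $Q_d=x_0x_1+x_2x_3+\dots+x_{d-1}x_d$ if $d$ is odd and $Q_d=x_0x_1+\dots+x_{d-2}x_{d-1}+x_d^2$ if $d$ is even. The $A_2$ singularity is $S_{p,d}=\mathbb{F}_p[[x_0,\dots,x_d]]/(P_d)$, where $P_d=x_0x_1+\dots+x_{d-3}x_{d-2}+x_{d-1}^2+x_d^3$ if $d$ is odd and $P_d=x_0x_1+\dots+x_{d-2}x_{d-1}+x_d^3$ if $d$ is even. *)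

(* Defs.v *)
From HB Require Import structures.
From mathcomp Require Import all_boot all_order all_algebra.
From mathcomp Require Import generic_quotient ring_quotient.
From mathcomp Require Import boolp classical_sets functions reals topology.
From mathcomp Require Import normedtype sequences.
(* The notations of mpoly clash with those of the analysis library. *)
From mathcomp.multinomials Require Import -(notations) mpoly.

Set Implicit Arguments.
Unset Strict Implicit.
Unset Printing Implicit Defensive.

Import Order.TTheory GRing.Theory Num.Theory.
Import numFieldNormedType.Exports.

Local Open Scope classical_set_scope.
Local Open Scope ring_scope.
Local Open Scope quotient_scope.

Section Length.
Variables (A : pzRingType) (M : lmodType A).

Definition submodule (N : set M) : Prop :=
  N 0 /\ forall (a : A) (u v : M), N u -> N v -> N (a *: u + v).

Definition submodule_chain (n : nat) (N : nat -> set M) : Prop :=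
  (forall i, (i <= n)%N -> submodule (N i)) /\
  (forall i, (i < n)%N -> N i `<` N i.+1).

(* [supremum 0%N] of an unbounded set of naturals is 0, so that modules of
   infinite length get the junk value 0. *)
Definition length : nat :=
  supremum 0%N [set n | exists N, submodule_chain n N].

End Length.

Section Ideals.
Variable A : comPzRingType.

Definition ideal (I : set A) : Prop :=
  I 0 /\ forall a u v : A, I u -> I v -> I (a * u + v).

Definition prime_ideal (P : set A) : Prop :=
  [/\ ideal P, ~ P 1 & forall a b : A, P (a * b) -> P a \/ P b].

Definition maximal_ideal (M : set A) : Prop :=
  [/\ ideal M, ~ M 1 &
      forall I : set A, ideal I -> ~ I 1 -> M `<=` I -> I = M].

Definition prime_chain (n : nat) (P : nat -> set A) : Prop :=
  (forall i, (i <= n)%N -> prime_ideal (P i)) /\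
  (forall i, (i < n)%N -> P i `<` P i.+1).

(* As for [length], the value is 0 when the dimension is infinite. *)
Definition krull_dim : nat :=
  supremum 0%N [set n | exists P, prime_chain n P].

(* Meaningful for local rings, which have exactly one maximal ideal. *)
Definition local_max_ideal : set A := xget set0 maximal_ideal.

Definition ideal_gen (X : set A) : set A := smallest ideal X.

Lemma ideal_gen_ideal (X : set A) : ideal (ideal_gen X).
Proof.
split=> [I [[I0 _] _] //|a u v Xu Xv I [idI XI]].
by apply: idI.2; [exact: Xu|exact: Xv].
Qed.

Definition ideal_pred (X : set A) : {pred A} := fun a => `[< ideal_gen X a >].

Lemma ideal_predP (X : set A) a : reflect (ideal_gen X a) (a \in ideal_pred X).
Proof. exact: asboolP. Qed.

Lemma ideal_pred_zmod_closed (X : set A) : zmod_closed (ideal_pred X).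
Proof.
have [X0 XD] := ideal_gen_ideal X.
split=> [|u v /ideal_predP Xu /ideal_predP Xv]; apply/ideal_predP => //.
by rewrite -mulN1r addrC; apply: XD.
Qed.

HB.instance Definition _ (X : set A) :=
  GRing.isZmodClosed.Build A (ideal_pred X) (ideal_pred_zmod_closed X).

Lemma ideal_predMl (X : set A) a u : u \in ideal_pred X -> a * u \in ideal_pred X.
Proof.
have [X0 XD] := ideal_gen_ideal X.
by move=> /ideal_predP Xu; apply/ideal_predP; rewrite -[_ * _]addr0; apply: XD.
Qed.

End Ideals.

(* The quotient of A by the ideal generated by X. The ring structure of
   [ring_quotient] is only available for proper ideals. *)
Definition quo (A : comPzRingType) (X : set A) : Type :=
  Quotient.quot (ideal_pred X).

Section Quotient.
Variables (A : comPzRingType) (X : set A).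

HB.instance Definition _ :=
  ZmodQuotient.copy (quo X) (Quotient.quot (ideal_pred X)).

Local Notation Q := (quo X).

Lemma quo_eqP (a b : A) :
  reflect (\pi_Q a = \pi_Q b) (a - b \in ideal_pred X).
Proof. by rewrite (Quotient.idealrBE (ideal_pred X)); apply: eqP. Qed.

Definition quo_one : Q := \pi_Q 1.
Definition quo_mul (x y : Q) : Q := \pi_Q (repr x * repr y).
Definition quo_scale (a : A) (x : Q) : Q := \pi_Q (a * repr x).

Lemma quo_mulE a b : quo_mul (\pi_Q a) (\pi_Q b) = \pi_Q (a * b).
Proof.
apply/quo_eqP; set a' := repr _; set b' := repr _.
have Ha : a' - a \in ideal_pred X by apply/quo_eqP; rewrite reprK.
have Hb : b' - b \in ideal_pred X by apply/quo_eqP; rewrite reprK.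
have -> : a' * b' - a * b = a' * (b' - b) + b * (a' - a).
  by rewrite !mulrBr addrA (mulrC b a') (mulrC b a) subrK.
by rewrite rpredD // ideal_predMl.
Qed.

Lemma quo_scaleE a b : quo_scale a (\pi_Q b) = \pi_Q (a * b).
Proof.
apply/quo_eqP; rewrite -mulrBr ideal_predMl //.
by apply/quo_eqP; rewrite reprK.
Qed.

Lemma quo_addE a b : \pi_Q a + \pi_Q b = \pi_Q (a + b).
Proof. by rewrite !piE. Qed.

Lemma quo_mulA : associative quo_mul.
Proof.
by move=> x y z; rewrite -[x]reprK -[y]reprK -[z]reprK !quo_mulE !reprK mulrA.
Qed.

Lemma quo_mulC : commutative quo_mul.
Proof. by move=> x y; rewrite -[x]reprK -[y]reprK !quo_mulE mulrC. Qed.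

Lemma quo_mul1 : left_id quo_one quo_mul.
Proof. by move=> x; rewrite -[x]reprK quo_mulE mul1r. Qed.

Lemma quo_mulDl : left_distributive quo_mul +%R.
Proof.
move=> x y z; rewrite -[x]reprK -[y]reprK -[z]reprK.
by rewrite quo_addE !quo_mulE quo_addE mulrDl.
Qed.

HB.instance Definition _ := GRing.Zmodule_isComPzRing.Build (quo X)
  quo_mulA quo_mulC quo_mul1 quo_mulDl.

Lemma quo_scaleA (a b : A) (x : Q) :
  quo_scale a (quo_scale b x) = quo_scale (a * b) x.
Proof. by rewrite -[x]reprK !quo_scaleE !reprK mulrA. Qed.

Lemma quo_scale1 : left_id 1 quo_scale.
Proof. by move=> x; rewrite -[x]reprK quo_scaleE mul1r. Qed.

Lemma quo_scaleDr : right_distributive quo_scale +%R.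
Proof.
move=> a x y; rewrite -[x]reprK -[y]reprK.
by rewrite quo_addE !quo_scaleE quo_addE mulrDr.
Qed.

Lemma quo_scaleDl (x : Q) : {morph quo_scale^~ x : a b / a + b}.
Proof. by move=> a b; rewrite -[x]reprK !quo_scaleE quo_addE mulrDl. Qed.

HB.instance Definition _ := GRing.Zmodule_isLmodule.Build A (quo X)
  quo_scaleA quo_scale1 quo_scaleDr quo_scaleDl.

End Quotient.

Arguments local_max_ideal : clear implicits.

(* In the three definitions below, A is meant to be a Noetherian local ring of
   prime characteristic p. *)
Definition frobenius_power (A : comPzRingType) (p e : nat) : set A :=
  ideal_gen [set a ^+ (p ^ e) | a in local_max_ideal A].

Arguments frobenius_power : clear implicits.

Definition HK (A : comPzRingType) (p e : nat) : nat :=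
  length (quo (frobenius_power A p e)).

Definition eHK (R : realType) (A : comPzRingType) (p : nat) : R :=
  limn (fun e => (HK A p e)%:R / (p ^ (e * krull_dim A))%:R : R).

Definition mpser (n : nat) (K : comNzRingType) : Type := multinom n -> K.

Section PowerSeries.
Variables (n : nat) (K : comNzRingType).

HB.instance Definition _ := GRing.Zmodule.copy (mpser n K) (multinom n -> K).

Implicit Types f g h : mpser n K.

Definition mpser_one : mpser n K := fun m => (m == mnm0)%:R.

(* All exponents with k.1 + k.2 = m have degree at most that of m. *)
Definition mpser_mul f g : mpser n K := fun m =>
  \sum_(k : bmultinom n (mdeg m).+1 * bmultinom n (mdeg m).+1
        | m == mnm_add k.1 k.2) f k.1 * g k.2.

Definition mpserX (i : 'I_n) : mpser n K := fun m => (m == mnm1 i)%:R.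

(* The ring axioms are transported from {mpoly K[n]} by truncation. *)
Definition mpser_trunc (N : nat) f : mpoly n K :=
  \sum_(k : bmultinom n N) f k *: mpolyX K k.

Lemma mcoeff_trunc N f m : (mdeg m < N)%N -> mcoeff m (mpser_trunc N f) = f m.
Proof. by move=> mN; rewrite /mpser_trunc mcoeff_mpoly. Qed.

Lemma mcoeffM_eq (p p' q q' : mpoly n K) (m : multinom n) :
  (forall k, (mdeg k <= mdeg m)%N -> mcoeff k p = mcoeff k p') ->
  (forall k, (mdeg k <= mdeg m)%N -> mcoeff k q = mcoeff k q') ->
  mcoeff m (p * q) = mcoeff m (p' * q').
Proof.
move=> pp' qq'; rewrite !mcoeffM; apply: eq_bigr => k _.
by rewrite pp' ?qq' // -ltnS bmdeg.
Qed.

Lemma mpser_mulE N f g m : (mdeg m < N)%N ->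
  mpser_mul f g m = mcoeff m (mpser_trunc N f * mpser_trunc N g).
Proof.
move=> mN; rewrite mcoeffM; apply: eq_bigr => k _.
by rewrite !mcoeff_trunc // (leq_ltn_trans _ mN) // -ltnS bmdeg.
Qed.

Lemma mcoeff_truncM N f g m : (mdeg m < N)%N ->
  mcoeff m (mpser_trunc N (mpser_mul f g)) =
  mcoeff m (mpser_trunc N f * mpser_trunc N g).
Proof. by move=> mN; rewrite mcoeff_trunc // (mpser_mulE _ _ mN). Qed.

Lemma mpser_mulC : commutative mpser_mul.
Proof.
by move=> f g; apply/funext => m; rewrite !(mpser_mulE _ _ (ltnSn _)) mulrC.
Qed.

Lemma mpser_mulA : associative mpser_mul.
Proof.
move=> f g h; apply/funext => m; rewrite !(mpser_mulE _ _ (ltnSn _)).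
set T := mpser_trunc _.
transitivity (mcoeff m (T f * (T g * T h))).
  by apply: mcoeffM_eq => // k km; rewrite mcoeff_truncM.
by rewrite mulrA; apply: mcoeffM_eq => // k km; rewrite mcoeff_truncM.
Qed.

Lemma mpser_mul1 : left_id mpser_one mpser_mul.
Proof.
move=> f; apply/funext => m; rewrite (mpser_mulE _ _ (ltnSn _)).
rewrite -[RHS](mcoeff_trunc f (ltnSn _)) -[X in _ = mcoeff _ X]mul1r.
by apply: mcoeffM_eq => // k km; rewrite mcoeff_trunc // mcoeff1.
Qed.

Lemma mpser_mulDl : left_distributive mpser_mul +%R.
Proof.
move=> f g h; apply/funext => m.
transitivity (mpser_mul f h m + mpser_mul g h m); last by [].
by rewrite /mpser_mul -big_split; apply: eq_bigr => k _; exact: mulrDl.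
Qed.

Lemma mpser_one_neq0 : mpser_one != 0.
Proof.
apply/eqP => /(congr1 (fun f : mpser n K => f mnm0)).
by rewrite /mpser_one eqxx; apply/eqP; rewrite oner_neq0.
Qed.

HB.instance Definition _ := GRing.Zmodule_isComNzRing.Build (mpser n K)
  mpser_mulA mpser_mulC mpser_mul1 mpser_mulDl mpser_one_neq0.

End PowerSeries.

Section Singularities.
Variables p d : nat.

Definition xvar (i : nat) : mpser d.+1 'F_p := mpserX 'F_p (inord i).

(* x_0 x_1 + x_2 x_3 + ... , with k terms *)
Definition hyperbolic_sum (k : nat) : mpser d.+1 'F_p :=
  \sum_(i < k) xvar i.*2 * xvar i.*2.+1.

Definition A1_equation : mpser d.+1 'F_p :=
  if odd d then hyperbolic_sum d.+1./2
  else hyperbolic_sum d./2 + xvar d ^+ 2.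

Definition A2_equation : mpser d.+1 'F_p :=
  if odd d then hyperbolic_sum d.-1./2 + xvar d.-1 ^+ 2 + xvar d ^+ 3
  else hyperbolic_sum d./2 + xvar d ^+ 3.

Definition A1_singularity : comPzRingType := quo [set A1_equation].

Definition A2_singularity : comPzRingType := quo [set A2_equation].

End Singularities.

Arguments xvar : clear implicits.
Arguments hyperbolic_sum : clear implicits.
Arguments A1_equation : clear implicits.
Arguments A2_equation : clear implicits.

(* Main.v *)
Require Import Defs.
From mathcomp Require Import all_boot all_order all_algebra.
From mathcomp Require Import generic_quotient ring_quotient.
From mathcomp Require Import boolp classical_sets reals topology.
From mathcomp Require Import normedtype sequences.
From mathcomp Require Import zify ring lra.
From mathcomp.multinomials Require Import -(notations) mpoly.

Set Implicit Arguments.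
Unset Strict Implicit.
Unset Printing Implicit Defensive.

Import Order.TTheory GRing.Theory Num.Theory.
Import numFieldNormedType.Exports.

Local Open Scope classical_set_scope.
Local Open Scope ring_scope.
Local Open Scope quotient_scope.

Local Notation "a +m b" := (mnm_add a b) (at level 50, left associativity).
Local Notation "a -m b" := (mnm_sub a b) (at level 50, left associativity).
Local Notation "a *m+ b" := (mnm_muln a b) (at level 40, left associativity).
Local Notation "a <=m b" := (lem a b) (at level 70).

(** Put q = p^e and let g be the quadric of type A_1 in the d variables
    x_0, ..., x_(d-1). In one more variable x the singularities A_1 and A_2 are
    the hypersurfaces x^n + g = 0 with n = 2 and n = 3, up to signs and, for A_1
    with d odd, up to the linear substitution that turns x_(d-1) x_d into a
    difference of two squares (A1_colength_odd).

    Modulo (x^n + g, x^q) every power series is a combination of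
    1, x, ..., x^(n-1), in which the coefficient of x^j matters modulo g^(b_j),
    where b_0, ..., b_(n-1) is the balanced partition of q into n parts. Writing
    D_q(b) for the colength of (x_0^q, ..., x_(d-1)^q, g^b), this gives
    HK_e = D_q(b_0) + ... + D_q(b_(n-1)) (colength_binomial). The function D_q is
    concave in b, because its increments are the colengths of the increasing
    ideals (x_i^q, g^(b+1)) : g^b, and D_(pq)(pb) = p^d D_q(b) by flatness of
    Frobenius (quadric_colength_frobenius).

    These two properties make HK_e / q^d nondecreasing, hence convergent. In
    terms of the concave limit phi(t) of D_q(tq) / q^d, the two multiplicities
    are 2 phi(1/2) and 3 phi(1/3). Since phi(0) = 0, concavity gives
    3 phi(1/3) >= 2 phi(1/2), with equality only if phi is linear on [0, 1/2].
    As 2/p < 1/2, that would force D_p(2) = 2 D_p(1): multiplication by g on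
    F_p[x_0, ..., x_(d-1)] / (x_i^p) would have no Jordan block of size one.
    There is such a block: an element killed by g and outside the image of g
    (quadric_colength_strictly_concave). The passage to the limit is carried out
    with explicit chords of D_q (block_sum_gap) rather than with phi.

    Two facts of commutative algebra relate this to the definitions. The length
    of a quotient by an m-primary ideal is its codimension over F_p, and this
    codimension is additive: colength I = colength (I + (a)) + colength (I : a).
    The Krull dimension of a hypersurface in d + 1 variables is d
    (krull_dim_hypersurface), because adding to a prime ideal an element of m
    outside it lowers the degree of the Hilbert-Samuel function by exactly one. The
    upper bound on the new degree rests on an Artin-Rees property, obtained from
    standard bases, and the primes of a long chain are ideals maximal among
    those of a given growth. *)

(** * Colength of subgroups over a prime field *)

Section Colength.
Variable p : nat.
Local Notation K := 'F_p.

Definition subgroup (V : zmodType) (I : set V) : Prop :=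
  I 0 /\ forall u v, I u -> I v -> I (u - v).

(** Codimension over F_p. Additive maps between F_p-vector spaces are linear,
    so no scalar multiplication has to be carried by V. *)
Definition colength_is (V : zmodType) (I : set V) (k : nat) : Prop :=
  exists f : V -> 'rV[K]_k, [/\ {morph f : u v / u - v},
    forall w, exists u, f u = w & forall u, I u <-> f u = 0].

Lemma Fp_scaleE (M : lmodType K) (c : K) (v : M) : c *: v = v *+ c.
Proof. by rewrite -[in LHS](natr_Zp c) scaler_nat. Qed.

Lemma subgroupN (V : zmodType) (I : set V) u : subgroup I -> I u -> I (- u).
Proof. by move=> [I0 IB] Iu; rewrite -sub0r; apply: IB. Qed.

Lemma subgroupD (V : zmodType) (I : set V) u v :
  subgroup I -> I u -> I v -> I (u + v).
Proof. by move=> sI Iu Iv; rewrite -[v]opprK; apply: sI.2 => //; apply: subgroupN. Qed.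

Lemma subgroupMn (V : zmodType) (I : set V) u n :
  subgroup I -> I u -> I (u *+ n).
Proof.
move=> sI Iu; elim: n => [|n IHn]; first by rewrite mulr0n; case: sI.
by rewrite mulrS; apply: subgroupD.
Qed.

Lemma subgroup_sum (V : zmodType) (I : set V) (J : Type) (r : seq J)
    (P : pred J) (F : J -> V) :
  subgroup I -> (forall j, P j -> I (F j)) -> I (\sum_(j <- r | P j) F j).
Proof.
by move=> sI IF; elim/big_ind: _ => //; [case: sI | move=> u v; apply: subgroupD].
Qed.

Section MorphB.
Variables (V W : zmodType) (f : V -> W).
Hypothesis fB : {morph f : u v / u - v}.
Lemma morphB0 : f 0 = 0. Proof. by rewrite -[X in f X](subrr 0) fB subrr. Qed.
Lemma morphBN u : f (- u) = - f u. Proof. by rewrite -sub0r fB morphB0 sub0r. Qed.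
Lemma morphBD u v : f (u + v) = f u + f v.
Proof. by rewrite -[v in LHS]opprK fB morphBN opprK. Qed.
Lemma morphBMn u n : f (u *+ n) = f u *+ n.
Proof. by elim: n => [|n IHn]; rewrite ?morphB0 // !mulrS morphBD IHn. Qed.
Lemma morphB_sum (J : Type) (r : seq J) (P : pred J) (F : J -> V) :
  f (\sum_(j <- r | P j) F j) = \sum_(j <- r | P j) f (F j).
Proof. by rewrite (big_morph f morphBD morphB0). Qed.
End MorphB.

Lemma colength_is_subgroup (V : zmodType) (I : set V) k :
  colength_is I k -> subgroup I.
Proof.
move=> [f [fB _ fI]]; split; first by apply/fI; rewrite (morphB0 fB).
by move=> u v /fI fu /fI fv; apply/fI; rewrite fB fu fv subr0.
Qed.

Lemma colength_is_le (V : zmodType) (I : set V) k k' :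
  colength_is I k -> colength_is I k' -> (k <= k')%N.
Proof.
move=> [f [fB fS fI]] [f' [fB' fS' fI']].
pose s w := projT1 (cid (fS w)).
have sE w : f (s w) = w by rewrite /s; case: cid.
have injs : injective (fun w => f' (s w)).
  move=> w w' /eqP; rewrite -subr_eq0 -fB' => /eqP/fI'/fI/eqP.
  by rewrite fB subr_eq0 !sE => /eqP.
have := leq_card _ injs; rewrite !card_mx !mul1n leq_exp2l //.
exact: card_finNzRing_gt1.
Qed.

Lemma colength_is_unique (V : zmodType) (I : set V) k k' :
  colength_is I k -> colength_is I k' -> k = k'.
Proof.
move=> Ik Ik'; apply/eqP; rewrite eqn_leq.
by rewrite (colength_is_le Ik Ik') (colength_is_le Ik' Ik).
Qed.

Definition colength (V : zmodType) (I : set V) : nat := xget 0%N (colength_is I).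
Definition cofinite (V : zmodType) (I : set V) : Prop := exists k, colength_is I k.

Lemma colengthP (V : zmodType) (I : set V) : cofinite I -> colength_is I (colength I).
Proof. by move=> cI; apply: xgetPex. Qed.

Lemma colengthE (V : zmodType) (I : set V) k : colength_is I k -> colength I = k.
Proof. by move=> Ik; apply: (colength_is_unique _ Ik); apply: colengthP; exists k. Qed.

Lemma image_submx (V : zmodType) k (f : V -> 'rV[K]_k) (I : set V) :
  {morph f : u v / u - v} -> subgroup I ->
  exists U : 'M[K]_k, forall w, (w <= U)%MS <-> exists2 u, I u & f u = w.
Proof.
move=> fB sI; pose P (w : 'rV[K]_k) := `[< exists2 u, I u & f u = w >].
exists (\sum_(w : 'rV[K]_k | P w) <<w>>)%MS => w; split; last first.
  move=> [u Iu fu]; apply: (sumsmx_sup w); last by rewrite genmxE.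
  by apply/asboolP; exists u.
move=> /sub_sumsmxP [a ->].
suff H (r : seq 'rV[K]_k) : exists2 u, I u & f u = \sum_(i <- r | P i) a i *m <<i>>%MS.
  exact: H.
elim: r => [|v r [u Iu fu]].
  by exists 0; [case: sI|rewrite big_nil (morphB0 fB)].
rewrite big_cons; case: ifP => [/asboolP [u' Iu' fu']|_]; last by exists u.
have : (a v *m <<v>>%MS <= v)%MS by rewrite (submx_trans (submxMl _ _)) // genmxE.
move=> /sub_rVP [c cE].
exists (u' *+ c + u).
  by apply: subgroupD => //; apply: subgroupMn.
by rewrite (morphBD fB) (morphBMn fB) fu' fu cE Fp_scaleE.
Qed.

(** Linear algebra in F_p^k: the cokernel of the subspace f(I') presents V /
    I', and h is f followed by coordinates on that subspace, which identify I'
    / I with F_p^k2. *)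
Lemma colength_filtration (V : zmodType) (I I' : set V) k :
  colength_is I k -> subgroup I' -> I `<=` I' ->
  exists k1 k2, [/\ (k = k1 + k2)%N, colength_is I' k1 &
    exists h : V -> 'rV[K]_k2, [/\ {morph h : u v / u - v},
      forall w, exists2 u, I' u & h u = w &
      forall u, I' u -> (I u <-> h u = 0)]].
Proof.
move=> [f [fB fS fI]] sI' II'.
have [U UE] := image_submx fB sI'.
exists (\rank (cokermx U)), (\rank U); split.
- by rewrite mxrank_coker subnK // rank_leq_col.
- exists (fun u => f u *m col_base (cokermx U)); split.
  + by move=> u v; rewrite fB mulmxBl.
  + move=> w; have full : row_full (col_base (cokermx U)) by exact: col_base_full.
    have /submxP [v ->] : (w <= col_base (cokermx U))%MS by exact: submx_full.
    by have [u <-] := fS v; exists u.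
  + move=> u.
    have -> : (f u *m col_base (cokermx U) = 0) <-> (f u <= U)%MS.
      split => [e|]; first by rewrite submxE -(mulmx_base (cokermx U)) mulmxA e mul0mx.
      rewrite submxE -{1}(mulmx_base (cokermx U)) mulmxA => /eqP e.
      by apply: (row_free_inj (row_base_free (cokermx U))); rewrite e mul0mx.
    split => [I'u|/UE [v I'v fvu]]; first by apply/UE; exists u.
    have /II' : I (u - v) by apply/fI; rewrite fB fvu subrr.
    by move=> /(subgroupD sI')/(_ I'v); rewrite subrK.
- exists (fun u => f u *m pinvmx (row_base U)); split.
  + by move=> u v; rewrite fB mulmxBl.
  + move=> w; have /UE [u I'u fu] : (w *m row_base U <= U)%MS.
      by rewrite (submx_trans (submxMl _ _)) // eq_row_base.
    by exists u => //; rewrite fu mulmxKp // row_base_free.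
  + move=> u I'u; have fuU : (f u <= row_base U)%MS.
      by rewrite eq_row_base; apply/UE; exists u.
    split => [/fI ->|e]; first by rewrite mul0mx.
    by apply/fI; rewrite -(mulmxKpV fuU) e mul0mx.
Qed.

Lemma cofinite_sub (V : zmodType) (I I' : set V) :
  cofinite I -> subgroup I' -> I `<=` I' -> cofinite I'.
Proof. by move=> [k Ik] sI' /(colength_filtration Ik sI') [k1 [_ [_ ? _]]]; exists k1. Qed.

Lemma colength_sub (V : zmodType) (I I' : set V) :
  cofinite I -> subgroup I' -> I `<=` I' -> (colength I' <= colength I)%N.
Proof.
move=> /colengthP Ik sI' /(colength_filtration Ik sI') [k1 [k2 [-> /colengthE -> _]]].
exact: leq_addr.
Qed.

Lemma colength_proper (V : zmodType) (I I' : set V) :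
  cofinite I -> subgroup I' -> I `<` I' -> (colength I' < colength I)%N.
Proof.
move=> cI sI' [II' nI'I].
have [k1 [[|k2]]] := colength_filtration (colengthP cI) sI' II'; last first.
  by case=> -> /colengthE -> _; rewrite addnS ltnS leq_addr.
move=> [_ _ [h [_ _ hI]]]; case: nI'I => u I'u; apply/(hI _ I'u).
by apply/matrixP => ? [].
Qed.

Lemma colength_is_setT (V : zmodType) : colength_is [set: V] 0.
Proof.
exists (fun=> 0); split => [u v|w|//]; first by rewrite subr0.
by exists 0; apply/matrixP => ? [].
Qed.

End Colength.

(** For a map onto the quotient only. It compares polynomials with power
    series. *)
Lemma colength_is_dense p (V W : zmodType) (g : V -> W) (I : set W) k :
  {morph g : u v / u - v} -> (forall w, exists u, I (g u - w)) ->
  colength_is p I k -> colength_is p [set u | I (g u)] k.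
Proof.
move=> gB gS [f [fB fS fI]]; exists (f \o g); split => [u v|w|u] /=.
- by rewrite gB fB.
- have [v <-] := fS w; have [u /fI uv] := gS v; exists u.
  by apply/eqP; rewrite -subr_eq0 -fB uv.
- exact: fI.
Qed.

(** The g j identify the quotient with a product of quotients, so the
    codimensions add up. *)
Lemma colength_is_family p (J : finType) (V W : zmodType) (g : J -> V -> W)
    (I : J -> set W) (k : J -> nat) :
  (forall j, {morph g j : u v / u - v}) ->
  (forall w : J -> W, exists u, forall j, g j u = w j) ->
  (forall j, colength_is p (I j) (k j)) ->
  colength_is p [set u | forall j, I j (g j u)] (\sum_j k j).
Proof.
move=> gB gS Ik; pose f j := projT1 (cid (Ik j)).
have fP j : [/\ {morph f j : u v / u - v}, forall w, exists u, f j u = w &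
    forall u, I j u <-> f j u = 0] by rewrite /f; case: cid.
have -> : (\sum_j k j = \sum_(i < #|J|) k (enum_val i))%N by rewrite big_enum_val.
exists (fun u => \mxrow_(i < #|J|) f (enum_val i) (g (enum_val i) u)); split.
- move=> u v; rewrite -mxrowB; apply: eq_mxrow => i.
  by rewrite gB; have [-> _ _] := fP (enum_val i).
- move=> w.
  have H (j : J) : exists v, f j v = castmx (erefl, congr1 k (enum_rankK j)) (submxrow w (enum_rank j)).
    by have [_ fS _] := fP j; apply: fS.
  have [v vE] := choice H; have [u uE] := gS v; exists u.
  rewrite -[RHS]submxrowK; apply: eq_mxrow => i; rewrite uE vE.
  move: (congr1 k _); rewrite enum_valK => kk; rewrite castmx_id.
  by [].
- move=> u; split=> [uI|e j].
    rewrite -[RHS](mxrow0 (q_ := fun i => k (enum_val i))); apply: eq_mxrow => i.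
    by have [_ _ fI] := fP (enum_val i); apply/fI/uI.
  have := congr1 (fun w => submxrow w (enum_rank j)) e; rewrite mxrowK submxrow0 enum_rankK.
  by have [_ _ fI] := fP j; move/fI.
Qed.

(** * Ideals *)

Section IdealOps.
Variables (p : nat) (A : comPzRingType).
Implicit Types (I J : set A) (a u v : A).

Definition add_gen I a : set A := [set u | exists v b, I v /\ u = v + b * a].
Definition colon I a : set A := [set u | I (u * a)].

Lemma ideal_subgroup I : ideal I -> subgroup I.
Proof. by case=> I0 ID; split=> // u v Iu Iv; rewrite addrC -mulN1r; apply: ID. Qed.

Lemma idealMl I a u : ideal I -> I u -> I (a * u).
Proof. by case=> I0 ID Iu; rewrite -[_ * _]addr0; apply: ID. Qed.

Lemma idealMr I a u : ideal I -> I u -> I (u * a).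
Proof. by rewrite mulrC; apply: idealMl. Qed.

Lemma idealD I u v : ideal I -> I u -> I v -> I (u + v).
Proof. by move=> /ideal_subgroup; apply: subgroupD. Qed.

Lemma ideal1 I u : ideal I -> I 1 -> I u.
Proof. by move=> idI I1; rewrite -[u]mulr1; apply: idealMl. Qed.

Lemma ideal0 : ideal [set (0 : A)].
Proof. by split=> // a _ _ -> ->; rewrite mulr0 addr0. Qed.

Lemma add_gen_ideal I a : ideal I -> ideal (add_gen I a).
Proof.
move=> [I0 ID]; split; first by exists 0, 0; rewrite mul0r addr0.
move=> c _ _ [u [b [Iu ->]]] [v [b' [Iv ->]]].
exists (c * u + v), (c * b + b'); split; first exact: ID.
by rewrite mulrDr mulrDl addrACA mulrA.
Qed.

Lemma colon_ideal I a : ideal I -> ideal (colon I a).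
Proof.
move=> [I0 ID]; split => [|c u v Iu Iv]; rewrite /colon /= ?mul0r //.
by rewrite mulrDl -mulrA; apply: ID.
Qed.

Lemma sub_add_gen I a : I `<=` add_gen I a.
Proof. by move=> u Iu; exists u, 0; rewrite mul0r addr0. Qed.

Lemma mem_add_gen I a b : I 0 -> add_gen I a (b * a).
Proof. by move=> I0; exists 0, b; rewrite add0r. Qed.

Lemma gen_add_gen I a : I 0 -> add_gen I a a.
Proof. by move=> I0; exists 0, 1; rewrite add0r mul1r. Qed.

Lemma add_gen_sub I J a : ideal J -> I `<=` J -> J a -> add_gen I a `<=` J.
Proof. by move=> idJ IJ Ja _ [v [b [/IJ Jv ->]]]; apply: idealD => //; apply: idealMl. Qed.

Lemma sub_colon I a : ideal I -> I `<=` colon I a.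
Proof. by move=> idI u Iu; apply: idealMr. Qed.

(** Multiplication by a identifies A / (I : a) with (I + (a)) / I. *)
Lemma colength_colon I a : ideal I -> cofinite p I ->
  colength p I = (colength p (add_gen I a) + colength p (colon I a))%N.
Proof.
move=> idI /colengthP Ik.
have [k1 [k2 [-> /colengthE -> [h [hB hS hI]]]]] := colength_filtration Ik
  (ideal_subgroup (add_gen_ideal a idI)) (@sub_add_gen I a).
congr (_ + _)%N; symmetry; apply: colengthE.
have I0 := idI.1.
exists (fun u => h (u * a)); split => [u v|w|u]; first by rewrite mulrBl hB.
- have [_ [v [b [Iv ->]]] <-] := hS w; exists b.
  rewrite (morphBD hB).
  by have -> : h v = 0; [apply/hI => //; apply: sub_add_gen|rewrite add0r].
- by apply: hI; apply: mem_add_gen.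
Qed.

Lemma cofinite_colon I a : ideal I -> cofinite p I -> cofinite p (colon I a).
Proof.
move=> idI cI; apply: (cofinite_sub cI); last exact: sub_colon.
by apply: ideal_subgroup; apply: colon_ideal.
Qed.

Lemma cofinite_add_gen I a : ideal I -> cofinite p I -> cofinite p (add_gen I a).
Proof.
move=> idI cI; apply: (cofinite_sub cI); last exact: sub_add_gen.
by apply: ideal_subgroup; apply: add_gen_ideal.
Qed.

End IdealOps.

(** * Coefficients of power series *)

Section Coefficients.
Variables (n : nat) (K : comNzRingType).
Implicit Types (f g h : mpser n K) (m k : multinom n).

Lemma psP f g : (forall m, f m = g m) -> f = g.
Proof. by move=> fg; apply/funext. Qed.

Lemma ps0 m : (0 : mpser n K) m = 0. Proof. by []. Qed.
Lemma psD f g m : (f + g) m = f m + g m. Proof. by []. Qed.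
Lemma psB f g m : (f - g) m = f m - g m. Proof. by []. Qed.
Lemma ps1 m : (1 : mpser n K) m = (m == mnm0)%:R. Proof. by []. Qed.

Lemma ps_sum (J : Type) (r : seq J) (P : pred J) (F : J -> mpser n K) m :
  (\sum_(j <- r | P j) F j) m = \sum_(j <- r | P j) F j m.
Proof. exact: (@morphB_sum _ _ (fun f : mpser n K => f m)). Qed.

Lemma psME N f g m : (mdeg m < N)%N ->
  (f * g) m = \sum_(k : bmultinom n N | k <=m m) f k * g (m -m k).
Proof.
move=> mN; rewrite [LHS](mpser_mulE f g mN) [LHS](mcoeff_poly_mul_lin _ _ mN).
apply: eq_bigr => k km; rewrite !mcoeff_trunc ?bmdeg //.
exact: leq_ltn_trans (mdegB _ _) mN.
Qed.

Definition monomial m : mpser n K := fun k => (k == m)%:R.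

Lemma monomial0 : monomial mnm0 = 1. Proof. by []. Qed.

Lemma monomialME m f k :
  (monomial m * f) k = if m <=m k then f (k -m m) else 0.
Proof.
rewrite (psME _ _ (ltnSn (mdeg k))); case: ifP => mk.
  have mP : (mdeg m < (mdeg k).+1)%N by rewrite ltnS lemc_mdeg ?lem_leo.
  rewrite (bigD1 (BMultinom mP)) //= big1 ?addr0 /monomial ?eqxx ?mul1r //.
  by move=> j /andP [_]; rewrite bmeqP /= => /negbTE ->; rewrite mul0r.
apply: big1 => j jk; rewrite /monomial; case: eqP => [e|]; last by rewrite mul0r.
by rewrite -e jk in mk.
Qed.

Lemma monomialM m k : monomial m * monomial k = monomial (m +m k).
Proof.
apply: psP => j; rewrite monomialME /monomial; case: ifP => mj.
  congr (nat_of_bool _)%:R; apply/eqP/eqP => [<-|->]; last by rewrite addmC addmK.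
  by rewrite addmC submK.
by case: eqP => // e; rewrite e lem_addr in mj.
Qed.

Lemma monomialX m j : monomial m ^+ j = monomial (mnm_muln m j).
Proof.
by elim: j => [|j IHj]; rewrite ?mulm0n // exprS mulmS IHj monomialM.
Qed.

Lemma monomialDE m f k : (monomial m * f) (k +m m) = f k.
Proof. by rewrite monomialME lem_addl addmK. Qed.

End Coefficients.

Section Orders.
Variables (n : nat) (K : comNzRingType).
Implicit Types (f g h : mpser n K) (m k : multinom n).

Definition ord_ge N : set (mpser n K) := [set f | forall m, (mdeg m < N)%N -> f m = 0].

Lemma ord_geM N N' f g : ord_ge N f -> ord_ge N' g -> ord_ge (N + N') (f * g).
Proof.
move=> fN gN m mN; rewrite (psME _ _ (ltnSn _)); apply: big1 => k km.
have [/fN ->|Nk] := ltnP (mdeg k) N; first by rewrite mul0r.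
rewrite gN ?mulr0 //.
have := mdegD (m -m k) k; rewrite submK // => e.
by rewrite -(ltn_add2r (mdeg k)) -e (leq_trans mN) // addnC leq_add2l.
Qed.

Lemma ord_ge0 f : ord_ge 0 f. Proof. by []. Qed.

Lemma ord_ge_ideal N : ideal (ord_ge N : set (mpser n K)).
Proof.
split=> [//|a u v uN vN m mN]; rewrite psD vN // addr0.
by have := @ord_geM 0 N a u (fun m => _) uN m mN; apply.
Qed.

Lemma ord_ge_le N N' : (N <= N')%N -> ord_ge N' `<=` ord_ge N.
Proof. by move=> le f fN m mN; apply: fN; apply: leq_trans mN le. Qed.

Lemma ord_ge_eq0 f : (forall N, ord_ge N f) -> f = 0.
Proof. by move=> fN; apply: psP => m; rewrite (fN (mdeg m).+1 m). Qed.

Lemma monomial_ord_ge m : ord_ge (mdeg m) (monomial K m).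
Proof. by move=> k km; rewrite /monomial; case: eqP km => // ->; rewrite ltnn. Qed.

(** The sum of a family with u_D of order at least D - c: in degree mdeg m the
    terms with D > mdeg m + c vanish. *)
Definition ps_series (c : nat) (u : nat -> mpser n K) : mpser n K :=
  fun m => (\sum_(D < (mdeg m + c).+1) u D) m.

Lemma ps_seriesE c u N : (forall D, ord_ge (D - c) (u D)) ->
  ord_ge N (ps_series c u - \sum_(D < N + c) u D).
Proof.
move=> uc m mN; rewrite psB /ps_series.
have E M : (mdeg m + c < M)%N -> (\sum_(D < M) u D) m = (\sum_(D < (mdeg m + c).+1) u D) m.
  move=> lt; rewrite -(subnKC lt) big_split_ord /= psD -[RHS]addr0; congr (_ + _).
  rewrite ps_sum big1 // => D _; apply: uc.
  by rewrite ltn_subRL -[X in (_ < X)%N]/((mdeg m + c).+1 + D)%N addSn ltnS addnC leq_addr.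
by rewrite (E (N + c)%N) ?subrr // ltn_add2r.
Qed.

Lemma ps_series_ord c u N : (forall D, ord_ge N (u D)) -> ord_ge N (ps_series c u).
Proof. by move=> uN m mN; rewrite /ps_series ps_sum big1 // => D _; apply: uN. Qed.

(** The inverse is the geometric series in h. *)
Lemma ps_one_sub_unit h : h mnm0 = 0 -> exists g, (1 - h) * g = 1.
Proof.
move=> h0; have h1 : ord_ge 1 h.
  by move=> m; rewrite ltnS leqn0 mdeg_eq0 => /eqP ->.
have hX D : ord_ge D (h ^+ D).
  elim: D => [//|D IHD]; rewrite exprS -add1n; exact: ord_geM.
exists (ps_series 0 (fun D => h ^+ D)); apply/eqP; rewrite -subr_eq0; apply/eqP.
apply: ord_ge_eq0 => N.
set G := ps_series _ _.
have GN : ord_ge N (G - \sum_(D < N) h ^+ D).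
  by have := @ps_seriesE 0 (fun D => h ^+ D) N; rewrite addn0; apply => D; rewrite subn0.
have -> : (1 - h) * G - 1 = (1 - h) * (G - \sum_(D < N) h ^+ D) - h ^+ N.
  rewrite mulrBr -[1 - h in X in _ = _ - X - _]opprB mulNr -subrX1 opprK.
  by rewrite -addrA addrAC subrr add0r.
have [_ NB] := ideal_subgroup (ord_ge_ideal N).
by apply: NB => //; exact: (idealMl _ (ord_ge_ideal N)).
Qed.

End Orders.

(** * Leading monomials and standard bases *)

Section LeadingMonomials.
Variables (n : nat) (K : idomainType).
Implicit Types (f g h : mpser n K) (m k : multinom n).

(** The leading monomial is the smallest one for the graded order, as suits
    power series. *)
Definition is_lead f m := f m != 0 /\ forall k, (k < m)%O -> f k = 0.

Lemma lead_exists f : f != 0 -> exists m, is_lead f m.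
Proof.
move=> f0; apply: contrapT => nl; case/eqP: f0; apply: psP => m.
elim/(@ltmwf n): m => m IHm; apply/eqP; apply/negPn/negP => fm.
by apply: nl; exists m; split => // k /IHm.
Qed.

Lemma lead_mul f g m k : is_lead f m -> is_lead g k -> is_lead (f * g) (m +m k).
Proof.
move=> [fm fl] [gk gl].
have E j : (j <= m +m k)%O -> (f * g) j = if j == m +m k then f m * g k else 0.
  move=> jmk; rewrite (psME _ _ (ltnSn (mdeg j))).
  have z (i : multinom n) : i <=m j -> (i != m) || (j != m +m k) -> f i * g (j -m i) = 0.
    move=> ij ne; have [/fl ->|mi] := ltP i m; first by rewrite mul0r.
    rewrite gl ?mulr0 // ltNge; apply/negP => kji.
    have := submK ij; rewrite addmC => e.
    case: (ltgtP i m) mi => // [mi|im] _.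
      by have := ltmc_le_add mi kji; rewrite e ltNge jmk.
    move: ne; rewrite im eqxx /= => ne.
    have : (m +m k <= j)%O by rewrite -e im lemc_add2r -im.
    by move=> mkj; rewrite eq_le jmk mkj in ne.
  case: eqP => e; last by apply: big1 => i ij; apply: z => //; apply/orP; right; apply/eqP.
  have mP : (mdeg m < (mdeg j).+1)%N by rewrite e mdegD ltnS leq_addr.
  rewrite (bigD1 (BMultinom mP)) /=; last by rewrite e lem_addr.
  rewrite big1 ?addr0; last first.
    by move=> i /andP [ij]; rewrite bmeqP /= => im; apply: z => //; rewrite im.
  by rewrite e addmC addmK.
split; first by rewrite E // eqxx mulf_neq0.
by move=> j jmk; rewrite (E _ (ltW jmk)) lt_eqF.
Qed.

Lemma ps_mul_eq0 f g : f * g = 0 -> f = 0 \/ g = 0.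
Proof.
move=> fg; apply: contrapT => /not_orP [/eqP/lead_exists [m fm] /eqP/lead_exists [k gk]].
by have [] := lead_mul fm gk; rewrite fg ps0 eqxx.
Qed.

End LeadingMonomials.

(** By induction on the number j of coordinates that are compared. Minimal
    elements for the first j coordinates settle every m whose next coordinate
    is large, and each of the finitely many other values of that coordinate is
    treated separately. *)
Lemma dickson n (E : set (multinom n)) :
  exists F : seq (multinom n), (forall m, m \in F -> E m) /\
    forall m, E m -> exists2 k, k \in F & k <=m m.
Proof.
suff H j : (j <= n)%N -> forall E : set (multinom n), exists F : seq (multinom n),
    (forall m, m \in F -> E m) /\
    forall m, E m -> exists2 k, k \in F & forall i : 'I_n, (i < j)%N -> (k i <= m i)%N.
  have [F [FE EF]] := H n (leqnn n) E; exists F; split=> // m /EF [k kF km].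
  by exists k => //; apply/mnm_lepP => i; apply: km.
elim: j => [|j IHj] jn {}E.
  have [[m Em]|nE] := pselect (exists m, E m); last first.
    by exists [::]; split => // m Em; case: nE; exists m.
  by exists [:: m]; split=> [k|k _]; [rewrite inE => /eqP ->|exists m; rewrite ?mem_head].
have {}IHj := IHj (ltnW jn); pose x := Ordinal jn.
have [F0 [F0E EF0]] := IHj E.
pose M := \max_(k <- F0) k x.
have [G GP] := choice (fun v => IHj [set m | E m /\ m x = v]).
exists (F0 ++ flatten [seq G v | v <- iota 0 M]); split => [m|m Em].
  rewrite mem_cat => /orP [/F0E //|/flatten_mapP [v _ mG]].
  by have [] := (GP v).1 _ mG.
have [k kF0 km] := EF0 _ Em.
have [Mm|mM] := leqP M (m x).
  exists k; first by rewrite mem_cat kF0.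
  move=> i; rewrite ltnS leq_eqVlt => /orP [/eqP ij|/km //].
  have -> : i = x by apply: val_inj.
  by apply: leq_trans Mm; rewrite /M; apply: leq_bigmax_seq.
have [k' k'G k'm] := (GP (m x)).2 m (conj Em erefl).
exists k'; first by rewrite mem_cat; apply/orP; right; apply/flatten_mapP; exists (m x); rewrite ?mem_iota.
move=> i; rewrite ltnS leq_eqVlt => /orP [/eqP ij|/k'm //].
have -> : i = x by apply: val_inj.
by have [_ ->] := (GP (m x)).1 _ k'G.
Qed.

Section StandardBases.
Variables (n p : nat).
Local Notation K := 'F_p.
Local Notation S := (mpser n K).
Implicit Types (f g h w : S) (m k : multinom n) (I J : set S).

Lemma psMn f j m : (f *+ j) m = f m *+ j.
Proof. exact: (@morphBMn _ _ (fun f : S => f m)). Qed.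

Lemma ord_ge_zero (N : nat) : ord_ge N (0 : S).
Proof. by []. Qed.

Lemma ord_ge_subgroup (N : nat) : subgroup (ord_ge N : set S).
Proof. exact: ideal_subgroup (@ord_ge_ideal n K N). Qed.

Lemma ord_ge_sub (N : nat) f g : ord_ge N f -> ord_ge N g -> ord_ge N (f - g).
Proof. by have [_ NB] := ideal_subgroup (@ord_ge_ideal n K N); apply: NB. Qed.

Lemma ord_geMl (N : nat) f g : ord_ge N g -> ord_ge N (f * g).
Proof. exact: (idealMl _ (@ord_ge_ideal n K N)). Qed.

Section Division.
Variables (J : set S) (F : seq (multinom n)) (phi : multinom n -> S) (c : nat).
Hypotheses (idJ : ideal J) (Fu : uniq F).
Hypothesis FJ : forall m, m \in F -> J (phi m) /\ is_lead (phi m) m.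
Hypothesis Fc : forall m, m \in F -> (mdeg m <= c)%N.
Hypothesis JF : forall w m, J w -> is_lead w m -> exists2 k, k \in F & k <=m m.

Local Notation comb a := (\sum_(m <- F) a m * phi m).

Lemma comb_ideal a : J (comb a).
Proof.
rewrite big_seq; apply: (subgroup_sum _ (ideal_subgroup idJ)).
by move=> m /FJ [Jm _]; apply: idealMl.
Qed.

Lemma combD a b : comb a + comb b = comb (fun m => a m + b m).
Proof. by rewrite -big_split; apply: eq_bigr => m _; rewrite mulrDl. Qed.

Lemma combB a b : comb a - comb b = comb (fun m => a m - b m).
Proof.
by rewrite -sumrN -big_split; apply: eq_bigr => m _; rewrite mulrBl.
Qed.

(** Subtracting monomial multiples of the phi k kills the coefficients of
    degree D from the smallest monomial upwards; T w bounds what is left to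
    do. *)
Lemma division_step D w : J w -> ord_ge D w ->
  exists b, (forall m, ord_ge (D - c) (b m)) /\ ord_ge D.+1 (w - comb b).
Proof.
pose T w := [pred m : bmultinom n D.+1 | [exists k : bmultinom n D.+1,
  (val k <= val m)%O && (w (val k) != 0)]].
have [M] := ubnP #|T w|; elim: M w => // M IHM w TM Jw wD.
have [wD1|nwD1] := pselect (ord_ge D.+1 w).
  exists (fun=> 0); split=> [m|]; first exact: ord_ge_zero.
  by rewrite big1 ?subr0 // => m _; rewrite mul0r.
have w0 : w != 0.
  by apply/eqP => w0; apply: nwD1; rewrite w0; exact: ord_ge_zero.
have [m [wm wl]] := lead_exists w0.
have mD : mdeg m = D.
  apply/eqP; rewrite eqn_leq; apply/andP; split; last first.
    by rewrite leqNgt; apply/negP => /wD e; rewrite e eqxx in wm.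
  rewrite leqNgt; apply/negP => Dm; apply: nwD1 => k kD; apply: wl.
  by apply: lt_mdeg_ltmc; apply: leq_trans Dm.
have [k kF km] := JF Jw (conj wm wl).
have [Jk [kk kl]] := FJ kF.
pose e : S := monomial K (m -m k) *+ (w m / phi k k).
have ephi j : (e * phi k) j = (w m / phi k k) * (if m -m k <=m j then phi k (j -m (m -m k)) else 0).
  by rewrite /e mulrnAl psMn monomialME -mulr_natl natr_Zp.
have eD : ord_ge (D - c) e.
  apply: (subgroupMn _ (ord_ge_subgroup _)).
  apply: ord_ge_le (@monomial_ord_ge _ _ _).
  have := mdegD (m -m k) k; rewrite submK // mD => ->.
  by rewrite leq_subLR addnC leq_add2r Fc.
have mkk : m = k +m (m -m k) by rewrite addmC submK.
have ephi_m : (e * phi k) m = w m.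
  by rewrite ephi lem_subr {2}mkk addmK divfK.
have ephi_lt j : (j < m)%O -> (e * phi k) j = 0.
  move=> jm; rewrite ephi; case: ifP => [le|_]; last by rewrite mulr0.
  have -> : phi k (j -m (m -m k)) = 0; last by rewrite mulr0.
  by apply: kl; rewrite -(ltmc_add2l _ _ (m -m k)) submK // addmC submK.
pose w' := w - e * phi k.
have w'm j : (j <= m)%O -> w' j = 0.
  rewrite le_eqVlt => /orP [/eqP ->|jm]; first by rewrite /w' psB ephi_m subrr.
  by rewrite /w' psB wl // ephi_lt // subrr.
have Jw' : J w'.
  by apply: (ideal_subgroup idJ).2 => //; apply: idealMl.
have w'D : ord_ge D w'.
  move=> j jD; apply: w'm; apply: ltW; apply: lt_mdeg_ltmc; by rewrite mD.
have mP : (mdeg m < D.+1)%N by rewrite mD.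
have TT : (#|T w'| < #|T w|)%N.
  apply: proper_card; apply/properP; split.
    apply/fintype.subsetP => j; rewrite !inE => /existsP [i /andP [ij w'i]].
    have mi : (m < val i)%O.
      by rewrite ltNge; apply/negP => /w'm e0; rewrite e0 eqxx in w'i.
    apply/existsP; exists (BMultinom mP) => /=; rewrite wm andbT.
    exact: le_trans (ltW mi) ij.
  exists (BMultinom mP).
    by rewrite inE; apply/existsP; exists (BMultinom mP); rewrite /= lexx wm.
  rewrite inE; apply/existsP => -[i /andP [/= im]].
  by rewrite w'm ?eqxx.
have [b [bD b1]] := IHM _ (leq_trans TT TM) Jw' w'D.
exists (fun j => (if j == k then e else 0) + b j); split => [j|].
  apply: idealD (bD j); first exact: ord_ge_ideal.
  by case: eqP => // _; exact: ord_ge_zero.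
rewrite -combD opprD addrA (bigD1_seq k) //= eqxx big1 ?addr0 // => j /negbTE ->.
by rewrite mul0r.
Qed.

Lemma division D w : J w -> ord_ge D w ->
  exists a, (forall m, ord_ge (D - c) (a m)) /\ w = comb a.
Proof.
move=> Jw wD.
have H t (v : S) : exists b : multinom n -> S, J v -> ord_ge (D + t) v ->
    (forall m, ord_ge (D + t - c) (b m)) /\ ord_ge (D + t).+1 (v - comb b).
  have [Jv|nJv] := pselect (J v); last by exists (fun=> 0).
  have [vD|nvD] := pselect (ord_ge (D + t) v); last by exists (fun=> 0).
  by have [b bP] := division_step Jv vD; exists b.
have [B BP] := choice (fun tv : nat * S => H tv.1 tv.2).
(* The remainder after the degrees below D + t have been divided out. *)
pose W := fix W t := if t is t'.+1 then W t' - comb (B (t', W t')) else w.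
have WP t : J (W t) /\ ord_ge (D + t) (W t).
  elim: t => [|t [JW WD]]; first by rewrite addn0.
  have [_ WD1] := BP (t, W t) JW WD; split; last by rewrite addnS.
  by apply: (ideal_subgroup idJ).2 => //; apply: comb_ideal.
pose b t := B (t, W t).
have bP t m : ord_ge (D + t - c) (b t m).
  by have [JW WD] := WP t; have [bD _] := BP (t, W t) JW WD; apply: bD.
have WE t : W t = w - comb (fun m => \sum_(i < t) b i m).
  elim: t => [|t IHt] /=.
    by rewrite big1 ?subr0 // => m _; rewrite big_ord0 mul0r.
  rewrite -[B _]/(b t) IHt -addrA -opprD combD.
  by congr (_ - _); apply: eq_bigr => m _; rewrite big_ord_recr.
pose a m := ps_series c (fun t => b t m).
exists a; split=> [m|].
  apply: ps_series_ord => t; apply: ord_ge_le (bP t m).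
  by rewrite leq_sub2r ?leq_addr.
apply/eqP; rewrite -subr_eq0; apply/eqP; apply: ord_ge_eq0 => M.
have -> : w - comb a = W (M + c) - comb (fun m => a m - \sum_(i < M + c) b i m).
  by rewrite WE -combB opprB addrA subrK.
apply: ord_ge_sub.
  have [_] := WP (M + c)%N; apply: ord_ge_le.
  by rewrite addnCA leq_addr.
apply: (subgroup_sum _ (ord_ge_subgroup _)).
move=> m _; rewrite mulrC; apply: ord_geMl; apply: ps_seriesE => t.
by apply: ord_ge_le (bP t m); rewrite leq_sub2r ?leq_addl.
Qed.

End Division.

(** By Dickson's lemma the leading monomials of J are multiples of finitely
    many. Dividing by series with these leading monomials, one degree at a
    time, converges and loses at most the order c, the largest degree of a
    generator. *)
Lemma standard_basis J : ideal J -> exists (F : seq (multinom n))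
    (phi : multinom n -> S) (c : nat), (forall m, m \in F -> J (phi m)) /\
  forall D w, J w -> ord_ge D w ->
    exists a, (forall m, ord_ge (D - c) (a m)) /\ w = \sum_(m <- F) a m * phi m.
Proof.
move=> idJ.
have [F [FE EF]] := dickson [set m | exists2 f, J f & is_lead f m].
have H m : exists f, m \in F -> J f /\ is_lead f m.
  by case mF: (m \in F); [have [f Jf fm] := FE _ mF; exists f|exists 0].
have [phi phiP] := choice H.
pose c := \max_(m <- F) mdeg m.
exists (undup F), phi, c; split=> [m|D w Jw wD]; first by rewrite mem_undup => /phiP [].
apply: (@division J) => //.
- exact: undup_uniq.
- by move=> m; rewrite mem_undup; apply: phiP.
- by move=> m; rewrite mem_undup => mF; apply: leq_bigmax_seq.
- move=> v m Jv vm; have [|k kF km] := EF m; first by exists v.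
  by exists k; rewrite ?mem_undup.
Qed.

(** The Noetherian property in the form used with Zorn's lemma: the finitely
    many generators of the union all lie in one member of the chain. *)
Lemma ideal_chain_stable J (G : set (set S)) : ideal J ->
  total_on G subset -> G !=set0 -> (forall I, G I -> ideal I) ->
  J = \bigcup_(I in G) I -> G J.
Proof.
move=> idJ tG [I0 GI0] idG JE.
have [F [phi [c [FJ Jgen]]]] := standard_basis idJ.
have [I GI FI] : exists2 I, G I & forall m, m \in F -> I (phi m).
  elim: F FJ {Jgen} => [|m F IHF] FJ; first by exists I0.
  have [|I GI FI] := IHF; first by move=> k kF; apply: FJ; rewrite inE kF orbT.
  have := FJ m (mem_head _ _); rewrite JE => -[I' GI' I'm].
  have [II'|I'I] := tG _ _ GI GI'.
    by exists I' => // k; rewrite inE => /orP [/eqP -> //|/FI/II'].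
  by exists I => // k; rewrite inE => /orP [/eqP ->|/FI //]; apply: I'I.
suff -> : J = I by [].
apply/seteqP; split=> [w Jw|w Iw]; last by rewrite JE; exists I.
have [a [_ ->]] := Jgen 0%N w Jw (@ord_ge0 _ _ _).
rewrite big_seq; apply: (subgroup_sum _ (ideal_subgroup (idG _ GI))).
by move=> m /FI Im; apply: idealMl => //; apply: idG.
Qed.

Definition plus_ord I N : set S := [set u | exists v w, [/\ I v, ord_ge N w & u = v + w]].

Lemma plus_ord_ideal I N : ideal I -> ideal (plus_ord I N).
Proof.
move=> idI; split; first by by exists 0, 0; rewrite addr0; split => //; case: idI.
move=> a _ _ [v [w [Iv wN ->]]] [v' [w' [Iv' wN' ->]]].
exists (a * v + v'), (a * w + w'); split; [exact: idI.2|exact: (@ord_ge_ideal n K N).2|].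
by rewrite mulrDr addrACA.
Qed.

Lemma sub_plus_ord I N : I `<=` plus_ord I N.
Proof. by move=> u Iu; exists u, 0; rewrite addr0; split => //; exact: ord_ge_zero. Qed.

Lemma ord_plus_ord I N : ideal I -> ord_ge N `<=` plus_ord I N.
Proof. by move=> [I0 _] u uN; exists 0, u; rewrite add0r. Qed.

Lemma plus_ord_min I J N : ideal J -> I `<=` J -> @ord_ge n K N `<=` J -> plus_ord I N `<=` J.
Proof. by move=> idJ IJ NJ _ [v [w [/IJ Jv /NJ Jw ->]]]; apply: idealD. Qed.

Lemma add_gen_plus_ord I N x :
  ideal I -> add_gen (plus_ord I N) x = plus_ord (add_gen I x) N.
Proof.
move=> idI; apply/seteqP; split.
  apply: add_gen_sub; first exact/plus_ord_ideal/add_gen_ideal.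
    apply: plus_ord_min; first exact/plus_ord_ideal/add_gen_ideal.
      by apply: subset_trans (@sub_plus_ord _ _); apply: sub_add_gen.
    by apply: ord_plus_ord; apply: add_gen_ideal.
  by apply: sub_plus_ord; apply: gen_add_gen; case: idI.
apply: plus_ord_min; first exact/add_gen_ideal/plus_ord_ideal.
  apply: add_gen_sub; first exact/add_gen_ideal/plus_ord_ideal.
    by apply: subset_trans (@sub_add_gen _ _ _); apply: sub_plus_ord.
  by apply: gen_add_gen; exact: (plus_ord_ideal _ idI).1.
by apply: subset_trans (@sub_add_gen _ _ _); apply: ord_plus_ord.
Qed.

(** If u x = v + w with v in I and w of high order, then w lies in I + (x), so
    it is a combination of a standard basis with coefficients of high order;
    the multiples of x that occur in it are subtracted from u. *)
Lemma artin_rees I x : ideal I -> (forall u, I (u * x) -> I u) ->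
  exists c, forall N u, plus_ord I (N + c) (u * x) -> plus_ord I N u.
Proof.
move=> idI Ix.
have [F [phi [c [FJ Jgen]]]] := standard_basis (add_gen_ideal x idI).
have H m : exists vg : S * S, m \in F -> I vg.1 /\ phi m = vg.1 + vg.2 * x.
  case mF: (m \in F); last by exists (0, 0).
  by have [v [g [Iv e]]] := FJ _ mF; exists (v, g).
have [vg vgP] := choice H.
exists c => N u [v [w [Iv wN e]]].
have Jw : add_gen I x w.
  by exists (- v), u; split; [apply: subgroupN => //; exact: ideal_subgroup|rewrite e addKr].
have [a [aN wE]] := Jgen _ _ Jw wN.
rewrite addnK in aN.
pose g := \sum_(m <- F) a m * (vg m).2.
exists (u - g), g; split; last by rewrite subrK.
  apply: Ix; rewrite mulrBl e wE /g mulr_suml -addrA.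
  have -> : \sum_(m <- F) a m * phi m - \sum_(m <- F) a m * (vg m).2 * x =
            \sum_(m <- F) a m * (vg m).1.
    rewrite -sumrB [LHS]big_seq [RHS]big_seq; apply: eq_bigr => m mF.
    by have [_ ->] := vgP _ mF; rewrite mulrDr mulrA addrK.
  apply: idealD => //.
  rewrite [X in I X]big_seq; apply: (subgroup_sum _ (ideal_subgroup idI)).
  by move=> m mF; apply: idealMl => //; have [] := vgP _ mF.
apply: (subgroup_sum _ (ord_ge_subgroup _)).
by move=> m _; rewrite mulrC; apply: ord_geMl.
Qed.

End StandardBases.

(** * The ideals (x_0^q, ..., x_(n-1)^q) *)

Section Box.
Variables (n p : nat).
Local Notation K := 'F_p.
Local Notation S := (mpser n K).
Implicit Types (f g h w : S) (m k : multinom n) (I J : set S).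

(** Described by coefficients rather than generators, for which see box_gen. *)
Definition box_ideal q : set S := [set f | forall m, (forall i, (m i < q)%N) -> f m = 0].

Lemma box_ideal_ideal q : ideal (box_ideal q).
Proof.
split=> [//|a u v uq vq m mq]; rewrite psD vq // addr0.
rewrite (psME _ _ (ltnSn _)) big1 // => k km; rewrite uq ?mulr0 // => i.
by rewrite mnmBE (leq_ltn_trans (leq_subr _ _)).
Qed.

Lemma colength_is_box q : colength_is p (box_ideal q) (q ^ n)%N.
Proof.
have -> : (q ^ n)%N = #|{ffun 'I_n -> 'I_q}| by rewrite card_ffun !card_ord.
pose mn (a : {ffun 'I_n -> 'I_q}) : multinom n := Multinom (mktuple (fun i => val (a i))).
have mnE a i : mn a i = a i by rewrite /mn multinomE tnth_mktuple.
have mnq (m : multinom n) : (forall i, (m i < q)%N) -> exists a, mn a = m.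
  move=> mq; exists [ffun i => Ordinal (mq i)]; apply/mnmP => i.
  by rewrite mnE ffunE.
have mn_inj : injective mn.
  by move=> a b ab; apply/ffunP => i; apply: val_inj; rewrite /= -mnE ab mnE.
exists (fun f => \row_i f (mn (enum_val i))); split.
- by move=> u v; apply/rowP => i; rewrite !mxE.
- move=> w.
  exists (fun m => if [pick a | mn a == m] is Some a then w 0 (enum_rank a) else 0).
  apply/rowP => i; rewrite mxE; case: pickP => [a /eqP/mn_inj ->|/(_ (enum_val i))].
    by rewrite enum_valK.
  by rewrite eqxx.
- move=> u; split=> [uq|e].
    by apply/rowP => i; rewrite !mxE uq // => j; rewrite mnE.
  move=> m /mnq [a <-]; have := congr1 (fun w : 'rV_ _ => w 0 (enum_rank a)) e.
  by rewrite !mxE enum_rankK.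
Qed.

Lemma box_ord N : box_ideal N `<=` ord_ge N.
Proof.
move=> f fN m mN; apply: fN => i; apply: leq_ltn_trans mN.
by rewrite mdegE (bigD1 i) //= leq_addr.
Qed.

Lemma ord_box t : (0 < n)%N -> ord_ge (n * t) `<=` box_ideal t.
Proof.
move=> n0 f fN m mt; apply: fN; have := mt (Ordinal n0); case: t mt => // t mt _.
rewrite mdegE (@leq_ltn_trans (n * t)) ?ltn_pmul2l //.
have -> : (n * t = \sum_(i < n) t)%N by rewrite sum_nat_const card_ord.
by apply: leq_sum => i _; rewrite -ltnS.
Qed.

End Box.

(** * Growth of the Hilbert-Samuel function *)

Lemma leq_exp2r_weak j a b : (a <= b)%N -> (a ^ j <= b ^ j)%N.
Proof. by move=> ab; case: j => [//|j]; rewrite leq_exp2r. Qed.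

Lemma leq_exp2l_weak a i j : (i <= j)%N -> (a.+1 ^ i <= a.+1 ^ j)%N.
Proof. by move=> ij; rewrite leq_pexp2l. Qed.

Section Growth.
Variables (n p : nat).
Local Notation K := 'F_p.
Local Notation S := (mpser n K).
Implicit Types (f g h w x : S) (m k : multinom n) (I J P : set S).

(** The Hilbert-Samuel function of the quotient by I. *)
Definition hilb I N : nat := colength p (plus_ord I N).

Lemma cofinite_plus_ord I N : ideal I -> cofinite p (plus_ord I N).
Proof.
move=> idI; apply: (@cofinite_sub p _ (@box_ideal n p N)).
- by exists (N ^ n)%N; apply: colength_is_box.
- exact: ideal_subgroup (plus_ord_ideal _ _).
- by apply: subset_trans (@ord_plus_ord _ _ _ _ _) => //; apply: box_ord.
Qed.

Lemma hilb_ub I N : ideal I -> (hilb I N <= N ^ n)%N.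
Proof.
move=> idI; rewrite -(colengthE (colength_is_box n p N)); apply: colength_sub.
- by exists (N ^ n)%N; apply: colength_is_box.
- exact: ideal_subgroup (plus_ord_ideal _ _).
- by apply: subset_trans (@ord_plus_ord _ _ _ _ _) => //; apply: box_ord.
Qed.

Lemma hilb_mono I N N' : ideal I -> (N <= N')%N -> (hilb I N <= hilb I N')%N.
Proof.
move=> idI le; apply: colength_sub; first exact: cofinite_plus_ord.
  exact: ideal_subgroup (plus_ord_ideal _ _).
apply: plus_ord_min; [exact: plus_ord_ideal|exact: sub_plus_ord|].
by apply: subset_trans (@ord_plus_ord _ _ _ _ _) => //; apply: ord_ge_le.
Qed.

Lemma hilb_colon I N x : ideal I ->
  hilb I N = (hilb (add_gen I x) N + colength p (colon (plus_ord I N) x))%N.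
Proof.
move=> idI; rewrite /hilb (colength_colon x (plus_ord_ideal N idI) (cofinite_plus_ord _ idI)).
by rewrite add_gen_plus_ord.
Qed.

(** The Hilbert-Samuel function has degree at most n - j. The multiplied-out
    form is meaningful also for j > n, where it forces I to be the unit ideal.
    *)
Definition growth_le I j := exists C, forall N, (hilb I N * N ^ j <= C * N ^ n)%N.

Lemma growth_le0 I : ideal I -> growth_le I 0.
Proof. by move=> idI; exists 1%N => N; rewrite muln1 mul1n hilb_ub. Qed.

(** Multiplication by x is injective modulo P, so by Artin-Rees hilb P N +
    hilb (P + (x)) (N + c) is at most hilb P (N + c). Adding N such
    inequalities bounds N * hilb (P + (x)) N. *)
Lemma growth_le_prime P x j : prime_ideal P -> ~ P x ->
  growth_le P j -> growth_le (add_gen P x) j.+1.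
Proof.
move=> [idP P1 Pprime] Px [C CP].
have idPx := add_gen_ideal x idP.
have Pxreg u : P (u * x) -> P u by move=> /Pprime [].
have [c ar] := artin_rees idP Pxreg.
have step N : (hilb P N + hilb (add_gen P x) (N + c) <= hilb P (N + c))%N.
  rewrite [X in (_ <= X)%N](hilb_colon _ x idP) addnC leq_add2l.
  apply: colength_sub; last exact: ar.
    by apply: cofinite_colon; [exact: plus_ord_ideal|exact: cofinite_plus_ord].
  exact: ideal_subgroup (plus_ord_ideal _ _).
have steps N t : (t * hilb (add_gen P x) N <= hilb P (N + t * c))%N.
  elim: t => [//|t IHt].
  rewrite mulSnr (mulSnr t) addnA; apply: leq_trans (step _); apply: leq_add => //.
  by apply: hilb_mono => //; rewrite -addnA leq_addr.
exists (C * c.+1 ^ n)%N => N.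
rewrite expnS mulnCA mulnA.
apply: (@leq_trans (hilb P (N + N * c) * (N + N * c) ^ j)%N).
  by apply: leq_mul; [rewrite steps|rewrite leq_exp2r_weak // leq_addr].
apply: leq_trans (CP _) _.
by rewrite -mulnS expnMn -mulnA [(N ^ n * _)%N]mulnC.
Qed.

Lemma hilb_ord0 I : ideal I -> hilb I 0 = 0%N.
Proof.
move=> idI; rewrite /hilb.
suff -> : plus_ord I 0 = setT by rewrite (colengthE (colength_is_setT p _)).
by apply/seteqP; split => // u _; apply: ord_plus_ord.
Qed.

(** The ideal (I + ord_ge M.+1 : x) contains I + ord_ge M, so hilb I M.+1 -
    hilb I M is at most hilb (I + (x)) M.+1. Summing raises the degree by at
    most one. *)
Lemma growth_le_add_gen I x j : ideal I -> x mnm0 = 0 ->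
  growth_le (add_gen I x) j.+1 -> growth_le I j.
Proof.
move=> idI x0 [C Cx]; exists C => N.
have x1 : ord_ge 1 x by move=> m; rewrite ltnS leqn0 mdeg_eq0 => /eqP ->.
have idIx := add_gen_ideal x idI.
have step M : (hilb I M.+1 <= hilb (add_gen I x) M.+1 + hilb I M)%N.
  rewrite (hilb_colon _ x idI) leq_add2l; apply: colength_sub; first exact: cofinite_plus_ord.
    exact: ideal_subgroup (colon_ideal _ (plus_ord_ideal _ _)).
  apply: plus_ord_min; first exact: (colon_ideal _ (plus_ord_ideal _ _)).
    by apply: subset_trans (@sub_colon _ _ _ _); [exact: sub_plus_ord|exact: plus_ord_ideal].
  move=> u uM; have uxM : ord_ge M.+1 (u * x) by have := ord_geM uM x1; rewrite addn1.
  exact: ord_plus_ord.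
have le M : (M <= N)%N -> (hilb I M <= M * hilb (add_gen I x) N)%N.
  elim: M => [_|M IHM MN]; first by rewrite hilb_ord0.
  apply: leq_trans (step M) _; rewrite mulSn; apply: leq_add (IHM (ltnW MN)).
  exact: hilb_mono.
apply: leq_trans (Cx N); rewrite expnS mulnA leq_mul2r [X in (_ <= X)%N]mulnC.
by rewrite le // orbT.
Qed.

(** The quotient by I is an extension of the quotient by I + (a) by the
    quotient by (I : a). Hence an ideal I that is maximal among those of fast
    growth is prime: if ab lies in I and neither factor does, both ideals on
    the right are larger than I. *)
Lemma growth_le_product I a j : ideal I -> growth_le (add_gen I a) j ->
  growth_le (colon I a) j -> growth_le I j.
Proof.
move=> idI [C1 H1] [C2 H2]; exists (C1 + C2)%N => N.
rewrite (hilb_colon _ a idI) mulnDl mulnDl; apply: leq_add (H1 N) _.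
apply: leq_trans (H2 N); rewrite leq_mul2r; apply/orP; right.
apply: colength_sub; first by apply: cofinite_plus_ord; apply: colon_ideal.
  exact: ideal_subgroup (colon_ideal _ (plus_ord_ideal _ _)).
apply: plus_ord_min; first exact: (colon_ideal _ (plus_ord_ideal _ _)).
  by move=> u Iua; exact: (@sub_plus_ord n p I N _ Iua).
move=> u uN; have uaN : ord_ge N (u * a) by rewrite mulrC; apply: ord_geMl.
exact: ord_plus_ord.
Qed.

Lemma growth_le_unit I j : I 1 -> ideal I -> growth_le I j.
Proof.
move=> I1 idI; exists 0%N => N; rewrite /hilb.
suff -> : plus_ord I N = setT by rewrite (colengthE (colength_is_setT p _)).
apply/seteqP; split => // u _; apply: sub_plus_ord; exact: ideal1.
Qed.

Lemma prime_of_growth I j : ideal I -> ~ growth_le I j ->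
  exists P, [/\ prime_ideal P, I `<=` P & ~ growth_le P j].
Proof.
move=> idI bI; pose bad P := [/\ ideal P, I `<=` P & ~ growth_le P j].
have badI : bad I by split.
have [|P [bP Pmax]] := @Zorn_bigcup S (fun P => P = set0 \/ bad P).
  move=> F Fbad tF; have [[P0 [FP0 bP0]]|nF] := pselect (exists P0, F P0 /\ bad P0); last first.
    left; apply/seteqP; split => // u [P FP Pu].
    by case: (Fbad _ FP) => [P0|bP]; [rewrite P0 in Pu|case: nF; exists P].
  right; pose G := [set P | F P /\ bad P].
  have -> : \bigcup_(P in F) P = \bigcup_(P in G) P.
    apply/seteqP; split=> u [P FP Pu]; last by exists P => //; case: FP.
    by case: (Fbad _ FP) => [P0'|bP]; [rewrite P0' in Pu|exists P].
  have tG : total_on G subset by move=> P Q [FP _] [FQ _]; apply: tF.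
  suff idU : ideal (\bigcup_(P in G) P).
    by have [] := @ideal_chain_stable n p _ G idU tG _ _ erefl;
      [exists P0|move=> Q [_ []]|].
  split; first by exists P0 => //; case: bP0 => [[]].
  move=> a u v [P GP Pu] [Q GQ Qv].
  have [PQ|QP] := tG _ _ GP GQ; [exists Q => //|exists P => //].
    by case: GQ => _ [[_ QD] _ _]; apply: QD => //; apply: PQ.
  by case: GP => _ [[_ PD] _ _]; apply: PD => //; apply: QP.
have {bP} bP : bad P.
  case: bP => // P0; case: (Pmax I); last by right.
  by rewrite P0; split => // /(_ 0 idI.1).
have [idP IP gP] := bP.
have max Q : ideal Q -> P `<=` Q -> growth_le Q j \/ Q `<=` P.
  move=> idQ PQ; have [QP|QP] := pselect (Q `<=` P); [by right|left].
  apply: contrapT => gQ; apply: (Pmax Q) => //; right; split => //.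
  exact: subset_trans IP PQ.
exists P; split=> //; split=> [//|P1|a b Pab]; first by apply: gP; apply: growth_le_unit.
apply: contrapT => /not_orP [nPa nPb]; apply: gP; apply: (@growth_le_product _ a) => //.
  have [//|Q] := max _ (add_gen_ideal a idP) (@sub_add_gen _ _ _).
  by case: nPa; apply: Q; apply: gen_add_gen; case: idP.
have [//|Q] := max _ (colon_ideal a idP) (@sub_colon _ _ _ idP).
by case: nPb; apply: Q; rewrite /colon /= mulrC.
Qed.

Definition max_ideal : set S := [set f | f mnm0 = 0].

Lemma max_ideal_ord : max_ideal = ord_ge 1.
Proof.
apply/seteqP; split=> f f0; last by apply: f0; rewrite mdeg0.
by move=> m; rewrite ltnS leqn0 mdeg_eq0 => /eqP ->.
Qed.

Lemma max_ideal_ideal : ideal max_ideal.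
Proof. by rewrite max_ideal_ord; apply: ord_ge_ideal. Qed.

Lemma colength_max : colength_is p max_ideal 1.
Proof.
exists (fun f => \row_i f mnm0); split.
- by move=> u v; apply/rowP => i; rewrite !mxE.
- move=> w; exists (fun m => w 0 0); apply/rowP => i; rewrite mxE.
  by rewrite ord1.
- move=> u; split=> [u0|/rowP /(_ 0)]; last by rewrite !mxE.
  by apply/rowP => i; rewrite !mxE.
Qed.

Lemma unit_of_not_max f : f mnm0 != 0 -> exists g, f * g = 1.
Proof.
move=> f0; pose c := (f mnm0)^-1 : K.
have [|g e] := @ps_one_sub_unit n K (1 - f *+ c).
  by rewrite psB psMn -[f _ *+ _]mulr_natl natr_Zp mulVf // ps1 eqxx subrr.
exists (g *+ c); rewrite mulrnAr -mulrnAl -[RHS]e.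
by rewrite subKr.
Qed.

Lemma sub_max_ideal I : ideal I -> ~ I 1 -> I `<=` max_ideal.
Proof.
move=> idI I1 f If; apply: contrapT => /eqP/unit_of_not_max [g fg].
by apply: I1; rewrite -fg; apply: idealMr.
Qed.

Lemma hilb_gt0 I N : ideal I -> ~ I 1 -> (0 < hilb I N.+1)%N.
Proof.
move=> idI I1; rewrite -(colengthE colength_max); apply: colength_sub.
- exact: cofinite_plus_ord.
- exact: ideal_subgroup max_ideal_ideal.
- apply: plus_ord_min; [exact: max_ideal_ideal|exact: sub_max_ideal|].
  by rewrite max_ideal_ord; apply: ord_ge_le.
Qed.

Lemma growth_le_proper I j : ideal I -> ~ I 1 -> growth_le I j -> (j <= n)%N.
Proof.
move=> idI I1 [C HC]; rewrite leqNgt; apply/negP => nj.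
have := HC C.+1; rewrite leqNgt => /negP; apply.
apply: (@leq_trans (C.+1 ^ n.+1)%N).
  by rewrite expnS ltn_mul2r expn_gt0 /= ltnSn.
apply: (@leq_trans (1 * C.+1 ^ j)%N); first by rewrite mul1n leq_exp2l_weak.
by rewrite leq_mul2r hilb_gt0 // orbT.
Qed.

Lemma growth_max j : (j <= n)%N -> growth_le max_ideal j.
Proof.
move=> jn; exists 1%N => -[|N].
  by rewrite hilb_ord0 ?mul0n //; exact: max_ideal_ideal.
rewrite /hilb; have -> : plus_ord max_ideal N.+1 = max_ideal.
  apply/seteqP; split; last exact: sub_plus_ord.
  apply: plus_ord_min => //; first exact: max_ideal_ideal.
  by rewrite max_ideal_ord; apply: ord_ge_le.
by rewrite (colengthE colength_max) !mul1n leq_exp2l_weak.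
Qed.

(** The t^n monomials of a cube of side t have degree less than n t. *)
Lemma zero_growth : (0 < n)%N -> ~ growth_le [set 0] 1.
Proof.
move=> n0 [C HC].
(* Large enough for t ^ n * (n * t) to exceed C * (n * t) ^ n. *)
pose t := (C * n ^ n).+1.
have := HC (n * t)%N; rewrite leqNgt => /negP; apply.
rewrite expn1; apply: (@leq_trans (t ^ n * (n * t))%N).
  rewrite expnMn mulnA [(_ ^ n * (n * t))%N]mulnC ltn_mul2r.
  by rewrite expn_gt0 /= (@leq_trans t) // leq_pmull.
rewrite leq_mul2r; apply/orP; right.
rewrite -(colengthE (colength_is_box n p t)); apply: colength_sub.
- by apply: cofinite_plus_ord; exact: ideal0.
- exact: ideal_subgroup (@box_ideal_ideal n p t).
- apply: plus_ord_min; [exact: box_ideal_ideal| |exact: ord_box].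
  by move=> _ ->; exact: (@box_ideal_ideal n p t).1.
Qed.

End Growth.

(** * Ideals of a quotient ring *)

Section QuotientIdeals.
Variables (A : comPzRingType) (X : set A).
Implicit Types (I J : set A) (P : set (quo X)).

Definition qpi (a : A) : quo X := \pi_(quo X) a.

Lemma qpi_eq a b : qpi a = qpi b <-> ideal_gen X (a - b).
Proof. by split => [/quo_eqP/ideal_predP|/ideal_predP/quo_eqP]. Qed.

Lemma qpiD a b : qpi (a + b) = qpi a + qpi b.
Proof. by rewrite /qpi quo_addE. Qed.

Lemma qpiM a b : qpi (a * b) = qpi a * qpi b.
Proof. by rewrite /qpi -quo_mulE. Qed.

Lemma qpiZ a b : qpi (a * b) = a *: qpi b.
Proof. by rewrite /qpi -quo_scaleE. Qed.

Lemma qpi1 : qpi 1 = 1. Proof. by []. Qed.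

Lemma qpi0 : qpi 0 = 0.
Proof. by apply: (addrI (qpi 0)); rewrite -qpiD !addr0. Qed.

Lemma qpiB : {morph qpi : a b / a - b}.
Proof. by move=> a b; apply: (addIr (qpi b)); rewrite -qpiD !subrK. Qed.

Lemma qpi_eq0 a : qpi a = 0 <-> ideal_gen X a.
Proof. by rewrite -qpi0 qpi_eq subr0. Qed.

Lemma qpi_repr (x : quo X) : qpi (repr x) = x.
Proof. exact: reprK. Qed.

Lemma qpi_exp a k : qpi (a ^+ k) = qpi a ^+ k.
Proof. by elim: k => [|k IHk]; rewrite ?expr0 ?qpi1 // !exprS qpiM IHk. Qed.

Definition push I : set (quo X) := [set x | I (repr x)].
Definition pull P : set A := [set a | P (qpi a)].

Lemma push_pi I a : ideal I -> ideal_gen X `<=` I -> push I (qpi a) <-> I a.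
Proof.
move=> idI XI; have /XI Id : ideal_gen X (repr (qpi a) - a) by apply/qpi_eq; rewrite qpi_repr.
rewrite /push /=; split => Ia.
  by rewrite -[a](subKr (repr (qpi a))); apply: (ideal_subgroup idI).2.
by rewrite -[repr _](subrK a); apply: idealD.
Qed.

Lemma pull_ideal P : ideal P -> ideal (pull P).
Proof.
by move=> [P0 PD]; split=> [|a u v]; rewrite /pull /= ?qpi0 // qpiD qpiM; apply: PD.
Qed.

Lemma pull_gen P : ideal P -> ideal_gen X `<=` pull P.
Proof. by move=> [P0 _] a /qpi_eq0 a0; rewrite /pull /= a0. Qed.

Lemma push_ideal I : ideal I -> ideal_gen X `<=` I -> ideal (push I).
Proof.
move=> idI XI; have [I0 ID] := idI; split => [|a u v].
  by rewrite -qpi0; apply/push_pi.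
rewrite -[a]qpi_repr -[u]qpi_repr -[v]qpi_repr -qpiM -qpiD !push_pi //.
exact: ID.
Qed.

Lemma pull_prime P : prime_ideal P -> prime_ideal (pull P).
Proof.
move=> [idP P1 PM]; split; first exact: pull_ideal.
  by rewrite /pull /= qpi1.
by move=> a b; rewrite /pull /= qpiM; apply: PM.
Qed.

Lemma push_prime I : prime_ideal I -> ideal_gen X `<=` I -> prime_ideal (push I).
Proof.
move=> [idI I1 IM] XI; split; first exact: push_ideal.
  by rewrite -qpi1 push_pi.
move=> a b; rewrite -[a]qpi_repr -[b]qpi_repr -qpiM !push_pi //; exact: IM.
Qed.

Lemma pull_proper P P' : P `<` P' -> pull P `<` pull P'.
Proof.
move=> [PP' nP]; split => [a|n]; first exact: PP'.
by apply: nP => x; rewrite -[x]qpi_repr; apply: n.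
Qed.

Lemma push_proper I I' : ideal I -> ideal I' -> ideal_gen X `<=` I ->
  I `<` I' -> push I `<` push I'.
Proof.
move=> idI idI' XI [II' nI]; have XI' := subset_trans XI II'.
split=> [x|n]; first exact: II'.
by apply: nI => a /(push_pi _ idI' XI')/n/(push_pi _ idI XI).
Qed.

End QuotientIdeals.

Lemma ideal_gen_sub (A : comPzRingType) (X I : set A) :
  ideal I -> X `<=` I -> ideal_gen X `<=` I.
Proof. by move=> idI XI a; apply. Qed.

Lemma sub_ideal_gen (A : comPzRingType) (X : set A) : X `<=` ideal_gen X.
Proof. by move=> a Xa I [_]; apply. Qed.

Lemma ideal_gen_id (A : comPzRingType) (I : set A) : ideal I -> ideal_gen I = I.
Proof.
by move=> idI; apply/seteqP; split; [apply: ideal_gen_sub|apply: sub_ideal_gen].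
Qed.

(** * The dimension of a hypersurface *)

Lemma supremum_nat (E : set nat) k :
  E k -> (forall i, E i -> (i <= k)%N) -> supremum 0%N E = k.
Proof.
move=> Ek kE; rewrite /supremum; case: eqP => [E0|_]; first by rewrite E0 in Ek.
apply: xget_unique => [|j [jE jmin]].
  by split=> [i /kE //|i iE]; apply: iE.
apply/eqP; rewrite eqn_leq; apply/andP; split; last exact: (jE k Ek).
by apply: (jmin k) => i /kE.
Qed.

Section KrullDim.
Variables (p d : nat).
Local Notation K := 'F_p.
Local Notation S := (mpser d.+1 K).
Variable Q : S.
Hypotheses (Q0 : Q != 0) (Qm : Q mnm0 = 0) (d0 : (0 < d)%N).

Lemma growth_le_sub (I J : set S) j : ideal I -> ideal J -> I `<=` J ->
  growth_le I j -> growth_le J j.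
Proof.
move=> idI idJ IJ [C HC]; exists C => N; apply: leq_trans (HC N).
rewrite leq_mul2r; apply/orP; right; apply: colength_sub.
- exact: cofinite_plus_ord.
- exact: ideal_subgroup (plus_ord_ideal _ _).
- apply: plus_ord_min; first exact: plus_ord_ideal.
    by apply: subset_trans IJ _; apply: sub_plus_ord.
  exact: ord_plus_ord.
Qed.

Lemma zero_prime : prime_ideal [set (0 : S)].
Proof.
split; first exact: ideal0.
  by move=> /eqP; rewrite oner_eq0.
by move=> a b /ps_mul_eq0.
Qed.

(** The degree of growth drops at every step, and P 0 starts at degree d since
    it contains Q. *)
Lemma prime_chain_le r (P : nat -> set S) :
  (forall i, (i <= r)%N -> prime_ideal (P i) /\ P i Q) ->
  (forall i, (i < r)%N -> P i `<` P i.+1) -> (r <= d)%N.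
Proof.
move=> Pp Plt.
have H i : (i <= r)%N -> growth_le (P i) i.+1.
  elim: i => [_|i IHi ir].
    have [[idP _ _] PQ] := Pp 0%N isT.
    apply: (@growth_le_sub (add_gen [set 0] Q)) => //; first exact/add_gen_ideal/ideal0.
      by apply: add_gen_sub => // _ ->; case: idP.
    apply: growth_le_prime; [exact: zero_prime|exact/eqP|].
    by apply: growth_le0; exact: ideal0.
  have [Pi _] := Pp i (ltnW ir); have [[idP _ _] _] := Pp i.+1 ir.
  have [PP /existsNP [x /not_implyP [Px nPx]]] := Plt i ir.
  have [idPi _ _] := Pi.
  apply: (@growth_le_sub (add_gen (P i) x)) => //; first exact: add_gen_ideal.
    exact: add_gen_sub.
  by apply: growth_le_prime => //; apply: IHi; apply: ltnW.
have [[idP P1 _] _] := Pp r (leqnn r).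
exact: growth_le_proper idP P1 (H r (leqnn r)).
Qed.

(** Adding an element of the maximal ideal lowers the degree of growth by at
    most one, and prime_of_growth then passes to a prime ideal without
    lowering it further. *)
Lemma prime_chain_ex i : (i < d)%N -> exists P : nat -> set S,
  [/\ forall j, (j <= i)%N -> prime_ideal (P j) /\ P j Q,
      forall j, (j < i)%N -> P j `<` P j.+1 & ~ growth_le (P i) i.+2].
Proof.
elim: i => [_|i IHi id].
  have [|P [Pp PQ Pg]] := @prime_of_growth _ p (add_gen [set 0] Q) 2 (add_gen_ideal _ (ideal0 _)).
    move=> /(growth_le_add_gen (ideal0 _) Qm); exact: zero_growth.
  exists (fun=> P); split=> // j _; split=> //; apply: PQ; exact: gen_add_gen.
have [P [Pp Plt Pg]] := IHi (ltnW id).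
have [Pi PiQ] := Pp i (leqnn i); have [idP P1 _] := Pi.
have Pm := sub_max_ideal idP P1.
have [x xm Px] : exists2 x, max_ideal x & ~ P i x.
  apply: contrapT => n; apply: Pg.
  have -> : P i = @max_ideal d.+1 p.
    by apply/seteqP; split => // x xm; apply: contrapT => Px; apply: n; exists x.
  by apply: growth_max; apply: ltnW; rewrite ltnS.
have [|P' [P'p PP' P'g]] := @prime_of_growth _ p (add_gen (P i) x) i.+3 (add_gen_ideal _ idP).
  by move=> /(growth_le_add_gen idP xm).
exists (fun j => if (j <= i)%N then P j else P'); split=> [j|j|]; last by rewrite ltnn.
- case: ifP => [ji _|_ _]; first exact: Pp.
  by split=> //; apply: PP'; apply: sub_add_gen.
- move=> ji1; have [->|ji] : j = i \/ (j < i)%N.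
    by move: ji1; rewrite ltnS leq_eqVlt => /orP [/eqP|]; [left|right].
  2: by rewrite (ltnW ji) ji; apply: Plt.
  rewrite leqnn ltnn; split; first exact: subset_trans (@sub_add_gen _ _ _) PP'.
  by move=> /(_ x) n; apply: Px; apply: n; apply: PP'; apply: gen_add_gen; case: idP.
Qed.

(** The maximal ideal is put on top of the chain of d primes from
    prime_chain_ex. *)
Lemma krull_dim_hypersurface : krull_dim (quo [set Q]) = d.
Proof.
apply: supremum_nat; last first.
  move=> r [P [Pp Plt]]; apply: (@prime_chain_le r (fun i => pull (P i))).
    move=> i ir; split; first exact/pull_prime/Pp.
    have [idP _ _] := Pp i ir.
    by apply: pull_gen => //; apply: sub_ideal_gen.
  by move=> i ir; apply/pull_proper/Plt.
(* The top prime of this chain still grows too fast to be maximal. *)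
have [P [Pp Plt Pg]] := @prime_chain_ex d.-1 (eq_ind_r (fun x => (d.-1 < x)%N) (leqnn _) (esym (prednK d0))).
have mP : prime_ideal (@max_ideal d.+1 p).
  split; first exact: max_ideal_ideal.
    by rewrite /max_ideal /= ps1 eqxx => /eqP; rewrite oner_eq0.
  move=> a b ab; apply: contrapT => /not_orP [/eqP/unit_of_not_max [a' aa'] /eqP/unit_of_not_max [b' bb']].
  have : max_ideal ((a * b) * (a' * b')) by apply: idealMr => //; apply: max_ideal_ideal.
  by rewrite mulrACA aa' bb' mulr1 /max_ideal /= ps1 eqxx => /eqP; rewrite oner_eq0.
pose P' j := if (j < d)%N then P j else @max_ideal d.+1 p.
have P'p j : (j <= d)%N -> prime_ideal (P' j) /\ P' j Q.
  rewrite /P'; case: ifP => [jd _|//]; by apply: Pp; rewrite -ltnS prednK.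
have P'lt j : (j < d)%N -> P' j `<` P' j.+1.
  move=> jd; rewrite /P' jd; case: ifP => jd'; first by apply: Plt; rewrite -ltnS prednK.
  have [[idP P1 _] _] := Pp j (eq_ind _ (fun x => (j < x)%N) jd _ (esym (prednK d0))).
  split; first exact: sub_max_ideal.
  have jE : j = d.-1.
    have e : j.+1 = d by apply/eqP; rewrite eqn_leq jd leqNgt jd'.
    by rewrite -[in RHS]e.
  move=> mPj; apply: Pg; rewrite -jE; have -> : P j = @max_ideal d.+1 p.
    by apply/seteqP; split => //; exact: sub_max_ideal.
  by apply: growth_max; rewrite ltnS.
have QP j : (j <= d)%N -> ideal_gen [set Q] `<=` P' j.
  by move=> /P'p [[idP _ _] PQ]; apply: ideal_gen_sub => // _ ->.
exists (fun j => push (P' j)); split=> [j jd|j jd].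
  by apply: push_prime; [case: (P'p j jd)|apply: QP].
have [[idP _ _] _] := P'p j (ltnW jd); have [[idP' _ _] _] := P'p j.+1 jd.
by apply: push_proper => //; [apply: QP; apply: ltnW|apply: P'lt].
Qed.

End KrullDim.

(** * Length and colength *)

Section Length.
Variables (n p : nat).
Local Notation K := 'F_p.
Local Notation S := (mpser n K).
Implicit Types (I J : set S).

(** An element b of maximal order outside I is multiplied into I by every non-
    unit. *)
Lemma ideal_socle I N : ideal I -> ord_ge N `<=` I -> ~ I 1 ->
  exists b, ~ I b /\ colon I b = @max_ideal n p.
Proof.
move=> idI NI I1.
(* D is the largest order of an element outside I. *)
have [D [b [bD Ib]] Dmax] : exists2 D, exists b, ord_ge D b /\ ~ I b &
    ord_ge D.+1 `<=` I.
  elim: N NI => [|N IHN] NI; first by case: I1; apply: NI.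
  have [NI'|/existsNP [b /not_implyP [bN Ib]]] := pselect (ord_ge N `<=` I).
    exact: IHN.
  by exists N => //; exists b.
exists b; split=> //; apply/seteqP; split.
  apply: sub_max_ideal; first exact: colon_ideal.
  by rewrite /colon /= mul1r.
rewrite max_ideal_ord => f f1; apply: Dmax.
by have := ord_geM f1 bD; rewrite add1n.
Qed.

(** Adding a socle element lowers the colength by one. *)
Lemma composition_series k I N : ideal I -> ord_ge N `<=` I -> colength_is p I k ->
  exists C : nat -> set S, [/\ C 0%N = I,
    forall i, (i <= k)%N -> ideal (C i) /\ I `<=` C i &
    forall i, (i < k)%N -> C i `<` C i.+1].
Proof.
elim: k I => [|k IHk] I idI NI Ik; first by exists (fun=> I); split=> // i _; split.
have cI : cofinite p I by exists k.+1.
have I1 : ~ I 1.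
  move=> I1; have IT : I = setT by apply/seteqP; split=> // u _; apply: ideal1.
  by rewrite IT in Ik; have := colength_is_unique Ik (colength_is_setT p _).
have [b [Ib bm]] := ideal_socle idI NI I1.
have := colength_colon b idI cI; rewrite bm (colengthE (colength_max n p)) (colengthE Ik).
rewrite addn1 => -[kE].
have [|||C [C0 CP Clt]] := IHk (add_gen I b).
- exact: add_gen_ideal.
- exact: subset_trans NI (@sub_add_gen _ _ _).
- by rewrite kE; apply: colengthP; apply: cofinite_add_gen.
exists (fun i => if i is j.+1 then C j else I); split=> [//|[|i] ik|[|i] ik].
- by split.
- have [idC IC] := CP i ik; split=> //; exact: subset_trans (@sub_add_gen _ _ _) IC.
- rewrite C0; split; first exact: sub_add_gen.
  by move=> /(_ b) h; apply: Ib; apply: h; apply: gen_add_gen; case: idI.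
- exact: Clt.
Qed.

Lemma ideal_chain_le k I r (C : nat -> set S) : colength_is p I k ->
  (forall i, (i <= r)%N -> ideal (C i) /\ I `<=` C i) ->
  (forall i, (i < r)%N -> C i `<` C i.+1) -> (r <= k)%N.
Proof.
move=> Ik CP Clt; have cI : cofinite p I by exists k.
suff H i : (i <= r)%N -> (colength p (C i) + i <= k)%N.
  by apply: leq_trans (H r (leqnn r)); rewrite leq_addl.
elim: i => [_|i IHi ir].
  have [idC IC] := CP 0%N isT; rewrite addn0 -(colengthE Ik).
  by apply: colength_sub => //; apply: ideal_subgroup.
apply: leq_trans (IHi (ltnW ir)); rewrite addnS -addSn leq_add2r.
have [idC IC] := CP i (ltnW ir); have [idC' IC'] := CP i.+1 ir.
apply: colength_proper; last exact: Clt.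
- by apply: cofinite_sub cI _ IC; apply: ideal_subgroup.
- exact: ideal_subgroup.
Qed.

(** Submodules are the ideals between I and the whole ring. Strict inclusions
    change the colength, so no chain is longer than k, and composition_series
    attains k. *)
Lemma length_quo_quo (Y : set S) (X : set (quo Y)) I N k :
  ideal I -> ord_ge N `<=` I -> colength_is p I k ->
  (forall s, ideal_gen X (qpi Y s) <-> I s) -> length (quo X) = k.
Proof.
move=> idI NI Ik XI; pose rho s : quo X := qpi X (qpi Y s).
have rhoS x : exists s, rho s = x.
  by exists (repr (repr x)); rewrite /rho !qpi_repr.
have rhoE s t : rho s = rho t <-> I (s - t).
  by rewrite /rho qpi_eq -qpiB XI.
have rhoD s t : rho (s + t) = rho s + rho t by rewrite /rho !qpiD.
have rhoM a s : rho (a * s) = qpi Y a *: rho s.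
  by rewrite /rho -qpiZ -qpiM.
have rho0 : rho 0 = 0 by rewrite /rho !qpi0.
have rhoI s : I s <-> rho s = 0 by rewrite -rho0 rhoE subr0.
apply: supremum_nat; last first.
  move=> r [C [Csub Clt]]; pose C' i := [set s | C i (rho s)].
  apply: (ideal_chain_le (C := C') Ik) => [i ir|i ir].
    have [C0 CD] := Csub i ir; split; last by move=> s /rhoI s0; rewrite /C' /= s0.
    split; first by rewrite /C' /= rho0.
    by move=> a s t Cs Ct; rewrite /C' /= rhoD rhoM; apply: CD.
  have [CC nC] := Clt i ir; split; first by move=> s; apply: CC.
  by move=> n'; apply: nC => x; have [s <-] := rhoS x; apply: n'.
have [C [C0 CP Clt]] := composition_series idI NI Ik.
pose C' i : set (quo X) := [set x | exists2 s, C i s & rho s = x].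
have C'E i s : (i <= k)%N -> C' i (rho s) <-> C i s.
  move=> /CP [idC IC]; split=> [[t Ct /esym/rhoE/IC st]|Cs]; last by exists s.
  by rewrite -[s](subrK t); apply: idealD.
exists C'; split=> [i ik|i ik].
  have [idC IC] := CP i ik; split; first by exists 0 => //; case: idC.
  move=> a _ _ [s Cs <-] [t Ct <-]; exists (repr a * s + t); first exact: idC.2.
  by rewrite rhoD rhoM qpi_repr.
have [CC nC] := Clt i ik; split; first by move=> x [s /CC Cs <-]; exists s.
by move=> n'; apply: nC => s /(C'E _ _ ik)/n'/(C'E _ _ (ltnW ik)).
Qed.

End Length.

(** * Hilbert-Kunz functions as colengths *)

Lemma ord_sub_box n p q : exists N, ord_ge N `<=` @box_ideal n p q.
Proof.
case: n => [|n]; last by exists (n.+1 * q)%N; apply: ord_box.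
by exists 1%N => f f1 m _; apply: f1; rewrite mdegE big_ord0.
Qed.

Section HilbertKunz.
Variables (n p : nat).
Hypothesis p_prime : prime p.
Local Notation K := 'F_p.
Local Notation S := (mpser n K).
Implicit Types (f g : S) (m : multinom n).

Lemma box_gen q f : box_ideal q f ->
  exists g : 'I_n -> S, f = \sum_i monomial K (mnm_muln (mnm1 i) q) * g i.
Proof.
move=> fq.
pose c m := [pick i : 'I_n | (q <= m i)%N].
have qU i m : (mnm_muln (mnm1 i) q <=m m) = (q <= m i)%N.
  apply/mnm_lepP/idP => [/(_ i)|qm j]; rewrite mulmnE mnm1E ?eqxx ?mul1n //.
  by case: eqP => [<-|_]; rewrite ?mul1n ?mul0n.
exists (fun i m => if c (m +m mnm_muln (mnm1 i) q) == Some i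
                   then f (m +m mnm_muln (mnm1 i) q) else 0).
apply: psP => m; rewrite ps_sum.
under eq_bigr do rewrite monomialME qU.
case cm: (c m) => [i|].
  have qi : (q <= m i)%N by move: cm; rewrite /c; case: pickP => // j qj [<-].
  rewrite (bigD1 i) //= qi submK ?qU // cm eqxx big1 ?addr0 // => j ji.
  by case: ifP => // qj; rewrite submK ?qU // cm; case: eqP => // -[ij]; rewrite ij eqxx in ji.
move: cm; rewrite /c; case: pickP => // qm _.
rewrite fq => [|i]; last by rewrite ltnNge qm.
by rewrite big1 // => i _; rewrite qm.
Qed.

Lemma monomial_box q i : box_ideal q (monomial K (mnm_muln (mnm1 i) q) : S).
Proof.
move=> m mq; rewrite /monomial; case: eqP => // e.
by have := mq i; rewrite e mulmnE mnm1E eqxx mul1n ltnn.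
Qed.

Lemma mpser_pchar : p \in [pchar S].
Proof.
rewrite inE p_prime; apply/eqP; apply: psP => m; rewrite psMn.
by rewrite -mulr_natr pchar_Fp_0 // mulr0.
Qed.

Lemma frobD e f g : (f + g) ^+ (p ^ e) = f ^+ (p ^ e) + g ^+ (p ^ e).
Proof.
apply: exprDn_pchar.
by rewrite (eq_pnat _ (pcharf_eq mpser_pchar)) pnatX pnat_id.
Qed.

Lemma frob_sum e (J : Type) (r : seq J) (P : pred J) (F : J -> S) :
  (\sum_(j <- r | P j) F j) ^+ (p ^ e) = \sum_(j <- r | P j) F j ^+ (p ^ e).
Proof.
apply: (big_morph (fun f => f ^+ (p ^ e))); first exact: frobD.
by rewrite expr0n expn_eq0 (gtn_eqF (prime_gt0 p_prime)).
Qed.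

Lemma max_ideal_box : @max_ideal n p = box_ideal 1.
Proof.
apply/seteqP; split=> f f0.
  move=> m m1; have -> : m = mnm0; last exact: f0.
  by apply/mnmP => i; apply/eqP; rewrite mnm0E -leqn0 -ltnS.
by apply: f0 => i; rewrite mnm0E.
Qed.

Lemma max_ideal_frob e f : max_ideal f -> box_ideal (p ^ e) (f ^+ (p ^ e)).
Proof.
rewrite max_ideal_box => /box_gen [g ->]; rewrite frob_sum.
apply: (subgroup_sum _ (ideal_subgroup (@box_ideal_ideal n p _))) => i _.
rewrite exprMn monomialX; apply: (idealMr _ (@box_ideal_ideal n p _)).
by rewrite mulm1n; apply: monomial_box.
Qed.

Variable Q : S.
Hypothesis Qm : Q mnm0 = 0.
Local Notation A := (quo [set Q]).

Lemma Q_sub_max : ideal_gen [set Q] `<=` @max_ideal n p.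
Proof. by apply: ideal_gen_sub; [exact: max_ideal_ideal|move=> _ ->]. Qed.

Lemma local_max_idealE : local_max_ideal A = push (@max_ideal n p).
Proof.
have idm := @max_ideal_ideal n p.
have sub (I : set A) : ideal I -> ~ I 1 -> I `<=` push (@max_ideal n p).
  move=> idI I1 x; rewrite -[x]qpi_repr (push_pi _ idm Q_sub_max).
  by apply: (sub_max_ideal (pull_ideal idI)); rewrite /pull /= qpi1.
have m1 : ~ push (@max_ideal n p) (1 : A).
  rewrite -qpi1 (push_pi _ idm Q_sub_max) /max_ideal /= ps1 eqxx.
  by move/eqP; rewrite oner_eq0.
have idpm : ideal (push (@max_ideal n p) : set A) by exact: push_ideal Q_sub_max.
apply: xget_unique => [|M [idM M1 Mmax]].
  split=> // I idI I1 mI; apply/seteqP; split=> //; exact: sub.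
by rewrite -(Mmax _ idpm m1) //; exact: sub.
Qed.

(** The maximal ideal is generated by the variables and the q-th power map is
    additive, so the q-th powers of its elements generate (x_0^q, ...,
    x_(n-1)^q). *)
Lemma HK_colength e :
  HK A p e = colength p (add_gen (box_ideal (p ^ e)) Q).
Proof.
set q := (p ^ e)%N; set I := add_gen _ Q.
have idb := @box_ideal_ideal n p q.
have idI : ideal I by apply: add_gen_ideal.
have cb : cofinite p (@box_ideal n p q) by exists (q ^ n)%N; exact: colength_is_box.
have QI : ideal_gen [set Q] `<=` I.
  by apply: ideal_gen_sub => // _ ->; apply: gen_add_gen; case: idb.
have [N NI] := ord_sub_box n p q.
apply: (@length_quo_quo n p _ _ I N) => //.
- exact: subset_trans NI (@sub_add_gen _ _ _).
- by apply: colengthP; apply: cofinite_add_gen.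
rewrite (ideal_gen_id (ideal_gen_ideal _)).
set X := [set _ | _ in _].
have idX := ideal_gen_ideal X.
move=> s; split.
  rewrite -(push_pi s idI QI); apply: ideal_gen_sub; first exact: push_ideal.
  move=> _ [a am <-]; rewrite -[a]qpi_repr -qpi_exp (push_pi _ idI QI).
  apply: sub_add_gen; apply: max_ideal_frob.
  by move: am; rewrite local_max_idealE.
suff : I `<=` pull (ideal_gen X) by apply.
apply: add_gen_sub; first exact: pull_ideal.
  move=> f /box_gen [g ->].
  apply: (subgroup_sum _ (ideal_subgroup (pull_ideal idX))) => i _.
  apply: (idealMr _ (pull_ideal idX)); rewrite -[mnm1 i]mulm1n -!monomialX /pull /=.
  rewrite qpi_exp; apply: sub_ideal_gen; exists (qpi _ (monomial K (mnm1 i))); rewrite ?expr1 //.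
  rewrite local_max_idealE (push_pi _ (@max_ideal_ideal n p) Q_sub_max).
  by rewrite max_ideal_box -[mnm1 i]mulm1n; apply: monomial_box.
by apply: pull_gen => //; apply: sub_ideal_gen.
Qed.

End HilbertKunz.

(** * Monomial substitutions and slices *)

Section Pushforward.
Variables (n n' : nat) (K : comNzRingType).
Variables (e : multinom n -> multinom n') (s : multinom n').
Hypothesis eD : forall a b, e (a +m b) = e a +m e b.
Hypothesis es : forall k m, e k <=m e m +m s -> k <=m m.
Implicit Types (G H : mpser n K) (h : mpser n' K).

(** The substitution of the monomial e k for k. It is used for x_i -> x_i^p
    and for the inclusion of a ring with one variable fewer. *)
Definition ps_push G : mpser n' K := fun m =>
  if `[< exists k, e k = m >] then G (xget mnm0 [set k | e k = m]) else 0.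

(** When the target is free over the image of ps_push on a set of monomials s,
    these are the coordinates of h in that basis. *)
Definition slice h : mpser n K := fun m => h (e m +m s).

Lemma push_inj : injective e.
Proof.
move=> a b ab; have le x y : e x = e y -> x <=m y.
  by move=> xy; apply: es; rewrite xy lem_addr.
apply/mnmP => i; apply/eqP; rewrite eqn_leq.
by rewrite (mnm_lepP (le _ _ ab)) (mnm_lepP (le _ _ (esym ab))).
Qed.

Lemma push0 : e mnm0 = mnm0.
Proof. by apply: (@addmI _ (e mnm0)); rewrite -eD !addm0. Qed.

Lemma ps_pushE G k : ps_push G (e k) = G k.
Proof.
rewrite /ps_push; case: asboolP => [_|[]]; last by exists k.
by congr G; apply: xget_unique => // j /push_inj.
Qed.

Lemma ps_push_out G m : (forall k, e k <> m) -> ps_push G m = 0.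
Proof. by move=> em; rewrite /ps_push; case: asboolP => // -[k /em]. Qed.

Lemma ps_push_cases m : (exists k, m = e k) \/ (forall k, e k <> m).
Proof.
have [[k <-]|n1] := pselect (exists k, e k = m); [by left; exists k|right=> k ek].
by apply: n1; exists k.
Qed.

(** Coordinates are linear over the image of ps_push: by es a monomial e k
    divides e m + s only if k divides m. *)
Lemma slice_pushM G h : slice (ps_push G * h) = G * slice h.
Proof.
apply: psP => m; rewrite /slice.
rewrite (psME _ _ (ltnSn (mdeg (e m +m s)))) (psME _ _ (ltnSn (mdeg m))).
pose F (k' : multinom n') (k : multinom n) :=
  (e k == k')%:R * (G k * h ((e m +m s) -m k')).
transitivity (\sum_(k' : bmultinom n' (mdeg (e m +m s)).+1 | k' <=m e m +m s)
    \sum_(k : bmultinom n (mdeg m).+1 | k <=m m) F k' k).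
  apply: eq_bigr => k' k'm; have [[k ek]|nk] := ps_push_cases k'; last first.
    rewrite ps_push_out // mul0r big1 // => k _.
    by rewrite /F; case: eqP => [/nk //|_]; rewrite mul0r.
  have km : k <=m m by apply: es; rewrite -ek.
  have kP : (mdeg k < (mdeg m).+1)%N by rewrite ltnS lemc_mdeg ?lem_leo.
  rewrite (bigD1 (BMultinom kP)) //= big1 ?addr0; last first.
    move=> j /andP [_]; rewrite bmeqP /= => jk.
    rewrite /F ek; case: eqP => [/push_inj jk'|_]; last by rewrite mul0r.
    by rewrite jk' eqxx in jk.
  by rewrite /F /= ek ps_pushE eqxx mul1r.
rewrite exchange_big /=; apply: eq_bigr => k km.
have ekm : e m +m s = e k +m (e (m -m k) +m s) by rewrite addmA -eD [k +m _]addmC submK.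
have eks : e k <=m e m +m s by rewrite ekm lem_addr.
have kP : (mdeg (e k) < (mdeg (e m +m s)).+1)%N by rewrite ltnS lemc_mdeg ?lem_leo.
rewrite (bigD1 (BMultinom kP)) //= big1 ?addr0; last first.
  move=> j /andP [_]; rewrite bmeqP /= /F => jk.
  by rewrite eq_sym (negbTE jk) mul0r.
by rewrite /F /= eqxx mul1r {1}ekm addmC addmK.
Qed.

Lemma ps_pushB G H : ps_push (G - H) = ps_push G - ps_push H.
Proof.
apply: psP => m; have [[k ->]|nk] := ps_push_cases m.
  by rewrite psB !ps_pushE.
by rewrite psB !ps_push_out // subrr.
Qed.

Lemma sliceB : {morph slice : h h' / h - h'}.
Proof. by []. Qed.

Lemma ps_push_monomial k : ps_push (monomial K k) = monomial K (e k).
Proof.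
apply: psP => m; have [[j ->]|nk] := ps_push_cases m.
  by rewrite ps_pushE /monomial (inj_eq push_inj).
by rewrite ps_push_out // /monomial; case: eqP => // /esym /nk.
Qed.

Lemma ps_push1 : ps_push 1 = 1.
Proof. by rewrite -[1 in LHS]monomial0 ps_push_monomial push0 monomial0. Qed.

End Pushforward.

Section PushMorphism.
Variables (n n' : nat) (K : comNzRingType) (e : multinom n -> multinom n').
Hypothesis eD : forall a b, e (a +m b) = e a +m e b.
Hypothesis e0 : forall k m, e k <=m e m +m mnm0 -> k <=m m.
Local Notation push := (@ps_push n n' K e).
Implicit Types G H : mpser n K.

Lemma ps_pushM G H : push (G * H) = push G * push H.
Proof.
apply: psP => m; have [[k ->]|nk] := ps_push_cases e m.
  rewrite (ps_pushE e0) -[in RHS](addm0 (e k)).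
  have := congr1 (fun f : mpser n K => f k) (slice_pushM eD e0 G (push H)).
  rewrite /slice => ->; congr ((G * _) k); apply: psP => j.
  by rewrite addm0 (ps_pushE e0).
rewrite ps_push_out // (psME _ _ (ltnSn (mdeg m))) big1 // => k km.
have [[a ka]|na] := ps_push_cases e k; last by rewrite ps_push_out // mul0r.
have [[b mb]|nb] := ps_push_cases e (m -m k); last by rewrite (ps_push_out _ nb) mulr0.
by case: (nk (b +m a)); rewrite eD -ka -mb submK.
Qed.

Lemma ps_pushD G H : push (G + H) = push G + push H.
Proof. exact: (morphBD (@ps_pushB _ _ _ _ _ e0)). Qed.

Lemma ps_pushX G j : push (G ^+ j) = push G ^+ j.
Proof.
elim: j => [|j IHj]; first by rewrite !expr0 (ps_push1 _ eD e0).
by rewrite !exprS ps_pushM IHj.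
Qed.

Lemma ps_push_sum (J : Type) (r : seq J) (P : pred J) (F : J -> mpser n K) :
  push (\sum_(j <- r | P j) F j) = \sum_(j <- r | P j) push (F j).
Proof. exact: (morphB_sum (@ps_pushB _ _ _ _ _ e0)). Qed.

End PushMorphism.

Definition mk_mnm n (f : 'I_n -> nat) : multinom n := Multinom (mktuple f).

Lemma mk_mnmE n (f : 'I_n -> nat) i : mk_mnm f i = f i.
Proof. by rewrite multinomE tnth_mktuple. Qed.

(** * Flatness of Frobenius *)

Section Frobenius.
Variables (n p : nat).
Hypothesis p_prime : prime p.
Local Notation K := 'F_p.
Local Notation S := (mpser n K).
Implicit Types (F G H : S) (m k : multinom n) (a : {ffun 'I_n -> 'I_p}).

Definition frob_mn m := m *m+ p.
Definition res_mn a : multinom n := mk_mnm (fun i => val (a i)).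
Local Notation phi := (ps_push frob_mn).

Lemma frob_mnD m k : frob_mn (m +m k) = frob_mn m +m frob_mn k.
Proof. by apply/mnmP => i; rewrite !(mulmnE, mnmDE) mulnDl. Qed.

Lemma frob_mn_res a k m : frob_mn k <=m frob_mn m +m res_mn a -> k <=m m.
Proof.
move=> /mnm_lepP h; apply/mnm_lepP => i; have := h i.
rewrite mnmDE !mulmnE mk_mnmE leqNgt => h'; rewrite leqNgt; apply/negP => mk.
move/negP: h'; apply; apply: (@leq_trans ((m i).+1 * p)); last by rewrite leq_mul2r mk orbT.
by rewrite mulSn addnC ltn_add2r; apply: ltn_ord.
Qed.

Lemma frob_mn0 k m : frob_mn k <=m frob_mn m +m mnm0 -> k <=m m.
Proof.
move=> h; apply: (@frob_mn_res [ffun=> Ordinal (prime_gt0 p_prime)]).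
by move: h; congr (_ <=m _ +m _); apply/mnmP => i; rewrite mnm0E mk_mnmE ffunE.
Qed.

Definition mn_res m : {ffun 'I_n -> 'I_p} :=
  [ffun i => Ordinal (ltn_pmod (m i) (prime_gt0 p_prime))].
Definition mn_quo m : multinom n := mk_mnm (fun i => m i %/ p)%N.

Lemma mn_quoK m : frob_mn (mn_quo m) +m res_mn (mn_res m) = m.
Proof.
by apply/mnmP => i; rewrite mnmDE mulmnE !mk_mnmE ffunE /= -divn_eq.
Qed.

Lemma mn_res_unique m k a : frob_mn k +m res_mn a = m -> a = mn_res m /\ k = mn_quo m.
Proof.
move=> <-; split; [apply/ffunP => i; apply: val_inj|apply/mnmP => i].
  by rewrite ffunE /= mnmDE mulmnE mk_mnmE modnMDl modn_small //; apply: ltn_ord.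
rewrite mk_mnmE mnmDE mulmnE mk_mnmE divnMDl ?prime_gt0 // divn_small ?addn0 //.
exact: ltn_ord.
Qed.

Local Notation slc a := (@slice n n K frob_mn (res_mn a)).

(** The ring is free over its subring of series in the x_i^p, with the
    monomials of exponents less than p as a basis. *)
Lemma frob_decomposition F :
  F = \sum_(a : {ffun 'I_n -> 'I_p}) monomial K (res_mn a) * phi (slc a F).
Proof.
apply: psP => m; rewrite ps_sum (bigD1 (mn_res m)) //= big1 ?addr0.
  by rewrite -[X in _ = _ X](mn_quoK m) monomialDE (ps_pushE frob_mn0) /slice mn_quoK.
move=> a am; rewrite monomialME; case: ifP => // le.
rewrite ps_push_out // => k ek; have [] := @mn_res_unique m k a.
  by rewrite ek submK.
by move=> ea; rewrite ea eqxx in am.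
Qed.

Lemma box_frob q F : box_ideal q F -> box_ideal (q * p) (phi F).
Proof.
move=> Fq m mq; have [[k mk]|nk] := ps_push_cases frob_mn m; last by rewrite ps_push_out.
rewrite mk (ps_pushE frob_mn0) Fq // => i; have := mq i.
by rewrite mk mulmnE ltn_pmul2r // prime_gt0.
Qed.

Lemma box_slice q F a : box_ideal (q * p) F -> box_ideal q (slc a F).
Proof.
move=> Fq m mq; apply: Fq => i; rewrite mnmDE mulmnE mk_mnmE.
apply: (@leq_trans ((m i).+1 * p)); last by rewrite leq_mul2r mq orbT.
by rewrite mulSn addnC ltn_add2r; apply: ltn_ord.
Qed.

(** True of every polynomial over F_p; the sums of products of variables below
    need only the closure properties. *)
Definition frob_stable G := phi G = G ^+ p.

Lemma frob_slices q b G F : frob_stable G ->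
  add_gen (box_ideal (q * p)) (G ^+ (b * p)) F <->
  forall a, add_gen (box_ideal q) (G ^+ b) (slc a F).
Proof.
move=> Gp; have idb q' := @box_ideal_ideal n p q'.
have idJ := add_gen_ideal (G ^+ (b * p)) (idb (q * p)%N).
have phiG : phi (G ^+ b) = G ^+ (b * p).
  by rewrite (ps_pushX frob_mnD frob_mn0) Gp -exprM mulnC.
split=> [[w [h [wq ->]]] a|Fa].
  exists (slc a w), (slc a h); split; first exact: box_slice.
  by rewrite [slc a h * _]mulrC -(slice_pushM frob_mnD (@frob_mn_res a)) phiG [h * _]mulrC.
rewrite (frob_decomposition F); apply: (subgroup_sum _ (ideal_subgroup idJ)) => a _.
apply: idealMl => //; have [w [h [wq ->]]] := Fa a.
rewrite (ps_pushD frob_mn0) (ps_pushM frob_mnD frob_mn0) phiG.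
by exists (phi w), (phi h); split=> //; apply: box_frob.
Qed.

Lemma colength_is_frob q b G (k : nat) : frob_stable G ->
  colength_is p (add_gen (box_ideal q) (G ^+ b)) k ->
  colength_is p (add_gen (box_ideal (q * p)) (G ^+ (b * p))) (p ^ n * k)%N.
Proof.
move=> Gp Ik.
have -> : add_gen (box_ideal (q * p)) (G ^+ (b * p)) =
    [set F | forall a, add_gen (box_ideal q) (G ^+ b) (slc a F)].
  by apply/seteqP; split => F /(frob_slices _ _ _ Gp).
have -> : (p ^ n * k = \sum_(a : {ffun 'I_n -> 'I_p}) k)%N.
  by rewrite sum_nat_const card_ffun !card_ord.
apply: (@colength_is_family p _ S S (fun a => slc a)
  (fun=> add_gen (box_ideal q) (G ^+ b)) (fun=> k)) => // w.
exists (fun m => w (mn_res m) (mn_quo m)) => a; apply: psP => m.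
by rewrite /slice; have [<- <-] := @mn_res_unique _ m a erefl.
Qed.

Lemma frob_stableM G H : frob_stable G -> frob_stable H -> frob_stable (G * H).
Proof. by move=> Gp Hp; rewrite /frob_stable (ps_pushM frob_mnD frob_mn0) Gp Hp exprMn. Qed.

Lemma frob_stableD G H : frob_stable G -> frob_stable H -> frob_stable (G + H).
Proof.
move=> Gp Hp; rewrite /frob_stable (ps_pushD frob_mn0) Gp Hp.
by have := frobD p_prime 1 G H; rewrite expn1.
Qed.

Lemma frob_stable_monomial m : frob_stable (monomial K m).
Proof. by rewrite /frob_stable (ps_push_monomial _ frob_mn0) monomialX. Qed.

Lemma frob_stable_sum (J : Type) (r : seq J) (P : pred J) (F : J -> S) :
  (forall j, P j -> frob_stable (F j)) -> frob_stable (\sum_(j <- r | P j) F j).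
Proof.
move=> HF; elim/big_ind: _ => //; last exact: frob_stableD.
rewrite /frob_stable (morphB0 (@ps_pushB _ _ _ _ _ frob_mn0)) expr0n.
by rewrite (gtn_eqF (prime_gt0 p_prime)).
Qed.

End Frobenius.

(** * Adding a variable *)

Section LastVariable.
Variables (d p : nat).
Local Notation K := 'F_p.
Local Notation S := (mpser d K).
Local Notation T := (mpser d.+1 K).
Implicit Types (G H w : S) (F h : T) (k : multinom d) (m : multinom d.+1).

Definition ext_mn k : multinom d.+1 :=
  mk_mnm (fun i => if unlift ord_max i is Some j then k j else 0%N).
Definition last_mn i : multinom d.+1 := mnm1 ord_max *m+ i.
Local Notation iota := (@ps_push d d.+1 K ext_mn).
Local Notation slc i := (@slice d d.+1 K ext_mn (last_mn i)).
Local Notation x := (monomial K (mnm1 ord_max) : T).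

Lemma ext_mn_lift k j : ext_mn k (lift ord_max j) = k j.
Proof. by rewrite mk_mnmE liftK. Qed.

Lemma ext_mn_max k : ext_mn k ord_max = 0%N.
Proof. by rewrite mk_mnmE unlift_none. Qed.

Lemma last_mn_lift i j : last_mn i (lift ord_max j) = 0%N.
Proof. by rewrite mulmnE mnm1E; case: eqP => [e|//]; case/eqP: (neq_lift ord_max j). Qed.

Lemma last_mn_max i : last_mn i ord_max = i.
Proof. by rewrite mulmnE mnm1E eqxx mul1n. Qed.

Lemma mnm_lastP m m' : (forall j, m (lift ord_max j) = m' (lift ord_max j)) ->
  m ord_max = m' ord_max -> m = m'.
Proof. by move=> ml mm; apply/mnmP => i; case: (unliftP ord_max i) => [j|] ->. Qed.

Lemma ext_mnD k k' : ext_mn (k +m k') = ext_mn k +m ext_mn k'.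
Proof. by apply: mnm_lastP => [j|]; rewrite ?(mnmDE, ext_mn_lift, ext_mn_max). Qed.

Lemma ext_mn_last i k k' : ext_mn k <=m ext_mn k' +m last_mn i -> k <=m k'.
Proof.
move=> /mnm_lepP h; apply/mnm_lepP => j; have := h (lift ord_max j).
by rewrite mnmDE !ext_mn_lift last_mn_lift addn0.
Qed.

Lemma last_mn0 : last_mn 0 = mnm0.
Proof. exact: mulm0n. Qed.

Lemma ext_mn0 k k' : ext_mn k <=m ext_mn k' +m mnm0 -> k <=m k'.
Proof. by rewrite -last_mn0; apply: ext_mn_last. Qed.

Definition restr_mn m : multinom d := mk_mnm (fun j => m (lift ord_max j)).

Lemma restr_mnK m : ext_mn (restr_mn m) +m last_mn (m ord_max) = m.
Proof.
apply: mnm_lastP => [j|].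
  by rewrite mnmDE ext_mn_lift last_mn_lift addn0 mk_mnmE.
by rewrite mnmDE ext_mn_max last_mn_max.
Qed.

Lemma last_var_exp j : x ^+ j = monomial K (last_mn j).
Proof. by rewrite monomialX. Qed.

Lemma slice_iota i G h : slc i (iota G * h) = G * slc i h.
Proof. exact: slice_pushM ext_mnD (@ext_mn_last i) _ _. Qed.

Lemma slice_x i j h : slc i (x ^+ j * h) = if (j <= i)%N then slc (i - j) h else 0.
Proof.
apply: psP => k; rewrite /slice last_var_exp monomialME.
have -> : (last_mn j <=m ext_mn k +m last_mn i) = (j <= i)%N.
  apply/mnm_lepP/idP => [/(_ ord_max)|ji l].
    by rewrite mnmDE !last_mn_max ext_mn_max.
  case: (unliftP ord_max l) => [l'|] ->; first by rewrite last_mn_lift.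
  by rewrite mnmDE !last_mn_max ext_mn_max.
case: ifP => // ji; congr h; apply: mnm_lastP => [l|].
  by rewrite mnmBE !mnmDE !last_mn_lift subn0.
by rewrite mnmBE !mnmDE !last_mn_max ext_mn_max.
Qed.

Lemma slice_const i G : slc i (iota G) = if i == 0%N then G else 0.
Proof.
rewrite -[iota G]mulr1 slice_iota.
apply: psP => k; case: eqP => [->|/eqP i0].
  rewrite last_mn0; congr (_ k); rewrite -[RHS]mulr1; congr (G * _).
  apply: psP => k'; rewrite /slice addm0 !ps1; congr (nat_of_bool _)%:R.
  rewrite -(push0 ext_mnD); exact: (inj_eq (push_inj ext_mn0)).
suff -> : slc i (1 : T) = 0 by rewrite mulr0.
apply: psP => k'; rewrite /slice ps1; case: eqP => // e.
have := congr1 (fun m : multinom d.+1 => m ord_max) e.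
by rewrite mnmDE ext_mn_max last_mn_max mnm0E add0n => i0'; rewrite i0' in i0.
Qed.

Lemma box_iota q G : box_ideal q G -> box_ideal q (iota G).
Proof.
move=> Gq m mq; have [[k mk]|nk] := ps_push_cases ext_mn m; last by rewrite ps_push_out.
rewrite mk (ps_pushE ext_mn0) Gq // => i.
by have := mq (lift ord_max i); rewrite mk ext_mn_lift.
Qed.

Lemma box_slice_last q i h : (i < q)%N -> box_ideal q h -> box_ideal q (slc i h).
Proof.
move=> iq hq k kq; apply: hq => l; rewrite mnmDE.
case: (unliftP ord_max l) => [l'|] ->; first by rewrite ext_mn_lift last_mn_lift addn0.
by rewrite ext_mn_max last_mn_max.
Qed.

Lemma box_xX q j : (q <= j)%N -> box_ideal q (x ^+ j).
Proof.
move=> qj m mq; rewrite last_var_exp /monomial; case: eqP => // e.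
by have := mq ord_max; rewrite e last_mn_max ltnNge qj.
Qed.

Section Binomial.
Variables (n q : nat) (G : S).
Hypothesis n0 : (0 < n)%N.
Local Notation I := (add_gen (box_ideal q) (x ^+ n - iota G)).

(** The number of integers i < q congruent to j modulo n: these are the parts
    of the balanced partition of q. *)
Definition block (j : nat) : nat := ((q + n.-1 - j) %/ n)%N.

Lemma block_gt i : (i < q)%N -> (i %/ n < block (i %% n))%N.
Proof.
move=> iq; rewrite /block leq_divRL // mulSn.
have := divn_eq i n; have := ltn_pmod i n0; lia.
Qed.

Lemma block_le j (k : nat) : (j < n)%N -> (k < block j)%N -> (j + n * k < q)%N.
Proof.
move=> jn; rewrite /block leq_divRL // mulSn mulnC; lia.
Qed.

Lemma block_ge j : (j < n)%N -> (q <= j + n * block j)%N.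
Proof.
move=> jn; rewrite /block mulnC.
have := divn_eq (q + n.-1 - j) n; have := ltn_pmod (q + n.-1 - j) n0; lia.
Qed.

(** Replacing x ^ n by G turns a series into a polynomial of degree less than
    n in x, with coefficients psi j. One more term than the slices below q is
    kept: it is a multiple of G ^ block j, and with it psi j is surjective
    even if block j is 0. *)
Definition psi (j : nat) h : S := \sum_(k < (block j).+1) G ^+ k * slc (j + n * k) h.

Lemma psiB j : {morph psi j : u v / u - v}.
Proof.
by move=> u v; rewrite /psi -sumrB; apply: eq_bigr => k _; rewrite -mulrBr.
Qed.

Lemma psi_surj (w : 'I_n -> S) : exists F, forall j : 'I_n, psi j F = w j.
Proof.
have [F slE] : exists F, forall i, slc i F = \sum_(j < n) if i == j then w j else 0.
  exists (\sum_(j < n) x ^+ j * iota (w j)) => i.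
  rewrite (morphB_sum (@sliceB _ _ _ _ _)); apply: eq_bigr => l _.
  by rewrite slice_x slice_const subn_eq0; case: (ltngtP i l).
exists F => j.
rewrite /psi big_ord_recl big1 ?addr0 => [|k _].
  rewrite expr0 mul1r muln0 addn0 slE (bigD1 j) //= eqxx big1 ?addr0 // => l.
  by rewrite -val_eqE /= eq_sym => /negbTE ->.
rewrite slE big1 ?mulr0 // => l _; case: eqP => // e.
have := ltn_ord l; rewrite -e /= /bump /= mulnDr muln1; lia.
Qed.

(** Modulo x ^ n = G, multiplying x ^ j by G ^ block j gives x ^ (j + n *
    block j), a multiple of x ^ q, and block j is the least exponent for which
    this happens. *)
Lemma psi_mem F : I F <-> forall j : 'I_n, add_gen (box_ideal q) (G ^+ block j) (psi j F).
Proof.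
have idb := @box_ideal_ideal d p q; have idb' := @box_ideal_ideal d.+1 p q.
have idI : ideal I by apply: add_gen_ideal.
have sI := ideal_subgroup idI.
split=> [[w [h [wq ->]]] j|HF].
  have idJ := add_gen_ideal (G ^+ block j) idb.
  rewrite (morphBD (@psiB j)); apply: idealD => //.
    rewrite /psi big_ord_recr /=; apply: idealD => //.
      apply: sub_add_gen; apply: (subgroup_sum _ (ideal_subgroup idb)) => k _.
      apply: (idealMl _ idb); apply: box_slice_last => //; exact: block_le.
    by apply: (idealMr _ idJ); apply: gen_add_gen; case: idb.
  pose t (k : nat) := G ^+ k * slc (j + n * k) (x ^+ n * h).
  have -> : psi j (h * (x ^+ n - iota G)) = - t (block j).+1.
    have <- : \sum_(0 <= k < (block j).+1) (t k.+1 - t k) = t (block j).+1.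
      have t0 : t 0%N = 0 by rewrite /t muln0 addn0 slice_x leqNgt ltn_ord mulr0.
      by rewrite telescope_sumr // t0 subr0.
    rewrite -sumrN big_mkord; apply: eq_bigr => k _.
    rewrite opprB /t [h * _]mulrC mulrBl sliceB slice_iota mulrBr exprSr -mulrA.
    congr (_ - _ * (_ * _)); rewrite slice_x mulnS addnCA leq_addr.
    by rewrite addKn.
  apply: subgroupN; first exact: ideal_subgroup.
  by rewrite /t exprS mulrAC; apply: (idealMl _ idJ); apply: gen_add_gen; case: idb.
have IxG (k : nat) : I (x ^+ (n * k) - iota (G ^+ k)).
  rewrite (ps_pushX ext_mnD ext_mn0) exprM subrXX mulrC.
  by apply: (idealMl _ idI); apply: gen_add_gen; case: idb'.
(* The terms of F of low degree in x, sorted by residues modulo n. *)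
pose F' : T := \sum_(j < n) \sum_(k < (block j).+1) iota (slc (j + n * k) F) * x ^+ (j + n * k).
have bF : box_ideal q (F - F').
  move=> m mq; rewrite psB /F' ps_sum; apply/eqP; rewrite subr_eq0; apply/eqP.
  have E j : (iota (slc j F) * x ^+ j) m = if m ord_max == j then F m else 0.
    rewrite mulrC last_var_exp -[in LHS](restr_mnK m); case: eqP => [<-|/eqP mj].
      by rewrite monomialDE (ps_pushE ext_mn0) /slice restr_mnK.
    rewrite monomialME restr_mnK; case: ifP => // /mnm_lepP jm; rewrite ps_push_out // => k e.
    have := congr1 (fun m : multinom d.+1 => m ord_max) e.
    have := jm ord_max; rewrite mnmBE ext_mn_max last_mn_max => jm' /esym/eqP; rewrite subn_eq0 => mj'.
    by rewrite eqn_leq mj' jm' in mj.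
  have mn : (m ord_max %% n < n)%N by rewrite ltn_pmod.
  have mk : (m ord_max %/ n < (block (m ord_max %% n)).+1)%N by rewrite ltnW // ltnS block_gt.
  rewrite (bigD1 (Ordinal mn)) //= [X in _ + X]big1 ?addr0 => [|j jm].
    rewrite ps_sum (bigD1 (Ordinal mk)) //= [X in _ + X]big1 ?addr0 => [|k km].
      by rewrite E mulnC addnC -divn_eq eqxx.
    rewrite E; case: eqP => // e; case/eqP: km; apply: val_inj => /=.
    have := congr1 (fun t : nat => (t %/ n)%N) e.
    by rewrite /= [(n * _)%N]mulnC divnDMl // [(_ %% n %/ n)%N]divn_small // add0n => ->.
  rewrite ps_sum big1 // => k _; rewrite E; case: eqP => // e.
  by case/eqP: jm; apply: val_inj => /=; rewrite e addnC mulnC modnMDl modn_small.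
rewrite -[F](subrK F'); apply: idealD => //; first exact: sub_add_gen.
apply: (subgroup_sum _ sI) => j _.
have -> : \sum_(k < (block j).+1) iota (slc (j + n * k) F) * x ^+ (j + n * k) =
  \sum_(k < (block j).+1) (iota (slc (j + n * k) F) * x ^+ j) * (x ^+ (n * k) - iota (G ^+ k)) +
  iota (psi j F) * x ^+ j.
  rewrite /psi (ps_push_sum ext_mn0) mulr_suml -big_split; apply: eq_bigr => k _ /=.
  rewrite (ps_pushM ext_mnD ext_mn0) exprD mulrBr mulrA.
  by rewrite -[iota (G ^+ k) * _ * _]mulrA [iota (G ^+ k) * _]mulrC subrK.
apply: idealD => //.
  by apply: (subgroup_sum _ sI) => k _; apply: (idealMl _ idI).
have [w [h [wq ->]]] := HF j.
rewrite (ps_pushD ext_mn0) mulrDl; apply: idealD => //.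
  by apply: (idealMr _ idI); apply: sub_add_gen; apply: box_iota.
rewrite (ps_pushM ext_mnD ext_mn0) -mulrA; apply: (idealMl _ idI).
rewrite -[iota (G ^+ _)](subKr (x ^+ (n * block j))) mulrBl.
apply: sI.2; last by apply: (idealMr _ idI).
by rewrite -exprD; apply: sub_add_gen; apply: box_xX; rewrite addnC block_ge.
Qed.

Lemma colength_binomial :
  colength p I = (\sum_(j < n) colength p (add_gen (box_ideal q) (G ^+ block j)))%N.
Proof.
apply: colengthE.
have -> : I = [set F | forall j : 'I_n, add_gen (box_ideal q) (G ^+ block j) (psi j F)].
  by apply/seteqP; split => F /psi_mem.
apply: (@colength_is_family _ _ _ _ (fun j : 'I_n => psi j) (fun j => add_gen (box_ideal q) (G ^+ block j))).
- by move=> j; apply: psiB.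
- exact: psi_surj.
- move=> j; apply: colengthP; apply: cofinite_add_gen; first exact: box_ideal_ideal.
  by exists (q ^ d)%N; apply: colength_is_box.
Qed.

End Binomial.
End LastVariable.

(** * Linear changes of variables *)

Section Substitution.
Variables (n p : nat).
Hypothesis p_prime : prime p.
Local Notation K := 'F_p.
Local Notation S := (mpser n K).
Local Notation P := (mpoly n K).
Implicit Types (f g : S) (u v : P) (m : multinom n).

Definition ps_of u : S := fun m => mcoeff m u.

Lemma ps_ofB : {morph ps_of : u v / u - v}.
Proof. by move=> u v; apply: psP => m; rewrite /ps_of mcoeffB. Qed.

Lemma ps_ofD : {morph ps_of : u v / u + v}.
Proof. by move=> u v; apply: psP => m; rewrite /ps_of mcoeffD. Qed.

Lemma ps_ofM : {morph ps_of : u v / u * v}.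
Proof. by move=> u v; apply: psP => m; rewrite /ps_of mcoeffM. Qed.

Lemma ps_of1 : ps_of 1 = 1.
Proof. by apply: psP => m; rewrite /ps_of mcoeff1. Qed.

Lemma ps_ofX m : ps_of (mpolyX K m) = monomial K m.
Proof. by apply: psP => k; rewrite /ps_of mcoeffX /monomial eq_sym. Qed.

Lemma ps_of_exp u j : ps_of (u ^+ j) = ps_of u ^+ j.
Proof. by elim: j => [|j IHj]; rewrite ?ps_of1 // !exprS ps_ofM IHj. Qed.

Lemma ps_of_dense (q : nat) f : exists u, box_ideal q (ps_of u - f).
Proof.
have [N NI] := ord_sub_box n p q; exists (mpser_trunc N f); apply: NI => m mN.
by rewrite psB /ps_of mcoeff_trunc // subrr.
Qed.

Variables (theta theta' : n.-tuple P).
Hypothesis thetaK : forall u, comp_mpoly theta (comp_mpoly theta' u) = u.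
Hypothesis theta_max : forall i, max_ideal (ps_of (tnth theta i)).

(** A monomial of u outside the box has a factor x_i ^ q, and the image of
    x_i, having no constant term, has its q-th power in (x_0^q, ...,
    x_(n-1)^q). *)
Lemma box_subst (e : nat) u : box_ideal (p ^ e) (ps_of u) ->
  box_ideal (p ^ e) (ps_of (comp_mpoly theta u)).
Proof.
move=> uq; have idb := @box_ideal_ideal n p (p ^ e).
have -> : ps_of (comp_mpoly theta u) =
    \sum_(m <- msupp u) ps_of (mcoeff m u *: comp_mpoly theta (mpolyX K m)).
  rewrite -(morphB_sum ps_ofB); congr ps_of.
  by rewrite {1}[u]mpolyE raddf_sum /=; apply: eq_bigr => m _; rewrite comp_mpolyZ.
rewrite big_seq; apply: (subgroup_sum _ (ideal_subgroup idb)) => m.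
rewrite mcoeff_msupp => um.
have [i qi] : exists i, (p ^ e <= m i)%N.
  apply: contrapT => ni; case/eqP: um; apply: uq => i.
  by rewrite ltnNge; apply/negP => qi; apply: ni; exists i.
rewrite comp_mpolyX (bigD1 i) //= -(subnKC qi) exprD -mul_mpolyC -mulrA.
rewrite (mulrCA (mpolyC _ _)) ps_ofM ps_of_exp.
by apply: (idealMr _ idb); apply: max_ideal_frob.
Qed.

(** The substitution maps (x_i^q, u) into (x_i^q, v) and is onto modulo the
    latter. *)
Lemma colength_subst_le e u v : comp_mpoly theta u = v ->
  (colength p (add_gen (box_ideal (p ^ e)) (ps_of v)) <=
   colength p (add_gen (box_ideal (p ^ e)) (ps_of u)))%N.
Proof.
move=> uv; set q := (p ^ e)%N; have idb := @box_ideal_ideal n p q.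
have cb : cofinite p (@box_ideal n p q) by exists (q ^ n)%N; exact: colength_is_box.
set I := add_gen _ (ps_of v); set J := add_gen _ (ps_of u).
have idI : ideal I by apply: add_gen_ideal.
have idJ : ideal J by apply: add_gen_ideal.
have bI := @sub_add_gen _ _ _ : box_ideal q `<=` I.
have bJ := @sub_add_gen _ _ _ : box_ideal q `<=` J.
have cI : cofinite p I by apply: cofinite_add_gen.
have cJ : cofinite p J by apply: cofinite_add_gen.
pose g t := ps_of (comp_mpoly theta t).
have gB : {morph g : s t / s - t} by move=> s t; rewrite /g raddfB /= ps_ofB.
have gI : colength_is p [set t | I (g t)] (colength p I).
  have gD w : exists t, I (g t - w).
    have [t tw] := ps_of_dense q w; exists (comp_mpoly theta' t).
    by rewrite /g thetaK; apply: bI.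
  exact: (colength_is_dense gB gD (colengthP cI)).
have gJ : colength_is p [set t | J (ps_of t)] (colength p J).
  have D w : exists t, J (ps_of t - w).
    by have [t tw] := ps_of_dense q w; exists t; apply: bJ.
  exact: (colength_is_dense ps_ofB D (colengthP cJ)).
rewrite -(colengthE gI) -(colengthE gJ); apply: colength_sub.
- by exists (colength p J).
- exact: colength_is_subgroup gI.
move=> t [w [h [wq e1]]]; have [h0 h0q] := ps_of_dense q h.
have rq : box_ideal q (ps_of (t - h0 * u)).
  rewrite ps_ofB ps_ofM e1 -addrA -mulrBl; apply: (idealD idb) => //.
  by apply: (idealMr _ idb); rewrite -opprB; apply: (subgroupN (ideal_subgroup idb)).
change (I (g t)); have -> : g t = g (t - h0 * u) + g h0 * ps_of v.
  have gM : g (h0 * u) = g h0 * ps_of v by rewrite /g rmorphM /= uv ps_ofM.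
  by rewrite gB gM subrK.
apply: (idealD idI); first by apply: bI; apply: box_subst.
by apply: (idealMl _ idI); apply: gen_add_gen; case: idb.
Qed.

End Substitution.

(** * Quadrics and their suspensions *)

Lemma mpoly_cancel n (R : comNzRingType) (theta theta' : n.-tuple (mpoly n R)) :
  (forall i, comp_mpoly theta (tnth theta' i) = mpolyX R (mnm1 i)) ->
  forall u, comp_mpoly theta (comp_mpoly theta' u) = u.
Proof.
move=> tt u; have E := mpolyE u; rewrite [LHS](congr1 (fun v => comp_mpoly theta (comp_mpoly theta' v)) E).
rewrite [RHS]E (raddf_sum (comp_mpoly theta')) (raddf_sum (comp_mpoly theta)) /=.
apply: eq_bigr => m _; rewrite !comp_mpolyZ comp_mpolyX rmorph_prod /=.
congr (_ *: _); rewrite [RHS]mpolyXE_id; apply: eq_bigr => i _.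
by rewrite rmorphXn /= tt.
Qed.

Lemma comp_mpolyXi n (R : comNzRingType) (theta : n.-tuple (mpoly n R)) i :
  comp_mpoly theta (mpolyX R (mnm1 i)) = tnth theta i.
Proof. by rewrite comp_mpolyXU -tnth_nth. Qed.

Lemma leq_increments a b c x y :
  (b = a + x -> c = b + y -> y <= x -> a + c <= b + b)%N.
Proof. by move=> -> ->; lia. Qed.

Lemma lt_increments b c x y : (b = x -> c = b + y -> y < x -> c < b + b)%N.
Proof. by move=> -> ->; lia. Qed.

Section Quadrics.
Variable p : nat.
Hypotheses (p_prime : prime p) (p_gt3 : (3 < p)%N).
Local Notation K := 'F_p.

Lemma xvarE d i : xvar p d i = monomial K (mnm1 (inord i)).
Proof. by []. Qed.

Lemma two_Fp : (2%:R : K) != 0.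
Proof.
rewrite -(dvdn_pcharf (pchar_Fp p_prime)) gtnNdvd //.
exact: leq_trans p_gt3.
Qed.

Lemma odd_p : odd p.
Proof. by case: (even_prime p_prime) => // p2; move: p_gt3; rewrite p2. Qed.

Lemma double_half_le i : (i./2.*2 <= i)%N.
Proof. by rewrite -[X in (_ <= X)%N](odd_double_half i) leq_addl. Qed.

Section Iota.
Variable d : nat.
Local Notation iota := (@ps_push d.+1 d.+2 K (@ext_mn d.+1)).

Lemma ext_mn1 j : ext_mn (mnm1 j) = mnm1 (lift ord_max j) :> multinom d.+2.
Proof.
apply: mnm_lastP => [i|].
  by rewrite ext_mn_lift !mnm1E (inj_eq (lift_inj)).
by rewrite ext_mn_max mnm1E eq_sym (negbTE (neq_lift _ _)).
Qed.

Lemma lift_inord i : (i <= d)%N -> lift ord_max (inord i : 'I_d.+1) = inord i :> 'I_d.+2.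
Proof.
move=> id; apply: val_inj; rewrite [LHS]lift_max /= !inordK // ltnS.
exact: leqW.
Qed.

Lemma iota_xvar i : (i <= d)%N -> iota (xvar p d i) = xvar p d.+1 i.
Proof.
move=> id; rewrite !xvarE (ps_push_monomial _ (@ext_mn0 _)) ext_mn1.
by rewrite lift_inord.
Qed.

Lemma iota_hyperbolic k : (k.*2 <= d.+1)%N ->
  iota (hyperbolic_sum p d k) = hyperbolic_sum p d.+1 k.
Proof.
move=> kd; rewrite (ps_push_sum (@ext_mn0 _)); apply: eq_bigr => i _.
have ik : (i.*2.+1 <= d)%N.
  by have := ltn_ord i; rewrite -ltnS; move: kd; rewrite -!mul2n; lia.
by rewrite (ps_pushM (@ext_mnD _) (@ext_mn0 _)) !iota_xvar // ltnW.
Qed.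

Lemma iota_sqr : iota (xvar p d d ^+ 2) = xvar p d.+1 d ^+ 2.
Proof. by rewrite (ps_pushX (@ext_mnD _) (@ext_mn0 _)) iota_xvar. Qed.

Lemma xvar_max : xvar p d.+1 d.+1 = monomial K (mnm1 ord_max).
Proof. by rewrite xvarE; congr (monomial _ (mnm1 _)); apply: val_inj; rewrite /= inordK. Qed.

Lemma A2_suspension :
  A2_equation p d.+1 = xvar p d.+1 d.+1 ^+ 3 + iota (A1_equation p d).
Proof.
rewrite /A2_equation /A1_equation /= if_neg; case: ifP => od.
  by rewrite addrC (@iota_hyperbolic d.+1./2) // double_half_le.
by rewrite addrC (ps_pushD (@ext_mn0 _)) iota_sqr iota_hyperbolic // leqW ?double_half_le.
Qed.

Lemma A1_suspension_even : odd d ->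
  A1_equation p d.+1 = xvar p d.+1 d.+1 ^+ 2 + iota (A1_equation p d).
Proof.
move=> od; rewrite /A1_equation /= od /= addrC (@iota_hyperbolic d.+1./2) //.
exact: double_half_le.
Qed.

End Iota.

Lemma frob_stable_A1 d : frob_stable (A1_equation p d).
Proof.
have sx i : frob_stable (xvar p d i) by rewrite xvarE; apply: frob_stable_monomial.
have sh k : frob_stable (hyperbolic_sum p d k).
  by apply: frob_stable_sum => // i _; apply: frob_stableM.
rewrite /A1_equation; case: ifP => _ //.
by apply: frob_stableD => //; rewrite expr2; apply: frob_stableM.
Qed.

Lemma add_genN (A : comPzRingType) (I : set A) a : add_gen I (- a) = add_gen I a.
Proof.
by apply/seteqP; split=> _ [w [h [Iw ->]]]; exists w, (- h); rewrite ?mulrN ?mulNr ?opprK.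
Qed.

Lemma add_gen_expN (A : comPzRingType) (I : set A) a b :
  add_gen I ((- a) ^+ b) = add_gen I (a ^+ b).
Proof.
rewrite exprNn -signr_odd; case: (odd b); rewrite ?expr0 ?mul1r //.
by rewrite expr1 mulN1r add_genN.
Qed.

(** By quadric_colength_frobenius, b / q -> quadric_colength d q b / q^(d+1)
    is independent of the level q = p^e wherever both levels are defined, so
    these functions interpolate a single concave function on [0, 1]. *)
Definition quadric_colength (d q b : nat) : nat :=
  colength p (add_gen (@box_ideal d.+1 p q) (A1_equation p d ^+ b)).

Lemma A2_colength d q :
  colength p (add_gen (box_ideal q) (A2_equation p d.+1)) =
  (\sum_(j < 3) quadric_colength d q (block 3 q j))%N.
Proof.
rewrite A2_suspension xvar_max -[ps_push _ _]opprK.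
rewrite -(morphBN (@ps_pushB _ _ _ _ _ (@ext_mn0 _))).
rewrite (@colength_binomial d.+1 p 3 q (- A1_equation p d) isT).
by apply: eq_bigr => j _; rewrite add_gen_expN.
Qed.

Lemma A1_colength_even d q : odd d ->
  colength p (add_gen (box_ideal q) (A1_equation p d.+1)) =
  (\sum_(j < 2) quadric_colength d q (block 2 q j))%N.
Proof.
move=> od; rewrite A1_suspension_even // xvar_max -[ps_push _ _]opprK.
rewrite -(morphBN (@ps_pushB _ _ _ _ _ (@ext_mn0 _))).
rewrite (@colength_binomial d.+1 p 2 q (- A1_equation p d) isT).
by apply: eq_bigr => j _; rewrite add_gen_expN.
Qed.

Section Odd.
Variable d : nat.
Hypothesis ed : ~~ odd d.
Local Notation P := (mpoly d.+2 K).
Local Notation X i := (mpolyX K (mnm1 i) : P).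
Local Notation u := (inord d : 'I_d.+2).
Local Notation v := (inord d.+1 : 'I_d.+2).

Let uv : u != v.
Proof. by apply/eqP => /(congr1 val); rewrite /= !inordK // => /eqP; rewrite ltn_eqF. Qed.

Definition hyp_poly : P :=
  \sum_(i < d./2) X (inord i.*2) * X (inord i.*2.+1).

(** Two of these compose to the identity when the product of their constants
    is 1/2 (rot_cancel), and they exchange x_u x_v and x_u^2 - x_v^2 up to a
    scalar. *)
Definition rot_tuple (c : P) : d.+2.-tuple P :=
  mktuple (fun i => if i == u then c * (X u + X v) else
                    if i == v then c * (X u - X v) else X i).

Lemma rot_u c : comp_mpoly (rot_tuple c) (X u) = c * (X u + X v).
Proof. by rewrite comp_mpolyXi tnth_mktuple eqxx. Qed.

Lemma rot_v c : comp_mpoly (rot_tuple c) (X v) = c * (X u - X v).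
Proof. by rewrite comp_mpolyXi tnth_mktuple eq_sym (negbTE uv) eqxx. Qed.

Lemma rot_other c i : i != u -> i != v -> comp_mpoly (rot_tuple c) (X i) = X i.
Proof. by move=> iu iv; rewrite comp_mpolyXi tnth_mktuple (negbTE iu) (negbTE iv). Qed.

Lemma rot_inord c i : (i < d)%N -> comp_mpoly (rot_tuple c) (X (inord i)) = X (inord i).
Proof.
move=> id; apply: rot_other; apply/eqP => /(congr1 val); rewrite /= !inordK //; lia.
Qed.

Lemma rot_hyp c : comp_mpoly (rot_tuple c) hyp_poly = hyp_poly.
Proof.
rewrite raddf_sum; apply: eq_bigr => i _ /=; rewrite rmorphM /=.
have := ltn_ord i; have := odd_double_half d; rewrite (negbTE ed) -!mul2n => dd ik.
by rewrite !rot_inord //; lia.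
Qed.

Lemma rot_cancel (c c' : K) : c * c' * 2%:R = 1 ->
  forall w, comp_mpoly (rot_tuple (mpolyC _ c)) (comp_mpoly (rot_tuple (mpolyC _ c')) w) = w.
Proof.
move=> cc; have CC : mpolyC d.+2 c * mpolyC d.+2 c' * 2%:R = 1.
  by rewrite -mpolyC_nat -!mpolyCM cc mpolyC1.
apply: mpoly_cancel => i; rewrite tnth_mktuple.
case: eqP => [->|/eqP iu]; last case: eqP => [->|/eqP iv].
- rewrite rmorphM rmorphD /= rot_u rot_v comp_mpolyC.
  transitivity (mpolyC d.+2 c * mpolyC d.+2 c' * 2%:R * X u); last by rewrite CC mul1r.
  ring.
- rewrite rmorphM rmorphB /= rot_u rot_v comp_mpolyC.
  transitivity (mpolyC d.+2 c * mpolyC d.+2 c' * 2%:R * X v); last by rewrite CC mul1r.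
  ring.
- exact: rot_other.
Qed.

Lemma rot_max (c : K) i : max_ideal (ps_of (tnth (rot_tuple (mpolyC _ c)) i)).
Proof.
have X0 j : max_ideal (ps_of (X j)).
  by rewrite ps_ofX /max_ideal /= /monomial eq_sym mnm1_eq0.
have idm := @max_ideal_ideal d.+2 p.
rewrite tnth_mktuple; case: eqP => _; last case: eqP => _ //.
- by rewrite ps_ofM ps_ofD; apply: (idealMl _ idm); apply: idealD.
- by rewrite ps_ofM ps_ofB; apply: (idealMl _ idm); apply: (ideal_subgroup idm).2.
Qed.

(** In an even number of variables the A_1 equation is purely hyperbolic;
    rotating its last two variables exhibits it as a suspension of the quadric
    with one square. *)
Lemma A1_colength_odd e :
  colength p (add_gen (box_ideal (p ^ e)) (A1_equation p d.+1)) =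
  (\sum_(j < 2) quadric_colength d (p ^ e) (block 2 (p ^ e) j))%N.
Proof.
pose c : K := 2%:R^-1.
have cc1 : c * 1 * 2%:R = 1 by rewrite mulr1 mulVf ?two_Fp.
have cc2 : 1 * c * 2%:R = 1 by rewrite mul1r mulVf ?two_Fp.
have Cc : mpolyC d.+2 c * 2%:R = 1.
  by rewrite -mpolyC_nat -mpolyCM mulVf ?two_Fp // mpolyC1.
pose F1 := hyp_poly + X u * X v; pose F2 := hyp_poly + X u ^+ 2 - X v ^+ 2.
have t1 : comp_mpoly (rot_tuple (mpolyC _ 1)) F1 = F2.
  rewrite rmorphD rmorphM /= rot_hyp rot_u rot_v mpolyC1 /F2; ring.
have t2 : comp_mpoly (rot_tuple (mpolyC _ c)) F2 = F1.
  rewrite rmorphB rmorphD !rmorphXn /= rot_hyp rot_u rot_v /F1.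
  transitivity (hyp_poly + (mpolyC d.+2 c * 2%:R) ^+ 2 * (X u * X v)); first ring.
  by rewrite Cc expr1n mul1r.
have hE : ps_of hyp_poly = hyperbolic_sum p d.+1 d./2.
  rewrite (morphB_sum (@ps_ofB _ _)); apply: eq_bigr => i _.
  by rewrite ps_ofM !ps_ofX.
have E1 : ps_of F1 = A1_equation p d.+1.
  rewrite ps_ofD ps_ofM !ps_ofX hE /A1_equation /= ed.
  rewrite [in RHS]/hyperbolic_sum big_ord_recr /=.
  by have := odd_double_half d; rewrite (negbTE ed) add0n => ->.
have E2 : ps_of F2 = - (xvar p d.+1 d.+1 ^+ 2 - ps_push (@ext_mn d.+1) (A1_equation p d)).
  rewrite ps_ofB ps_ofD !ps_of_exp !ps_ofX hE /A1_equation (negbTE ed).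
  rewrite (ps_pushD (@ext_mn0 _)) iota_sqr iota_hyperbolic ?opprB // ?leqW ?double_half_le //.
transitivity (colength p (add_gen (box_ideal (p ^ e)) (ps_of F2))); last first.
  by rewrite E2 add_genN xvar_max colength_binomial.
rewrite -E1; apply/eqP; rewrite eqn_leq; apply/andP; split.
  exact: (colength_subst_le p_prime (rot_cancel cc1) (rot_max c) e t2).
exact: (colength_subst_le p_prime (rot_cancel cc2) (rot_max 1) e t1).
Qed.

End Odd.

Lemma A1_colength d e :
  colength p (add_gen (box_ideal (p ^ e)) (A1_equation p d.+1)) =
  (\sum_(j < 2) quadric_colength d (p ^ e) (block 2 (p ^ e) j))%N.
Proof.
by case od: (odd d); [rewrite A1_colength_even|rewrite A1_colength_odd ?od].
Qed.

(** * Colengths of powers of a quadric *)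

Section DProperties.
Variable d : nat.
Local Notation S := (mpser d.+1 K).
Local Notation g := (A1_equation p d).
Local Notation J q b := (add_gen (@box_ideal d.+1 p q) (g ^+ b)).

Lemma quadric_power_ideal q b : ideal (J q b).
Proof. exact/add_gen_ideal/box_ideal_ideal. Qed.

Lemma quadric_power_cofinite q b : cofinite p (J q b).
Proof.
apply: cofinite_add_gen; first exact: box_ideal_ideal.
by exists (q ^ d.+1)%N; apply: colength_is_box.
Qed.

Lemma mem_quadric_power q b h : J q b (h * g ^+ b).
Proof. by apply: mem_add_gen; case: (@box_ideal_ideal d.+1 p q). Qed.

Lemma quadric_colength0 q : quadric_colength d q 0 = 0%N.
Proof.
rewrite /quadric_colength; have -> : J q 0 = setT; last exact: colengthE (colength_is_setT _ _).
by apply/seteqP; split=> // h _; rewrite -[h]mulr1 -(expr0 g); apply: mem_quadric_power.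
Qed.

Lemma quadric_colength_le q b : (quadric_colength d q b <= q ^ d.+1)%N.
Proof.
rewrite -(colengthE (colength_is_box d.+1 p q)); apply: colength_sub.
- by exists (q ^ d.+1)%N; apply: colength_is_box.
- exact/ideal_subgroup/quadric_power_ideal.
- exact: sub_add_gen.
Qed.

Lemma quadric_colength_succ q b :
  quadric_colength d q b.+1 =
  (quadric_colength d q b + colength p (colon (J q b.+1) (g ^+ b)))%N.
Proof.
rewrite /quadric_colength (colength_colon (g ^+ b) (quadric_power_ideal q b.+1)
  (quadric_power_cofinite q b.+1)).
congr (colength p _ + _)%N; apply/seteqP; split.
  apply: add_gen_sub; first exact: quadric_power_ideal.
    apply: add_gen_sub; [exact: quadric_power_ideal|exact: sub_add_gen|].
    by rewrite exprS; apply: mem_quadric_power.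
  by rewrite -[X in J _ _ X]mul1r; apply: mem_quadric_power.
apply: add_gen_sub; first exact/add_gen_ideal/quadric_power_ideal.
  by apply: subset_trans (@sub_add_gen _ _ _); apply: sub_add_gen.
by apply: gen_add_gen; case: (quadric_power_ideal q b.+1).
Qed.

Lemma colon_quadric_power q b : colon (J q b.+1) (g ^+ b) `<=` colon (J q b.+2) (g ^+ b.+1).
Proof.
move=> u [w [h [wq e]]]; exists (w * g), h; split.
  by apply: (idealMr _ (@box_ideal_ideal d.+1 p q)).
by rewrite exprSr mulrA e mulrDl -mulrA -exprSr.
Qed.

(** By quadric_colength_succ the increments are colengths of ideals that
    increase with b. *)
Lemma quadric_colength_concave q b :
  (quadric_colength d q b + quadric_colength d q b.+2 <=
   quadric_colength d q b.+1 + quadric_colength d q b.+1)%N.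
Proof.
apply: (leq_increments (quadric_colength_succ q b) (quadric_colength_succ q b.+1)).
apply: colength_sub; last exact: (@colon_quadric_power q b).
  exact: (cofinite_colon _ (quadric_power_ideal q b.+1) (quadric_power_cofinite q b.+1)).
exact: (ideal_subgroup (colon_ideal _ (quadric_power_ideal q b.+2))).
Qed.

Lemma quadric_colength_frobenius q b :
  quadric_colength d (q * p) (b * p) = (p ^ d.+1 * quadric_colength d q b)%N.
Proof.
apply: colengthE; apply: colength_is_frob => //; first exact: frob_stable_A1.
exact/colengthP/quadric_power_cofinite.
Qed.

(** The element u is killed by g modulo (x_i^p) but is not a multiple of g: a
    Jordan block of size one. *)
Lemma quadric_colength_strict u : box_ideal p (u * g) -> ~ J p 1 u ->
  (quadric_colength d p 2 < quadric_colength d p 1 + quadric_colength d p 1)%N.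
Proof.
move=> ug Ju; have D1 := quadric_colength_succ p 0; rewrite quadric_colength0 add0n in D1.
apply: (lt_increments D1 (quadric_colength_succ p 1)); apply: colength_proper.
- exact: (cofinite_colon _ (quadric_power_ideal p 1) (quadric_power_cofinite p 1)).
- exact: (ideal_subgroup (colon_ideal _ (quadric_power_ideal p 2))).
split; first exact: (@colon_quadric_power p 0).
move=> /(_ u) h; apply: Ju; have : colon (J p 1) (g ^+ 0) u.
  by apply: h; apply: sub_add_gen; rewrite expr1.
by rewrite /colon /= expr0 mulr1.
Qed.

Lemma quadric_colength_strict_functional u (l : S -> K) : {morph l : f h / f - h} ->
  (forall f, box_ideal p f -> l f = 0) -> (forall h, l (h * g) = 0) ->
  box_ideal p (u * g) -> l u != 0 ->
  (quadric_colength d p 2 < quadric_colength d p 1 + quadric_colength d p 1)%N.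
Proof.
move=> lB lbox lg ug lu; apply: (quadric_colength_strict ug) => -[w [h [wq e]]].
by case/eqP: lu; rewrite e expr1 (morphBD lB) lbox // lg addr0.
Qed.

End DProperties.
End Quadrics.

(** * A Jordan block of size one *)

Section JordanBlock.
Variable p : nat.
Hypotheses (p_prime : prime p) (p_gt3 : (3 < p)%N).
Local Notation K := 'F_p.

Lemma monomial_in_box n q (m : multinom n) (i : 'I_n) : (q <= m i)%N -> box_ideal q (monomial K m).
Proof.
move=> qm k kq; rewrite /monomial; case: eqP => // e.
by have := kq i; rewrite e ltnNge qm.
Qed.

Lemma ps_sign n a (f : mpser n K) m : ((-1) ^+ a * f) m = (-1) ^+ a * f m.
Proof. by rewrite -signr_odd -[in RHS]signr_odd; case: (odd a); rewrite ?expr0 ?expr1 ?mul1r ?mulN1r. Qed.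

Section Witness.
Variable d : nat.
Local Notation S := (mpser d.+1 K).
Local Notation U i := (mnm1 (inord i : 'I_d.+1)).

Lemma mnm1_inordE i (j : 'I_d.+1) : (i <= d)%N -> U i j = (i == j :> nat) :> nat.
Proof. by move=> id; rewrite mnm1E -val_eqE /= inordK. Qed.

Lemma hyperbolicE k : hyperbolic_sum p d k =
  \sum_(i < k) monomial K (U i.*2 +m U i.*2.+1).
Proof. by apply: eq_bigr => i _; rewrite !xvarE monomialM. Qed.

(** The witness is the product of the x_(2i)^(p-1). Every product x_(2i)
    x_(2i+1) kills it, and its exponent at x_(2i+1) is 0, so it does not occur
    in a multiple of the quadric. *)
Lemma quadric_colength_strict_odd : odd d ->
  (quadric_colength p d p 2 <
   quadric_colength p d p 1 + quadric_colength p d p 1)%N.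
Proof.
move=> od; have p0 := prime_gt0 p_prime.
pose al : multinom d.+1 := mk_mnm (fun i => if odd i then 0%N else p.-1).
have half i : (i < d.+1./2)%N -> (i.*2.+1 <= d)%N.
  by move=> id; have := odd_double_half d.+1; rewrite /= od /= -!mul2n; lia.
have gE : A1_equation p d = \sum_(i < d.+1./2) monomial K (U i.*2 +m U i.*2.+1).
  by rewrite /A1_equation od hyperbolicE.
apply: (@quadric_colength_strict_functional p d (monomial K al) (fun f : S => f al)).
- by [].
- move=> f; apply => i; rewrite mk_mnmE; case: ifP => _ //; by rewrite prednK.
- move=> h; rewrite gE mulr_sumr ps_sum big1 // => i _.
  have id := half _ (ltn_ord i).
  rewrite mulrC monomialME; case: ifP => // /mnm_lepP /(_ (inord i.*2.+1)).
  by rewrite mnmDE !mnm1_inordE ?(ltnW id) // mk_mnmE inordK //= odd_double /= eqxx addnC.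
- rewrite gE mulr_sumr; apply: (subgroup_sum _ (ideal_subgroup (@box_ideal_ideal _ _ _))) => i _.
  have id := half _ (ltn_ord i).
  rewrite monomialM; apply: (@monomial_in_box _ _ _ (inord i.*2)).
  have id' : (i.*2 < d.+1)%N by rewrite ltnS ltnW.
  rewrite !mnmDE !mnm1_inordE ?(ltnW id) // mk_mnmE inordK // odd_double eqxx.
  by rewrite /=; move: p0; lia.
- by rewrite /monomial eqxx oner_eq0.
Qed.

Section Even.
Hypotheses (ed : ~~ odd d) (d2 : (2 <= d)%N).
Let n := p./2.

Let pn : p = n.*2.+1.
Proof. by have := odd_double_half p; rewrite (odd_p p_prime p_gt3) add1n => ->. Qed.

Let d1 : (1 < d.+1)%N. Proof. by rewrite ltnS ltnW. Qed.

Let n0 : (0 < n)%N.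
Proof. by rewrite lt0n; apply/eqP => e; move: p_gt3; rewrite pn e. Qed.

(** With p = 2n + 1, the exponents of x_0^(n+1+a) x_1^a x_d^(2(n-1-a)+1) times
    the product of the x_(2i)^(p-1) with 0 < 2i < d. Multiplying by x_0 x_1 at
    a or by x_d^2 at a + 1 gives the same monomial. *)
Definition walk (a : nat) : multinom d.+1 := mk_mnm (fun i =>
  if i == d :> nat then (n.-1 - a).*2.+1 else
  if i == 0 :> nat then (n.+1 + a)%N else
  if i == 1 :> nat then a else if odd i then 0%N else p.-1).

Local Notation al := walk.

Lemma walk_max a (i : 'I_d.+1) : i = d :> nat -> al a i = (n.-1 - a).*2.+1.
Proof. by move=> e; rewrite mk_mnmE e eqxx. Qed.

Lemma walk_0 a (i : 'I_d.+1) : i = 0%N :> nat -> al a i = (n.+1 + a)%N.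
Proof. by move=> e; rewrite mk_mnmE e /=; case: eqP d2 => // <-. Qed.

Lemma walk_1 a (i : 'I_d.+1) : i = 1%N :> nat -> al a i = a.
Proof. by move=> e; rewrite mk_mnmE e /=; case: eqP d2 => // <-. Qed.

Lemma walk_even a j (i : 'I_d.+1) : i = j.+1.*2 :> nat -> (i < d)%N -> al a i = p.-1.
Proof.
by move=> e id; rewrite mk_mnmE ltn_eqF // e doubleS /= negbK odd_double.
Qed.

Lemma walk_odd a j (i : 'I_d.+1) : i = j.+1.*2.+1 :> nat -> (i < d)%N -> al a i = 0%N.
Proof. by move=> e id; rewrite mk_mnmE ltn_eqF // e /= odd_double. Qed.

Let M01 : multinom d.+1 := U 0 +m U 1.
Let MZ : multinom d.+1 := U d *m+ 2.

Lemma walk_step a : (a.+1 < n)%N -> al a +m M01 = al a.+1 +m MZ.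
Proof.
move=> an; apply/mnmP => i.
rewrite [LHS]mnmDE [RHS]mnmDE /MZ mulmnE /M01 mnmDE !mnm1_inordE ?(ltnW d2) // !mk_mnmE.
have := ltn_ord i; case: (eqVneq (i : nat) d) => [->|id] _.
  by rewrite (ltn_eqF (ltnW d2)) (ltn_eqF d2) -!mul2n; lia.
case: (eqVneq (i : nat) 0%N) => [e|i0]; first by rewrite ?e /=; lia.
by case: (eqVneq (i : nat) 1%N) => [e|i1]; rewrite ?e /=; lia.
Qed.

Lemma walk_box a i : (a < n)%N -> (al a i < p)%N.
Proof.
move=> an; rewrite mk_mnmE; have := pn; have := n0.
by do !case: ifP => _; rewrite -!mul2n; lia.
Qed.

Lemma walk_inj a b : al a = al b -> a = b.
Proof.
by move=> /(congr1 (fun m : multinom d.+1 => m (inord 1))); rewrite !walk_1 ?(inordK d1).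
Qed.

Lemma A1_equationE_even : A1_equation p d = \sum_(i < (d./2).-1.+1) monomial K (U i.*2 +m U i.*2.+1) +
  monomial K MZ.
Proof.
rewrite /A1_equation (negbTE ed) hyperbolicE xvarE monomialX prednK //.
by case: d d2 => [|[|d']].
Qed.

Lemma half_lt (i : nat) : (i < (d./2).-1)%N -> (i.+1.*2.+1 < d)%N.
Proof.
by move=> id; have := odd_double_half d; rewrite (negbTE ed) /= -!mul2n; lia.
Qed.

(** The witness u is the alternating sum of the monomials walk a for a < n,
    and l is the alternating sum of the coefficients at these monomials. By
    walk_step both u g and l (h g) telescope, and l u = n is nonzero in F_p.
    *)
Lemma quadric_colength_strict_even :
  (quadric_colength p d p 2 <
   quadric_colength p d p 1 + quadric_colength p d p 1)%N.
Proof.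
pose l (f : S) : K := \sum_(a < n) (-1) ^+ a * f (al a).
pose u : S := \sum_(a < n) (-1) ^+ a * monomial K (al a).
have MZal a : (a.+1 < n)%N -> MZ <=m al a.
  move=> an; apply/mnm_lepP => i; rewrite /MZ mulmnE mnm1_inordE //.
  case: (eqVneq d (i : nat)) => [di|_]; last by rewrite mul0n.
  by rewrite walk_max // mul1n -mul2n; lia.
apply: (@quadric_colength_strict_functional p d u l).
- by move=> f h; rewrite /l -sumrB; apply: eq_bigr => a _; rewrite -mulrBr.
- move=> f fp; rewrite /l big1 // => a _; rewrite fp ?mulr0 // => i.
  exact: walk_box.
- move=> h.
  pose t a := (monomial K M01 * h) (al a); pose s a := (monomial K MZ * h) (al a).
  have E a : (h * A1_equation p d) (al a) = t a + s a.
    rewrite mulrC A1_equationE_even mulrDl psD; congr (_ + _).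
    rewrite mulr_suml ps_sum big_ord_recl big1 ?addr0 // => i _.
    have id := half_lt (ltn_ord i); pose j : 'I_d.+1 := inord i.+1.*2.+1.
    have jE : j = i.+1.*2.+1 :> nat by rewrite inordK // leqW.
    have i0 : (lift ord0 i = i.+1 :> nat) by [].
    rewrite monomialME i0; case: ifP => // /mnm_lepP /(_ j).
    rewrite (walk_odd _ jE) ?jE // mnmDE !mnm1_inordE ?(ltnW id) ?(ltnW (ltnW id)) //.
    by rewrite jE eqxx addnC.
  have t0 : t 0%N = 0.
    rewrite /t monomialME; case: ifP => // /mnm_lepP /(_ (inord 1)).
    by rewrite /M01 mnmDE !mnm1_inordE ?(ltnW d2) // walk_1 ?(inordK d1).
  have st b : (b.+1 < n)%N -> s b = t b.+1.
    move=> an; have k1 := submK (MZal b an); set k := al b -m MZ in k1.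
    have k2 : k +m M01 = al b.+1.
      by apply: (@addIm _ MZ); rewrite -addmA [M01 +m MZ]addmC addmA k1 walk_step.
    by rewrite /s /t -k1 -k2 !monomialDE.
  have s1 : s n.-1 = 0.
    rewrite /s monomialME; case: ifP => // /mnm_lepP /(_ (inord d)).
    by rewrite /MZ mulmnE mnm1_inordE // walk_max inordK // eqxx subnn.
  (* The a-th term of l (h g) is T a.+1 - T a. *)
  pose T a := if (a < n)%N then - ((-1) ^+ a * t a) else 0.
  transitivity (\sum_(0 <= a < n) (T a.+1 - T a)).
    rewrite big_mkord; apply: eq_bigr => a _; rewrite E /T ltn_ord opprK.
    case: ifP => an; first by rewrite st // mulrDr addrC exprS mulN1r mulNr opprK.
    have -> : (a : nat) = n.-1 by have := ltn_ord a; move/negbT: an; lia.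
    by rewrite s1 addr0 add0r.
  by rewrite telescope_sumr // /T ltnn n0 t0 mulr0 oppr0 subr0.
- have idb := @box_ideal_ideal d.+1 p p.
  (* W a and W a.+1 are the two monomials of (x_0 x_1 + x_d^2) x^(walk a). *)
  pose W a := if a is b.+1 then al b +m M01 else al 0 +m MZ.
  have WE a : (a < n)%N -> al a +m MZ = W a.
    by case: a => [//|b] bn; rewrite /W walk_step.
  pose V a : S := - ((-1) ^+ a * monomial K (W a)).
  have uE a : (a < n)%N -> box_ideal p
      ((-1) ^+ a * monomial K (al a) * A1_equation p d - (V a.+1 - V a)).
    move=> an; rewrite A1_equationE_even big_ord_recl /= [_ + monomial K MZ]addrAC mulrDr.
    have -> : (-1) ^+ a * monomial K (al a) * (monomial K M01 + monomial K MZ) = V a.+1 - V a :> S.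
      rewrite -mulrA mulrDr !monomialM WE // /V exprS mulN1r mulNr !opprK.
      by rewrite mulrDr.
    rewrite [_ - _ + _]addrC addrK.
    rewrite mulr_sumr; apply: (subgroup_sum _ (ideal_subgroup idb)) => i _.
    rewrite -mulrA; apply: (idealMl _ idb); rewrite monomialM.
    have id := half_lt (ltn_ord i); pose j : 'I_d.+1 := inord i.+1.*2.
    have jE : j = i.+1.*2 :> nat by rewrite inordK // leqW // ltnW.
    have i0 : bump 0 i = i.+1 by [].
    have jd : (j < d)%N by rewrite jE ltnW.
    apply: (@monomial_in_box _ _ _ j); rewrite i0 !mnmDE (walk_even _ jE jd).
    by rewrite !mnm1_inordE ?(ltnW id) ?(ltnW (ltnW id)) // jE eqxx; move: p_gt3; lia.
  have -> : u * A1_equation p d = \sum_(a < n) ((-1) ^+ a * monomial K (al a) *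
      A1_equation p d - (V a.+1 - V a)) + (V n - V 0%N).
    rewrite mulr_suml sumrB -(telescope_sumr V (leq0n n)) big_mkord.
    by rewrite subrK.
  apply: (idealD idb).
    by apply: (subgroup_sum _ (ideal_subgroup idb)) => a _; apply: uE.
  have Vbox a : box_ideal p (monomial K (W a)) -> box_ideal p (V a).
    by move=> Wa; apply: (subgroupN (ideal_subgroup idb)); apply: (idealMl _ idb).
  apply: (ideal_subgroup idb).2; apply: Vbox.
    rewrite -(prednK n0) /=; apply: (@monomial_in_box _ _ _ (inord 0)).
    rewrite mnmDE walk_0 ?inordK // /M01 mnmDE !mnm1_inordE ?(ltnW d2) // inordK //.
    by have := pn; have := n0; rewrite -!mul2n /=; lia.
  apply: (@monomial_in_box _ _ _ (inord d)).
  rewrite mnmDE walk_max ?inordK // /MZ mulmnE mnm1_inordE // inordK // eqxx.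
  by have := pn; have := n0; rewrite -!mul2n /=; lia.
- have -> : l u = n%:R.
    rewrite /l -[n in RHS]card_ord -sumr_const; apply: eq_bigr => a _.
    rewrite /u ps_sum (bigD1 a) //= big1 ?addr0 => [|b ba].
      by rewrite ps_sign /monomial eqxx mulr1 -expr2 sqrr_sign.
    rewrite ps_sign /monomial; case: eqP => [/walk_inj e|_]; last by rewrite mulr0.
    by case/eqP: ba; apply: val_inj.
  rewrite -(dvdn_pcharf (pchar_Fp p_prime)) gtnNdvd //.
  by have := pn; have := n0; rewrite -!mul2n; lia.
Qed.

End Even.
End Witness.

Lemma quadric_colength_strictly_concave d : (0 < d)%N ->
  (quadric_colength p d p 2 <
   quadric_colength p d p 1 + quadric_colength p d p 1)%N.
Proof.
move=> d0; case od: (odd d); first exact: quadric_colength_strict_odd.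
by apply: quadric_colength_strict_even; rewrite ?od //; case: d d0 od => [|[|]].
Qed.

End JordanBlock.

(** * Concave sequences *)

Section Blocks.
Local Open Scope nat_scope.

Lemma block_val n q j : j < n -> block n q j = q %/ n + (j < q %% n).
Proof.
move=> jn; have n0 : 0 < n by apply: leq_ltn_trans jn.
rewrite /block {1}(divn_eq q n).
have rn := ltn_pmod q n0.
have -> : q %/ n * n + q %% n + n.-1 - j = q %/ n * n + (q %% n + n.-1 - j) by lia.
rewrite divnMDl //; congr (_ + _); case: ltnP => jr.
  have -> : q %% n + n.-1 - j = 1 * n + (q %% n - j).-1 by lia.
  by rewrite divnMDl // divn_small //; lia.
by rewrite divn_small //; lia.
Qed.

Lemma sum_lt n r : \sum_(j < n) (j < r) = minn n r.
Proof.
elim: n => [|n IHn]; first by rewrite big_ord0 min0n.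
by rewrite big_ord_recr /= IHn; case: ltnP => nr; lia.
Qed.

Lemma sum_block n q : 0 < n -> \sum_(j < n) block n q j = q.
Proof.
move=> n0; rewrite (eq_bigr (fun j : 'I_n => q %/ n + (j < q %% n))); last first.
  by move=> j _; rewrite block_val.
rewrite big_split /= sum_lt sum_nat_const card_ord (minn_idPr _) ?(ltnW (ltn_pmod _ _)) //.
by rewrite mulnC -divn_eq.
Qed.

Lemma thirds s q h b : q = 2 * h + 1 -> 5 <= s -> 5 * s <= q -> 3 * b <= q + 2 ->
  [/\ b <= h, h - s <= 6 * (h - b), s < h & 2 * s <= h].
Proof. by move=> -> *; split; lia. Qed.

Lemma block3_bounds s q j : j < 3 -> 5 <= s -> 5 * s <= q ->
  s <= block 3 q j /\ 3 * block 3 q j <= q + 2.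
Proof.
move=> j3; rewrite block_val //.
have := divn_eq q 3; have := ltn_pmod q (isT : 0 < 3); case: ltnP; lia.
Qed.

End Blocks.

Section Concave.
Variables (R : realFieldType) (f : nat -> R).
Hypothesis fc : forall b, f b + f b.+2 <= f b.+1 + f b.+1.

Let slope_mono i j : (i <= j)%N -> f j.+1 - f j <= f i.+1 - f i.
Proof.
move=> /subnKC <-; elim: (j - i)%N => [|k IHk]; first by rewrite addn0.
by apply: le_trans IHk; rewrite addnS; have := fc (i + k); lra.
Qed.

Lemma concave_tangent t x : f x <= f t + (f t.+1 - f t) * (x%:R - t%:R).
Proof.
have natS k : (k.+1%:R : R) = k%:R + 1 by rewrite -addn1 natrD.
case: (leqP t x) => [tx|/ltnW xt].
  rewrite -(subnKC tx); elim: (x - t)%N => [|k IHk].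
    by rewrite addn0 subrr mulr0 addr0.
  have := slope_mono (leq_addr k t); rewrite addnS natS.
  by move: IHk; set s := f t.+1 - f t; lra.
rewrite -(subnKC xt); elim: (t - x)%N => [|k IHk].
  by rewrite addn0 subrr mulr0 addr0.
have := slope_mono (leqnSn (x + k)); rewrite addnS natS natrD.
set s := f (x + k).+2 - _ => sl.
have : (k%:R + 1) * s <= (k%:R + 1) * (f (x + k).+1 - f (x + k)) by rewrite ler_wpM2l // addr_ge0.
by move: IHk; rewrite natrD; lra.
Qed.

Lemma concave_chord x y z : (x <= y)%N -> (y <= z)%N ->
  (z%:R - y%:R) * f x + (y%:R - x%:R) * f z <= (z%:R - x%:R) * f y.
Proof.
move=> xy yz; have := concave_tangent y x; have := concave_tangent y z.
have : (x%:R : R) <= y%:R by rewrite ler_nat.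
have : (y%:R : R) <= z%:R by rewrite ler_nat.
set X := (x%:R : R); set Y := y%:R; set Z := z%:R; set s := _ - f y => YZ XY fz fx.
have h1 : (Z - Y) * f x <= (Z - Y) * (f y + s * (X - Y)) by rewrite ler_wpM2l // subr_ge0.
have h2 : (Y - X) * f z <= (Y - X) * (f y + s * (Z - Y)) by rewrite ler_wpM2l // subr_ge0.
lra.
Qed.

(** The parts of the balanced partition lie on one edge of the graph of f, and
    the line through this edge bounds f from above. *)
Lemma concave_balanced n q (x : 'I_n -> nat) : (0 < n)%N -> (\sum_j x j = q)%N ->
  \sum_j f (x j) <= \sum_(j < n) f (block n q j).
Proof.
move=> n0 xq; pose t := (q %/ n)%N; pose s := f t.+1 - f t.
have -> : \sum_(j < n) f (block n q j) = \sum_(j < n) (f t + s * ((block n q j)%:R - t%:R)).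
  apply: eq_bigr => j _; rewrite block_val //; case: ltnP => _.
    by rewrite addn1 /s -(addn1 t) natrD; lra.
  by rewrite addn0 subrr mulr0 addr0.
apply: (@le_trans _ _ (\sum_j (f t + s * ((x j)%:R - t%:R)))).
  by apply: ler_sum => j _; apply: concave_tangent.
rewrite !big_split /= -!mulr_sumr !big_split /= -!natr_sum xq.
by rewrite sum_block.
Qed.

End Concave.

(** * Comparison of the limits *)

Section Limits.
Variables (R : realType) (p d : nat) (F : nat -> nat -> nat).
Hypotheses (p_odd : odd p) (p_gt3 : (3 < p)%N).
Hypothesis F0 : forall e, F e 0 = 0%N.
Hypothesis F_concave : forall e b, (F e b + F e b.+2 <= F e b.+1 + F e b.+1)%N.
Hypothesis F_le : forall e b, (F e b <= (p ^ e) ^ d)%N.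
Hypothesis F_frob : forall e b, F e.+1 (b * p) = (p ^ d * F e b)%N.
Hypothesis F_strict : (F 1 2 < F 1 1 + F 1 1)%N.

Definition block_sum n e : nat := (\sum_(j < n) F e (block n (p ^ e) j))%N.
Definition normalized_sum n : nat -> R := fun e => (block_sum n e)%:R / (p ^ (e * d))%:R.

Let p0 : (0 < p)%N. Proof. exact: leq_trans p_gt3. Qed.

Let pe0 k : 0 < ((p ^ k)%:R : R).
Proof. by rewrite ltr0n expn_gt0 p0. Qed.

Let fc e b : ((F e b)%:R : R) + (F e b.+2)%:R <= (F e b.+1)%:R + (F e b.+1)%:R.
Proof. by rewrite -!natrD ler_nat. Qed.

(** Multiplied by p, the balanced partition of p^e becomes a partition of
    p^(e+1) into n parts, which the balanced one dominates. *)
Lemma block_sum_frobenius n e : (0 < n)%N -> (p ^ d * block_sum n e <= block_sum n e.+1)%N.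
Proof.
move=> n0; rewrite -(ler_nat R) /block_sum big_distrr /= !natr_sum.
rewrite (eq_bigr (fun j : 'I_n => (F e.+1 (block n (p ^ e) j * p))%:R)); last first.
  by move=> j _; rewrite F_frob.
apply: (concave_balanced (fc e.+1)) => //.
by rewrite -big_distrl /= sum_block // expnSr.
Qed.

Lemma normalized_sum_nondecreasing n : (0 < n)%N -> nondecreasing_seq (normalized_sum n).
Proof.
move=> n0; apply/nondecreasing_seqP => e; rewrite /normalized_sum.
rewrite ler_pdivrMr // mulrAC ler_pdivlMr //.
rewrite -!natrM ler_nat mulSn expnD.
have := block_sum_frobenius e n0; nia.
Qed.

Lemma normalized_sum_le n e : normalized_sum n e <= n%:R.
Proof.
rewrite ler_pdivrMr // -natrM ler_nat.
apply: (@leq_trans (\sum_(j < n) (p ^ e) ^ d)%N); first by apply: leq_sum.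
by rewrite sum_nat_const card_ord -expnM.
Qed.

Lemma normalized_sum_cvg n : (0 < n)%N -> cvgn (normalized_sum n).
Proof.
move=> n0; apply: nondecreasing_is_cvgn; first exact: normalized_sum_nondecreasing.
by exists n%:R => _ [e _ <-]; apply: normalized_sum_le.
Qed.

Lemma F_frob_iter k b : F k.+1 (b * p ^ k) = (p ^ (k * d) * F 1 b)%N.
Proof.
elim: k => [|k IHk]; first by rewrite expn0 muln1 mul1n.
by rewrite expnSr mulnA F_frob IHk mulnA -expnD mulSn.
Qed.

(** Subtract from F the linear function for which the two values next to the
    middle of [0, q] have sum 0. The difference chi is concave and vanishes at
    0. Strict concavity at level p makes it positive at s = q / p, and the
    chord from s to the middle keeps it positive near q / 3. *)
Lemma block_sum_gap k : (0 < k)%N ->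
  4%:R * ((block_sum 2 k.+1)%:R : R) + (p ^ (k * d))%:R <= 4%:R * (block_sum 3 k.+1)%:R.
Proof.
move=> k0; set q := (p ^ k.+1)%N; set s := (p ^ k)%N; set h := (q./2)%N.
have qs : q = (s * p)%N by rewrite /q expnSr.
have qh : q = (2 * h + 1)%N.
  have := odd_double_half q; rewrite /q oddX p_odd orbT -/q -/h -mul2n; lia.
have s5 : (5 <= s)%N.
  have p5 : (5 <= p)%N.
    by move: p_gt3 p_odd; rewrite leq_eqVlt => /orP [/eqP <-|].
  by apply: leq_trans p5 _; rewrite /s -[X in (X <= _)%N]expn1 leq_pexp2l.
have s5q : (5 * s <= q)%N.
  rewrite qs mulnC leq_mul2l; apply/orP; right.
  by move: p_gt3 p_odd; rewrite leq_eqVlt => /orP [/eqP <-|].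
pose f b := ((F k.+1 b)%:R : R).
have fcc b : f b + f b.+2 <= f b.+1 + f b.+1 := fc k.+1 b.
have f0 : f 0%N = 0 by rewrite /f F0.
pose M := ((p ^ (k * d))%:R : R).
have fs : f (2 * s)%N + M <= f s + f s.
  rewrite /f -[s in X in _ <= X]mul1n !F_frob_iter /M -!natrD ler_nat.
  by rewrite -mulnDr -[X in (_ + X)%N]muln1 -mulnDr leq_mul2l addn1 F_strict orbT.
have q0 : 0 < (q%:R : R) by exact: pe0.
(* q = h + (h + 1), so chi h + chi h.+1 = 0. *)
pose m := (f h + f h.+1) / q%:R; pose chi b := f b - m * b%:R.
have natS b : (b.+1%:R : R) = b%:R + 1 by rewrite -addn1 natrD.
have chic b : chi b + chi b.+2 <= chi b.+1 + chi b.+1.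
  by rewrite /chi !natS; have := fcc b; lra.
have chi0 : chi 0%N = 0 by rewrite /chi f0 mulr0 subrr.
have qhR : (q%:R : R) = 2%:R * h%:R + 1 by rewrite {1}qh natrD natrM.
have mq : m * q%:R = f h + f h.+1 by rewrite /m divfK // gt_eqF.
have chih : chi h + chi h.+1 = 0.
  by rewrite /chi natS; move: mq; rewrite qhR; lra.
have h0 : 0 <= (h%:R : R) by [].
have chih0 : 0 <= chi h.
  have := concave_chord chic (leq0n h) (leqnSn h); rewrite chi0 natS.
  have -> : chi h.+1 = - chi h by move: chih; lra.
  move=> c; have : 0 <= (2%:R * h%:R + 1) * chi h by move: c; lra.
  by rewrite pmulr_rge0 //; lra.
have [_ _ _ sh] : [/\ 0 <= h, h - s <= 6 * (h - 0), s < h & 2 * s <= h]%N.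
  exact: (thirds qh s5 s5q).
have chi2s : 0 <= chi (2 * s)%N.
  have := concave_chord chic (leq0n (2 * s)) sh; rewrite chi0 !subr0 mulr0 add0r => c.
  have hp : 0 < (h%:R : R) by rewrite ltr0n (leq_trans _ sh) // muln_gt0 (leq_trans _ s5).
  rewrite -(pmulr_rge0 _ hp); apply: le_trans c.
  by rewrite mulr_ge0.
have chis : M <= 2%:R * chi s.
  by move: fs chi2s; rewrite /chi natrM; lra.
have M0 : 0 <= M by [].
have chib b : (s <= b)%N -> (3 * b <= q + 2)%N -> M <= 12%:R * chi b.
  move=> sb bq; have [bh r6 hs' _] := thirds qh s5 s5q bq.
  have c := concave_chord chic sb bh.
  have r6R : (h%:R : R) - s%:R <= 6%:R * (h%:R - b%:R).
    by rewrite -!natrB ?(leq_trans sb) // -natrM ler_nat.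
  have hs : 0 < (h%:R : R) - s%:R by rewrite subr_gt0 ltr_nat.
  have bs : 0 <= (b%:R : R) - s%:R by rewrite subr_ge0 ler_nat.
  have hb : 0 <= (h%:R : R) - b%:R by rewrite subr_ge0 ler_nat.
  have c2 : 0 <= (b%:R - s%:R) * chi h by rewrite mulr_ge0.
  have c3 : (h%:R - b%:R) * M <= (h%:R - b%:R) * (2%:R * chi s) by rewrite ler_wpM2l.
  have c4 : (h%:R - s%:R) * M <= 6%:R * (h%:R - b%:R) * M by rewrite ler_wpM2r.
  rewrite -(ler_pM2l hs); lra.
have E2 : ((block_sum 2 k.+1)%:R : R) = m * q%:R.
  rewrite mq /block_sum natr_sum !big_ord_recl big_ord0 /= !block_val // -/q.
  have -> : (q %/ 2 = h)%N by rewrite divn2.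
  have -> : (q %% 2 = 1)%N by rewrite modn2 /q oddX p_odd orbT.
  by rewrite /= addn1 addn0 addr0 addrC.
have E3 : ((block_sum 3 k.+1)%:R : R) = m * q%:R + \sum_(j < 3) chi (block 3 q j).
  have Sb : \sum_(j < 3) ((block 3 q j)%:R : R) = q%:R by rewrite -natr_sum sum_block.
  by rewrite /chi sumrB -mulr_sumr Sb addrC subrK /block_sum natr_sum.
have S3 : 3%:R * M <= 12%:R * \sum_(j < 3) chi (block 3 q j).
  rewrite mulr_sumr; have -> : 3%:R * M = \sum_(j < 3) M.
    by rewrite sumr_const card_ord mulr_natl.
  apply: ler_sum => j _; have [] := block3_bounds (ltn_ord j) s5 s5q; exact: chib.
rewrite E2 E3 -/M; lra.
Qed.

Lemma normalized_sum_lim : limn (normalized_sum 2) < limn (normalized_sum 3).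
Proof.
pose eps : R := (4 * p ^ d)%:R^-1.
have eps0 : 0 < eps by rewrite invr_gt0 ltr0n muln_gt0 expn_gt0 p0.
apply: (@lt_le_trans _ _ (limn (normalized_sum 2) + eps)); first by rewrite ltrDl.
have c2 := @normalized_sum_cvg 2 isT; have c3 := @normalized_sum_cvg 3 isT.
have ceps : (fun=> eps) @ \oo --> eps by exact: cvg_cst.
have c2e : (normalized_sum 2 \+ (fun=> eps)) @ \oo --> limn (normalized_sum 2) + eps by exact: cvgD c2 ceps.
rewrite -(cvg_lim (@Rhausdorff R) c2e); apply: ler_lim => //.
  by apply/cvg_ex; exists (limn (normalized_sum 2) + eps).
exists 2%N => // -[|[|k]] //= _.
rewrite /normalized_sum -(ler_pM2r (pe0 (k.+2 * d))) mulrDl !divfK ?gt_eqF //.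
have := @block_sum_gap k.+1 isT; set A := (block_sum 2 _)%:R; set B := (block_sum 3 _)%:R.
have -> : eps * (p ^ (k.+2 * d))%:R = (p ^ (k.+1 * d))%:R / 4%:R.
  rewrite mulSn expnD natrM /eps natrM invfM -mulrA mulKf ?gt_eqF //.
  by rewrite mulrC.
move=> gap; rewrite -(ler_pM2l (ltr0Sn R 3)) mulrDr.
by rewrite [4%:R * (_ / _)]mulrC divfK ?pnatr_eq0.
Qed.

End Limits.

(** * The singularities A_1 and A_2 *)

Section Equations.
Variables (p d : nat).
Hypothesis d2 : (2 <= d)%N.
Local Notation K := 'F_p.
Local Notation U i := (mnm1 (inord i : 'I_d.+1)).

Let mu := U 0 +m U 1.

Lemma power_coeff i c : (2 <= c)%N -> (monomial K (U i) ^+ c : mpser d.+1 K) mu = 0.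
Proof.
move=> c2; rewrite monomialX /monomial; case: eqP => // e.
have := congr1 (fun m : multinom d.+1 => m (inord i)) e.
rewrite mulmnE /mu mnmDE !mnm1E eqxx mul1n => ec; move: c2; rewrite -ec.
case: eqP => [i0|_]; case: eqP => [i1|_] //.
by have := congr1 val (etrans i0 (esym i1)); rewrite /= !inordK // ltnS ltnW.
Qed.

Lemma power_const i c : (0 < c)%N -> (monomial K (U i) ^+ c : mpser d.+1 K) mnm0 = 0.
Proof.
move=> c0; rewrite monomialX /monomial; case: eqP => // e.
have := congr1 (fun m : multinom d.+1 => m (inord i)) e.
by rewrite mulmnE mnm0E mnm1E eqxx mul1n => ec; rewrite -ec in c0.
Qed.

(** The coefficient of x_0 x_1 shows that the equations do not vanish. *)
Lemma hyperbolic_coeff k : (0 < k)%N -> (k.*2 <= d.+1)%N ->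
  hyperbolic_sum p d k mu = 1.
Proof.
case: k => // k _ kd; rewrite hyperbolicE ps_sum big_ord_recl big1 => [|i _].
  by rewrite addr0 /monomial eqxx.
rewrite /monomial; case: eqP => // e.
have := congr1 (fun m : multinom d.+1 => m (inord 0)) e.
have ik := ltn_ord i; rewrite /= /bump /= add1n.
have id : (i.+1.*2.+1 <= d)%N by move: kd ik; rewrite -!mul2n; lia.
by rewrite /mu !mnmDE !mnm1_inordE ?(ltnW d2) ?(ltnW id) // inordK.
Qed.

Lemma hyperbolic_const k : hyperbolic_sum p d k mnm0 = 0.
Proof.
rewrite hyperbolicE ps_sum big1 // => i _; rewrite /monomial eq_sym mnmD_eq0.
by rewrite mnm1_eq0.
Qed.

Let one_Fp : (1 : K) <> 0.
Proof. exact/eqP/oner_neq0. Qed.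

Lemma A1_equation_neq0 : A1_equation p d != 0.
Proof.
apply/eqP => /(congr1 (fun f : mpser d.+1 K => f mu)); rewrite /A1_equation.
case: ifP => od.
  by rewrite hyperbolic_coeff ?double_half_le //; case: d d2 => [|[]].
rewrite psD xvarE power_coeff // addr0 hyperbolic_coeff; first exact: one_Fp.
  by case: d d2 => [|[]].
by rewrite leqW ?double_half_le.
Qed.

Lemma A1_equation_const : A1_equation p d mnm0 = 0.
Proof.
rewrite /A1_equation; case: ifP => od; rewrite ?psD hyperbolic_const //.
by rewrite xvarE power_const // addr0.
Qed.

Lemma A2_equation_neq0 : A2_equation p d != 0.
Proof.
apply/eqP => /(congr1 (fun f : mpser d.+1 K => f mu)); rewrite /A2_equation.
case: ifP => od.
  rewrite !psD !xvarE !power_coeff // !addr0 hyperbolic_coeff; first exact: one_Fp.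
    by case: d d2 od => [|[|[]]].
  by apply: leq_trans (double_half_le _) _; case: d => // d'; apply: leqW.
rewrite psD xvarE power_coeff // addr0 hyperbolic_coeff; first exact: one_Fp.
  by case: d d2 => [|[]].
by rewrite leqW ?double_half_le.
Qed.

Lemma A2_equation_const : A2_equation p d mnm0 = 0.
Proof.
rewrite /A2_equation; case: ifP => od; rewrite !psD hyperbolic_const !xvarE !power_const //;
  by rewrite !addr0.
Qed.

End Equations.

Lemma eHK_hypersurface (R : realType) (p d : nat) (Q : mpser d.+2 'F_p)
    (u : nat -> nat) :
  prime p -> Q != 0 -> Q mnm0 = 0 ->
  (forall e, colength p (add_gen (@box_ideal d.+2 p (p ^ e)) Q) = u e) ->
  eHK R (quo [set Q]) p = limn (fun e => (u e)%:R / (p ^ (e * d.+1))%:R : R).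
Proof.
move=> pp Q0 Qm Qu; rewrite /eHK krull_dim_hypersurface //.
by congr (limn _); apply/funext => e; rewrite HK_colength // Qu.
Qed.

Theorem theorem2p14 (R : realType) (p d : nat) (p_prime : prime p)
    (p_gt3 : (3 < p)%N) (d_ge2 : (2 <= d)%N) :
  eHK R (A2_singularity p d) p > eHK R (A1_singularity p d) p.
Proof.
case: d d_ge2 => // d d_gt0.
pose F e b := quadric_colength p d (p ^ e) b.
have E1 : eHK R (A1_singularity p d.+1) p = limn (normalized_sum R p d.+1 F 2).
  exact: (eHK_hypersurface R p_prime (A1_equation_neq0 _ d_gt0)
    (A1_equation_const _ _) (A1_colength p_prime p_gt3 d)).
have E2 : eHK R (A2_singularity p d.+1) p = limn (normalized_sum R p d.+1 F 3).
  exact: (eHK_hypersurface R p_prime (A2_equation_neq0 _ d_gt0)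
    (A2_equation_const _ _) (fun e => A2_colength p_prime p_gt3 d (p ^ e))).
have lt_eq (x y x' y' : R) : x = x' -> y = y' -> x' < y' -> x < y by move=> -> ->.
apply: (lt_eq _ _ _ _ E1 E2); apply: normalized_sum_lim.
- exact: odd_p.
- exact: p_gt3.
- by move=> e; apply: quadric_colength0.
- by move=> e b; apply: quadric_colength_concave.
- by move=> e b; apply: quadric_colength_le.
- by move=> e b; rewrite /F expnSr quadric_colength_frobenius.
- by rewrite /F expn1; apply: quadric_colength_strictly_concave.
Qed.
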